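(* Let $f\in\mathrm{BMOSH}(\mathbb{D})$. Then the following statements are equivalent. (i) $f\in\mathrm{VMOSH}(\mathbb{D})$. (ii) The functions $f_r$, defined for $r\in[0,1]$ by $f_r(s):=f(rs)$, tend to $f$ in $\mathrm{BMOSH}(\mathbb{D})$ as $r\to1^-$. (iii) $f$ belongs to the $\mathrm{BMOSH}(\mathbb{D})$-closure of $\mathcal{A}(\mathbb{D}):=\{g\in\mathcal{SH}_L(\mathbb{D}): g\text{ has a continuous extension to }\overline{\mathbb{D}}\}$. (iv) $f$ belongs to the $\mathrm{BMOSH}(\mathbb{D})$-closure of the set of left slice hyperholomorphic polynomials. Consequently, $\mathrm{VMOSH}(\mathbb{D})$ is a closed subspace of $\mathrm{BMOSH}(\mathbb{D})$.
   Context: Let $\mathbb{H}$ be the quaternions, $\mathbb{S}=\{x\in\mathbb{H}:\mathrm{Re}(x)=0,|x|=1\}$, $\mathbb{C}_i=\{x_0+ix_1:x_0,x_1\in\mathbb{R}\}$ for $i\in\mathbb{S}$, $\mathbb{D}$ the open unit ball of $\mathbb{H}$, $\mathbb{D}_i=\mathbb{D}\cap\mathbb{C}_i$. Every $x\in\mathbb{H}$ is written $x=x_0+i_xx_1$ with $x_0=\mathrm{Re}(x)$, $x_1=|\mathrm{Im}(x)|\ge 0$, $i_x\in\mathbb{S}$. A real differentiable $f:\mathbb{D}\to\mathbb{H}$ is (left) slice hyperholomorphic, $f\in\mathcal{SH}_L(\mathbb{D})$, if $f(x)=\alpha(x_0,x_1)+i_x\beta(x_0,x_1)$ for all $x\in\mathbb{D}$,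 where the $\mathbb{H}$-valued functions $\alpha,\beta$ satisfy $\alpha(x_0,-x_1)=\alpha(x_0,x_1)$, $\beta(x_0,-x_1)=-\beta(x_0,x_1)$, $\partial_{x_0}\alpha=\partial_{x_1}\beta$, $\partial_{x_0}\beta=-\partial_{x_1}\alpha$. Left slice hyperholomorphic polynomials are the functions $x\mapsto\sum_{n=0}^Nx^na_n$ with $a_n\in\mathbb{H}$. $\mathcal{H}^2(\mathbb{D})$ is the set of $f\in\mathcal{SH}_L(\mathbb{D})$ with $\sup_{i\in\mathbb{S}}\lim_{r\nearrow1}\frac1{2\pi}\int_0^{2\pi}|f(re^{i\theta})|^2\,d\theta<\infty$; boundary values $f(e^{i\theta})$ are radial limits (existing for almost every $\theta$). For $f\in\mathcal{H}^2(\mathbb{D})$, $i\in\mathbb{S}$ and an interval $I=(\alpha,\beta)\subset\mathbb{R}$ with $|I|=\beta-\alpha\le2\pi$, let $f_{I,i}=\frac1{|I|}\int_If(e^{i\theta})\,d\theta$, and put $|f|_{\mathrm{BMOSH}(\mathbb{D}_i)}^2=\sup_{|I|\le2\pi}\frac1{|I|}\int_I|f(e^{i\theta})-f_{I,i}|^2\,d\theta$, $|f|_{\mathrm{BMOSH}(\mathbb{D})}=\sup_{i\in\mathbb{S}}|f|_{\mathrm{BMOSH}(\mathbb{D}_i)}$. $\mathrm{BMOSH}(\mathbb{D})$ is the set of $f\in\mathcal{H}^2(\mathbb{D})$ with $|f|_{\mathrm{BMOSH}(\mathbb{D})}<\infty$, with norm $\|f\|_{\mathrm{BMOSH}(\mathbb{D})}=|f(0)|+|f|_{\mathrm{BMOSH}(\mathbb{D})}$;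 convergence and closure in $\mathrm{BMOSH}(\mathbb{D})$ refer to this norm. $\mathrm{VMOSH}(\mathbb{D})$ is the set of $f\in\mathrm{BMOSH}(\mathbb{D})$ such that $\lim_{|I|\to0}\frac1{|I|}\int_I|f(e^{i\theta})-f_{I,i}|^2\,d\theta=0$ (uniformly over intervals $I\subset\mathbb{R}$ of length $|I|$) for all $i\in\mathbb{S}$. *)

(* Defs.v *)
From HB Require Import structures.
From mathcomp Require Import all_boot all_order all_algebra.
From mathcomp Require Import ring lra.
From mathcomp Require Import all_classical all_reals all_analysis.

Set Implicit Arguments.
Unset Strict Implicit.
Unset Printing Implicit Defensive.

Import Order.TTheory GRing.Theory Num.Theory.
Import numFieldNormedType.Exports.

Local Open Scope classical_set_scope.
Local Open Scope ring_scope.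

Record quat (R : Type) := Quat { qre : R; qi : R; qj : R; qk : R }.

Section quat_structures.
Context {R : realType}.
Implicit Types x y z : quat R.

Definition quat_tuple x := (qre x, qi x, qj x, qk x).
Definition tuple_quat (t : R * R * R * R) :=
  Quat t.1.1.1 t.1.1.2 t.1.2 t.2.
Lemma quat_tupleK : cancel quat_tuple tuple_quat.
Proof. by case. Qed.

HB.instance Definition _ := Choice.copy (quat R) (can_type quat_tupleK).

Lemma quatP x y :
  qre x = qre y -> qi x = qi y -> qj x = qj y -> qk x = qk y -> x = y.
Proof. by case: x => ????; case: y => ???? /= -> -> -> ->. Qed.

Definition qzero : quat R := Quat 0 0 0 0.
Definition qadd x y :=
  Quat (qre x + qre y) (qi x + qi y) (qj x + qj y) (qk x + qk y).
Definition qopp x := Quat (- qre x) (- qi x) (- qj x) (- qk x).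
Definition qscale (a : R) x := Quat (a * qre x) (a * qi x) (a * qj x) (a * qk x).
Definition qone : quat R := Quat 1 0 0 0.
Definition qmul x y :=
  Quat (qre x * qre y - qi x * qi y - qj x * qj y - qk x * qk y)
       (qre x * qi y + qi x * qre y + qj x * qk y - qk x * qj y)
       (qre x * qj y - qi x * qk y + qj x * qre y + qk x * qi y)
       (qre x * qk y + qi x * qj y - qj x * qi y + qk x * qre y).
Definition qnorm x :=
  Num.sqrt (qre x ^+ 2 + qi x ^+ 2 + qj x ^+ 2 + qk x ^+ 2).

Fact qaddA : associative qadd.
Proof. by move=> x y z; apply: quatP => /=; rewrite addrA. Qed.
Fact qaddC : commutative qadd.
Proof. by move=> x y; apply: quatP => /=; rewrite addrC. Qed.
Fact qadd0 : left_id qzero qadd.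
Proof. by move=> x; apply: quatP => /=; rewrite add0r. Qed.
Fact qaddN : left_inverse qzero qopp qadd.
Proof. by move=> x; apply: quatP => /=; rewrite addNr. Qed.

HB.instance Definition _ :=
  GRing.isZmodule.Build (quat R) qaddA qaddC qadd0 qaddN.

Fact qscaleA a b x : qscale a (qscale b x) = qscale (a * b) x.
Proof. by apply: quatP => /=; rewrite mulrA. Qed.
Fact qscale1 : left_id 1 qscale.
Proof. by move=> x; apply: quatP => /=; rewrite mul1r. Qed.
Fact qscaleDr : right_distributive qscale +%R.
Proof. by move=> a x y; apply: quatP => /=; rewrite mulrDr. Qed.
Fact qscaleDl x : {morph qscale^~ x : a b / a + b}.
Proof. by move=> a b; apply: quatP => /=; rewrite mulrDl. Qed.

HB.instance Definition _ := GRing.Zmodule_isLmodule.Build R (quat R)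
  qscaleA qscale1 qscaleDr qscaleDl.

Fact qnormD x y : qnorm (x + y) <= qnorm x + qnorm y.
Proof.
have n0 z : 0 <= qre z ^+ 2 + qi z ^+ 2 + qj z ^+ 2 + qk z ^+ 2.
  by rewrite !addr_ge0 ?sqr_ge0.
rewrite -(@ler_pXn2r _ 2) ?nnegrE ?addr_ge0 ?sqrtr_ge0// sqrrD !sqr_sqrtr//.
set c := qre x * qre y + qi x * qi y + qj x * qj y + qk x * qk y.
suff h : c <= qnorm x * qnorm y.
  rewrite (_ : _ + _ = qre x ^+ 2 + qi x ^+ 2 + qj x ^+ 2 + qk x ^+ 2 + c *+ 2 +
    (qre y ^+ 2 + qi y ^+ 2 + qj y ^+ 2 + qk y ^+ 2)).
    by rewrite lerD2r lerD2l ler_wMn2r.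
  by rewrite /c /=; ring.
rewrite (le_trans (ler_norm c))// -sqrtr_sqr /qnorm -sqrtrM// ler_sqrt ?mulr_ge0//.
rewrite -subr_ge0 (_ : _ - _ =
  (qre x * qi y - qi x * qre y) ^+ 2 + (qre x * qj y - qj x * qre y) ^+ 2 +
  (qre x * qk y - qk x * qre y) ^+ 2 + (qi x * qj y - qj x * qi y) ^+ 2 +
  (qi x * qk y - qk x * qi y) ^+ 2 + (qj x * qk y - qk x * qj y) ^+ 2).
  by rewrite !addr_ge0 ?sqr_ge0.
by rewrite /c; ring.
Qed.
Fact qnormZ (a : R) x : qnorm (a *: x) = `|a| * qnorm x.
Proof. by rewrite /qnorm /= !exprMn -!mulrDr sqrtrM ?sqr_ge0// sqrtr_sqr. Qed.
Fact qnorm0_eq0 x : qnorm x = 0 -> x = 0.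
Proof.
move/eqP; rewrite sqrtr_eq0 => h.
have := sqr_ge0 (qre x); have := sqr_ge0 (qi x).
have := sqr_ge0 (qj x); have := sqr_ge0 (qk x) => h1 h2 h3 h4.
by apply: quatP => /=; apply/eqP; rewrite -sqrf_eq0; apply/eqP; lra.
Qed.

HB.instance Definition _ :=
  Lmodule_isNormed.Build R (quat R) qnormD qnormZ qnorm0_eq0.

Fact qmulA : associative qmul.
Proof. by move=> x y z; apply: quatP => /=; ring. Qed.
Fact qmul1l : left_id qone qmul.
Proof. by move=> x; apply: quatP => /=; ring. Qed.
Fact qmul1r : right_id qone qmul.
Proof. by move=> x; apply: quatP => /=; ring. Qed.
Fact qmulDl : left_distributive qmul +%R.
Proof. by move=> x y z; apply: quatP => /=; ring. Qed.
Fact qmulDr : right_distributive qmul +%R.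
Proof. by move=> x y z; apply: quatP => /=; ring. Qed.
Fact qone_neq0 : qone != 0.
Proof. by apply/eqP => /(congr1 (@qre R))/= /eqP; rewrite oner_eq0. Qed.

HB.instance Definition _ := GRing.Zmodule_isNzRing.Build (quat R)
  qmulA qmul1l qmul1r qmulDl qmulDr qone_neq0.

Fact qscaleAl (a : R) x y : a *: (x * y) = a *: x * y.
Proof. by apply: quatP => /=; ring. Qed.
Fact qscaleAr (a : R) x y : a *: (x * y) = x * (a *: y).
Proof. by apply: quatP => /=; ring. Qed.

HB.instance Definition _ := GRing.Lmodule_isLalgebra.Build R (quat R) qscaleAl.
HB.instance Definition _ := GRing.Lalgebra_isAlgebra.Build R (quat R) qscaleAr.

End quat_structures.

Section BMOSH.
Context {R : realType}.
Local Notation H := (quat R).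
Local Notation mu := (@lebesgue_measure R).
Implicit Types (f g : H -> H) (i x : H).

Definition unit_ball : set H := [set x | `|x| < 1].

Definition imag_units : set H := [set i | qre i = 0 /\ `|i| = 1].

(* A function on the unit ball is represented by a total function [H -> H]; all
   the notions below depend only on its values on [unit_ball]. *)
Definition slice_hyperholomorphic : set (H -> H) := [set f |
  (forall x, unit_ball x -> differentiable f x) /\
  exists alpha beta : R -> R -> H,
    (forall i u v, imag_units i -> 0 <= v -> u ^+ 2 + v ^+ 2 < 1 ->
       f (u%:A + v *: i) = alpha u v + i * beta u v) /\
    (forall u v, u ^+ 2 + v ^+ 2 < 1 ->
       [/\ alpha u (- v) = alpha u v & beta u (- v) = - beta u v] /\
       [/\ derivable (alpha^~ v) u 1, derivable (alpha u) v 1,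
           derivable (beta^~ v) u 1 & derivable (beta u) v 1] /\
       [/\ derive1 (alpha^~ v) u = derive1 (beta u) v
         & derive1 (beta^~ v) u = - derive1 (alpha u) v])].

Definition slice_polynomials : set (H -> H) := [set g |
  exists (N : nat) (a : nat -> H), forall x, unit_ball x ->
    g x = \sum_(n < N.+1) x ^+ n * a n].

Definition disk_algebra : set (H -> H) := [set g |
  slice_hyperholomorphic g /\
  exists h : H -> H, {within closure unit_ball, continuous h} /\
    forall x, unit_ball x -> h x = g x].

Definition qcis i (t : R) : H := (cos t)%:A + sin t *: i.

Definition circle_mean f i (r : R) : \bar R :=
  ((2 * pi)^-1%:E *
   \int[mu]_(t in `[0%R, (2 * pi)%R]) (`|f (r *: qcis i t)| ^+ 2)%:E)%E.

(* For slice hyperholomorphic [f] the mean is nondecreasing in [r], so that the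
   limit always exists in [\bar R]. *)
Definition hardy2 : set (H -> H) := [set f |
  slice_hyperholomorphic f /\
  (ereal_sup [set lim (circle_mean f i r @[r --> 1^'-]) | i in imag_units]
     < +oo)%E].

(* Has a meaningful value only where the radial limit exists, hence for almost
   every [t] when [f] is in [hardy2]. *)
Definition boundary f i (t : R) : H := lim (f (r *: qcis i t) @[r --> 1^'-]).

Definition qRintegral (A : set R) (F : R -> H) : H :=
  Quat (\int[mu]_(t in A) qre (F t)) (\int[mu]_(t in A) qi (F t))
       (\int[mu]_(t in A) qj (F t)) (\int[mu]_(t in A) qk (F t)).

Definition average f i (a b : R) : H :=
  (b - a)^-1 *: qRintegral `]a, b[ (boundary f i).

Definition oscillation f i (a b : R) : \bar R :=
  ((b - a)^-1%:E *
   \int[mu]_(t in `]a, b[) (`|boundary f i t - average f i a b| ^+ 2)%:E)%E.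

Definition bmo_slice f i : \bar R :=
  sqrte (ereal_sup [set oscillation f i I.1 I.2 |
    I in [set I : R * R | I.1 < I.2 /\ I.2 - I.1 <= 2 * pi]]).

Definition bmo_seminorm f : \bar R :=
  ereal_sup [set bmo_slice f i | i in imag_units].

Definition BMOSH : set (H -> H) := [set f |
  hardy2 f /\ (bmo_seminorm f < +oo)%E].

Definition BMOSH_norm f : \bar R := (`|f 0|%:E + bmo_seminorm f)%E.

Definition BMOSH_cvg (T : Type) (F : set_system T) (g : T -> H -> H) f :=
  (\forall r \near F, BMOSH (g r)) /\
  BMOSH_norm (g r \- f) @[r --> F] --> 0%E.

Definition BMOSH_closure (A : set (H -> H)) : set (H -> H) := [set f |
  BMOSH f /\
  forall e : R, 0 < e ->
    exists g, [/\ A g, BMOSH g & (BMOSH_norm (f \- g)%R < e%:E)%E]].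

Definition VMOSH : set (H -> H) := [set f |
  BMOSH f /\
  forall i, imag_units i -> forall e : R, 0 < e ->
    exists2 d : R, 0 < d &
      forall a b : R, a < b -> b - a < d -> (oscillation f i a b < e%:E)%E].

(* Slice hyperholomorphic functions form a right module over the quaternions. *)
Definition BMOSH_closed_subspace (V : set (H -> H)) : Prop :=
  [/\ V `<=` BMOSH,
      V (fun=> 0),
      forall f g, V f -> V g -> V (f \+ g),
      forall f (a : H), V f -> V (fun x => f x * a)
    & BMOSH_closure V `<=` V].

Definition dilation f (r : R) : H -> H := fun s => f (r *: s).

End BMOSH.

Arguments unit_ball R : clear implicits.
Arguments imag_units R : clear implicits.
Arguments slice_hyperholomorphic R : clear implicits.
Arguments slice_polynomials R : clear implicits.
Arguments disk_algebra R : clear implicits.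
Arguments hardy2 R : clear implicits.
Arguments BMOSH R : clear implicits.
Arguments VMOSH R : clear implicits.

(* Main.v *)
(* On the slice of an imaginary unit [i], each real coordinate [U] of [f] is
   harmonic: the Cauchy-Riemann equation and Goursat's argument show that the
   [n]-th Fourier coefficient of [U(rho e^(it))] is [rho^n] times a constant, so
   that [U] is reproduced by the Poisson kernel. When the circle means are
   bounded, a maximal inequality gives a boundary function [u], radial limit
   almost everywhere and in L^2, with [U_r = P_r * u]. As convolution averages
   translates, the mean oscillation of [U_r] on [I] is at most the supremum over
   [s] of that of [u] on [I + s]. If [f] has vanishing mean oscillation, then
   [f_r - f] oscillates little on short intervals because both terms do, and on
   long intervals because [f_r] tends to [f] in L^2; the representation formula
   carries the estimate from the slices of [i] and [-i] to all slices at once.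
   Each [f_r] is continuous on the closed ball and is uniformly approximated on
   it by the partial sums of its expansion. Conversely, a function continuous on
   the closed ball has uniformly continuous boundary values, and vanishing mean
   oscillation survives limits in the BMO norm. *)
From HB Require Import structures.
From mathcomp Require Import all_boot all_order all_algebra.
From mathcomp Require Import ring lra.
From mathcomp Require Import all_classical all_reals all_analysis.
From mathcomp Require Import measurable_realfun.
Require Import Defs.

Set Implicit Arguments.
Unset Strict Implicit.
Unset Printing Implicit Defensive.

Import Order.TTheory GRing.Theory Num.Theory.
Import numFieldNormedType.Exports.

Local Open Scope classical_set_scope.
Local Open Scope ring_scope.

(** * Integrals over compact intervals *)

Section dint.
Context {R : realType}.
Local Notation mu := (@lebesgue_measure R).
Implicit Types (f g : R -> R) (a b c : R).

(** The functions are only assumed differentiable, so their derivatives need not be continuous and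
    Green's formula is out of reach; hence Goursat's bisection, carried out in the coordinates
    [(ln rho, t)], where the Cauchy-Riemann equation has constant coefficients. Values are tested
    with the functionals [x |-> Re(w x)]: replacing [w] by [w * i] gives the conjugate harmonic
    function, so the analysis concerns real functions. When the maximal inequality is applied there
    is no boundary function yet; it is used on the differences [U_r - U_(k r)] with [k < 1] fixed,
    small in L^2, while [U_(k r)] is continuous up to [r = 1]. Vanishing oscillation supplies a
    length that may depend on [i], whereas the norm is a supremum over all [i]; as two opposite
    slices determine all others, two lengths suffice. Finally, [boundary] takes arbitrary values on
    a null set and Lebesgue measure lives on Borel sets, so its integrals are moved to a measurable
    representative. The constants 2 and 4 come from [|x + y|^2 <= 2 |x|^2 + 2 |y|^2] and from the
    four real coordinates; working with them avoids Minkowski's inequality. *)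

Definition locint f := forall a b, mu.-integrable `[a, b] (EFin \o f).

(** For [b < a] the interval is empty and the value is [0], not the opposite integral; hence the
    ordering hypotheses in the lemmas on constants, splitting and primitives. *)
Definition dint f a b : R := \int[mu]_(t in `[a, b]) f t.

Lemma continuous_locint f : continuous f -> locint f.
Proof.
move=> cf a b; apply: continuous_compact_integrable; first exact: segment_compact.
exact: continuous_subspaceT.
Qed.

Lemma locint_cst c : locint (fun=> c).
Proof. by apply: continuous_locint => x; exact: cvg_cst. Qed.

Lemma locintD f g : locint f -> locint g -> locint (fun t => f t + g t).
Proof.
by move=> If Ig a b; apply: (integrableD _ (If a b) (Ig a b)).
Qed.

Lemma locintZ c f : locint f -> locint (fun t => c * f t).
Proof. by move=> If a b; apply: (integrableZl _ c (If a b)). Qed.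

Lemma locintB f g : locint f -> locint g -> locint (fun t => f t - g t).
Proof.
by move=> If Ig a b; apply: (integrableB _ (If a b) (Ig a b)).
Qed.

Lemma locint_norm f : locint f -> locint (fun t => `|f t|).
Proof. by move=> If a b; exact: integrable_abse (If a b). Qed.

Lemma locint_sum (I : Type) (r : seq I) (F : I -> R -> R) :
  (forall i, locint (F i)) -> locint (fun t => \sum_(i <- r) F i t).
Proof.
move=> IF; elim: r => [|x r ih].
  by under eq_fun do rewrite big_nil; exact: locint_cst.
by under eq_fun do rewrite big_cons; exact: locintD.
Qed.

Lemma dintD f g a b : locint f -> locint g ->
  dint (fun t => f t + g t) a b = dint f a b + dint g a b.
Proof. by move=> If Ig; rewrite /dint RintegralD. Qed.

Lemma dintB f g a b : locint f -> locint g ->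
  dint (fun t => f t - g t) a b = dint f a b - dint g a b.
Proof. by move=> If Ig; rewrite /dint RintegralB. Qed.

Lemma dintZ c f a b : locint f -> dint (fun t => c * f t) a b = c * dint f a b.
Proof. by move=> If; rewrite /dint RintegralZl. Qed.

Lemma dint_sum (I : Type) (r : seq I) (F : I -> R -> R) a b :
  (forall i, locint (F i)) ->
  dint (fun t => \sum_(i <- r) F i t) a b = \sum_(i <- r) dint (F i) a b.
Proof.
move=> IF; elim: r => [|x r ih].
  rewrite big_nil /dint; under eq_Rintegral do rewrite big_nil.
  by rewrite Rintegral_cst// mul0r.
rewrite big_cons -ih -(dintD _ _ (IF x) (locint_sum r IF)).
by rewrite /dint; under eq_Rintegral do rewrite big_cons.
Qed.

Lemma dint_cst c a b : a <= b -> dint (fun=> c) a b = c * (b - a).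
Proof.
rewrite le_eqVlt => /predU1P[->|ab].
  by rewrite /dint set_itv1 Rintegral_set1 subrr mulr0.
by rewrite /dint Rintegral_cst//= lebesgue_measure_itv/= lte_fin ab -EFinB.
Qed.

Lemma eq_dint f g a b : (forall t, a <= t <= b -> f t = g t) ->
  dint f a b = dint g a b.
Proof.
by move=> fg; apply: eq_Rintegral => t; rewrite inE/= in_itv/=; exact: fg.
Qed.

Lemma ler_dint f g a b : locint f -> locint g ->
  (forall t, a <= t <= b -> f t <= g t) -> dint f a b <= dint g a b.
Proof.
by move=> If Ig fg; apply: le_Rintegral => // t; rewrite /= in_itv; exact: fg.
Qed.

Lemma dint_ge0 f a b : (forall t, a <= t <= b -> 0 <= f t) -> 0 <= dint f a b.
Proof. by move=> f0; apply: Rintegral_ge0 => t; rewrite /= in_itv; exact: f0. Qed.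

Lemma dint_norm f a b : locint f -> `|dint f a b| <= dint (fun t => `|f t|) a b.
Proof. by move=> If; apply: le_normr_Rintegral. Qed.

Lemma dint_bound f a b M : locint f -> a <= b ->
  (forall t, a <= t <= b -> `|f t| <= M) -> `|dint f a b| <= M * (b - a).
Proof.
move=> If ab fM; apply: (le_trans (dint_norm _ _ If)).
rewrite -dint_cst//; apply: ler_dint => //; first exact: locint_norm.
exact: locint_cst.
Qed.

Lemma dint_split b f a c : locint f -> a <= b -> b <= c ->
  dint f a c = dint f a b + dint f b c.
Proof.
move=> If ab bc; have := @Rintegral_itvB R f (BLeft a) (BRight c) b (If a c).
rewrite !bnd_simp => /(_ ab bc) h; rewrite /dint.
rewrite -(@Rintegral_itv_obnd_cbnd _ b (BRight c)); last first.
  by apply: integrableS (If b c) => //; exact: subset_itv_oc_cc.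
by rewrite -h addrC subrK.
Qed.

Lemma dint_subset f a b a' b' : locint f -> (forall t, 0 <= f t) ->
  a' <= a -> b <= b' -> dint f a b <= dint f a' b'.
Proof.
move=> If f0 aa bb; have [ab|ba] := leP a b; last first.
  rewrite {1}/dint set_itv_ge ?Rintegral_set0; first exact: dint_ge0.
  by rewrite bnd_simp -ltNge.
rewrite (@dint_split a f a' b')//; last exact: le_trans bb.
rewrite (@dint_split b f a b')// addrCA lerDl addr_ge0//; exact: dint_ge0.
Qed.

Lemma dint_FTC2 f (F : R -> R) a b : a <= b -> continuous f ->
  (forall t, is_derive t (1 : R) F (f t)) -> dint f a b = F b - F a.
Proof.
move=> ab cf dF; move: ab; rewrite le_eqVlt => /predU1P[<-|ab].
  by rewrite subrr /dint set_itv1 Rintegral_set1.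
rewrite /dint /Rintegral (@continuous_FTC2 _ _ F)//.
- exact: continuous_subspaceT.
- have cF : continuous F.
    move=> x; apply/differentiable_continuous/derivable1_diffP.
    by have [] := dF x.
  split => //; last by apply/cvg_at_left_filter/cF.
  by apply/cvg_at_right_filter/cF.
- by move=> x _; rewrite derive1E; have [] := dF x.
Qed.

End dint.

(** * Translation invariance of Lebesgue measure and of integrals *)

Section translation.
Context {R : realType}.
Local Notation mu := (@lebesgue_measure R).
Implicit Types (f g : R -> R) (a b c : R).

Lemma measurable_shift c : measurable_fun setT (fun t : measurableTypeR R => (t + c : measurableTypeR R)).
Proof. by apply: measurable_funD. Qed.

(** By uniqueness of Lebesgue measure it is enough to compare the two measures on half-open
    intervals, whose length a translation preserves. *)
Lemma lebesgue_measure_shift c (A : set (measurableTypeR R)) : measurable A ->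
  mu A = pushforward mu (fun t : measurableTypeR R => (t + c : measurableTypeR R)) A.
Proof.
have mc := measurable_shift c.
pose mM := isMeasurableFun.Build _ _ _ _ _ mc.
pose phi : {mfun _ >-> _} := HB.pack (fun t : measurableTypeR R => (t + c : measurableTypeR R)) mM.
move=> mA; apply: (@lebesgue_measure_unique _ (pushforward mu phi)) => // X [[a b] _ <-].
transitivity (mu `]a - c, b - c]); last first.
  congr (mu _); apply/seteqP; split => x /=; rewrite !in_itv/=;
  by rewrite ltrBlDr lerBrDr.
rewrite !lebesgue_measure_itv/= !lte_fin ltrD2r; case: ifP => // _.
by rewrite -!EFinB; congr EFin; ring.
Qed.

Lemma locint_measurable f : locint f -> measurable_fun setT f.
Proof.
move=> If; have -> : [set: R] = \bigcup_n `[- n%:R, n%:R]%classic.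
  apply/seteqP; split => // x _; exists (Num.bound x) => //=.
  rewrite in_itv/= -ler_norml; apply/ltW.
  by have := archi_boundP (normr_ge0 x); rewrite /Num.bound normr_id.
apply/measurable_fun_bigcup => // n.
by have /measurable_int/measurable_EFinP := If (- n%:R) n%:R.
Qed.

Lemma integral_pushforward_shift (h : R -> \bar R) (D : set (measurableTypeR R)) c :
  (\int[pushforward mu (fun t : measurableTypeR R => (t + c)%R : measurableTypeR R)]_(t in D) h t =
  \int[mu]_(t in D) h t)%E.
Proof.
pose mM := isMeasurableFun.Build _ _ _ _ _ (measurable_shift c).
pose phi : {mfun _ >-> _} :=
  HB.pack (fun t : measurableTypeR R => (t + c : measurableTypeR R)) mM.
by apply: (@eq_measure_integral _ _ _ D mu (pushforward mu phi)) => A mA _;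
  rewrite [RHS](lebesgue_measure_shift c).
Qed.

Lemma ge0_integral_shift (h : R -> \bar R) (D : set (measurableTypeR R)) c : measurable D ->
  measurable_fun setT h -> (forall t, 0 <= h t)%E ->
  (\int[mu]_(t in [set t | D (t + c)%R]) h (t + c)%R = \int[mu]_(t in D) h t)%E.
Proof.
move=> mD mh h0; rewrite -(integral_pushforward_shift h D c).
by rewrite (ge0_integral_pushforward (measurable_shift c))//; exact: measurable_funTS.
Qed.

Lemma shift_itvcc c a b : [set t | `[a + c, b + c]%classic (t + c)] = `[a, b]%classic.
Proof. by apply/seteqP; split => x /=; rewrite !in_itv/= !lerD2r. Qed.

Lemma locint_shift c f : locint f -> locint (fun t => f (t + c)).
Proof.
move=> If a b; have mf := locint_measurable If.
apply/integrableP; split.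
  apply/measurable_EFinP/measurable_funTS.
  exact: (measurableT_comp mf (measurable_shift c)).
have /integrableP[_] := If (a + c) (b + c); apply: le_lt_trans.
rewrite -(@ge0_integral_shift (fun t => `|(f t)%:E|%E) _ c)//; last first.
  by apply: measurableT_comp => //; exact/measurable_EFinP.
by rewrite shift_itvcc.
Qed.

Lemma dint_shift c f a b : locint f ->
  dint (fun t => f (t + c)) a b = dint f (a + c) (b + c).
Proof.
move=> If; have mf := locint_measurable If.
rewrite /dint /Rintegral -[in RHS](integral_pushforward_shift _ _ c); congr fine.
rewrite [RHS](@integral_pushforward _ _ _ _ R _ (measurable_shift c)).
- by rewrite -[in LHS](shift_itvcc c).
- exact/measurable_EFinP.
- have -> : (+%R^~ c @^-1` `[a + c, b + c]%classic) = `[a, b]%classic.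
    exact: shift_itvcc.
  exact: (locint_shift c If).
- by [].
Qed.

End translation.

(** * Integrals of periodic functions *)

Section periodic.
Context {R : realType}.
Implicit Types (f : R -> R) (a p : R).

Lemma periodicMn (T : Type) (f : R -> T) p : (forall t, f (t + p) = f t) ->
  forall n t, f (t + p *+ n) = f t.
Proof.
by move=> fp; elim=> [t|n ih t]; rewrite ?mulr0n ?addr0// mulrS addrA ih fp.
Qed.

Lemma periodicMz (T : Type) (f : R -> T) p : (forall t, f (t + p) = f t) ->
  forall n t, f (t + p *~ n) = f t.
Proof.
move=> fp [n t|n t]; first exact: periodicMn.
by rewrite NegzE mulrNz -[LHS](periodicMn fp n.+1) -pmulrn subrK.
Qed.

(** [a] is reduced modulo [p] to [a0] in [[0, p[]; the part of [[a0, a0 + p]] beyond [p] is then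
    translated back onto [[0, a0]]. *)
Lemma dint_periodic f p : 0 < p -> locint f -> (forall t, f (t + p) = f t) ->
  forall a, dint f a (a + p) = dint f 0 p.
Proof.
move=> p0 If fp a.
pose k := Num.floor (a / p); pose a0 := a - p *~ k.
have pk : p *~ k = k%:~R * p by rewrite mulrzl.
have a00 : 0 <= a0.
  by rewrite subr_ge0 pk -ler_pdivlMr// floor_le.
have a0p : a0 < p.
  rewrite ltrBlDl pk -{2}[p]mul1r -mulrDl -ltr_pdivrMr//.
  by have := floorD1_gt (a / p); rewrite intrD.
have -> : dint f a (a + p) = dint f a0 (a0 + p).
  transitivity (dint f (a0 + p *~ k) (a0 + p + p *~ k)).
    by rewrite [a0 + p + _]addrAC /a0 subrK.
  rewrite -dint_shift//.
  by apply: eq_dint => t _; exact: periodicMz.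
rewrite (@dint_split _ p)// ?lerDr//; last exact: ltW.
rewrite [X in _ + X](_ : _ = dint f 0 a0).
  by rewrite addrC -dint_split//; exact: ltW.
rewrite -{1}(add0r p) -dint_shift//; exact: eq_dint.
Qed.

Lemma dint_periodicMn f p : 0 < p -> locint f -> (forall t, f (t + p) = f t) ->
  forall n a, dint f a (a + p *+ n) = dint f 0 p *+ n.
Proof.
move=> p0 If fp; elim=> [a|n ih a].
  by rewrite !mulr0n addr0 /dint set_itv1 Rintegral_set1.
have h1 : a <= a + p by rewrite lerDl ltW.
have h2 : a + p <= a + p *+ n.+1 by rewrite lerD2l mulrS lerDl mulrn_wge0// ltW.
rewrite (dint_split If h1 h2).
by rewrite mulrS addrA ih dint_periodic// -mulrS.
Qed.

End periodic.

(** * Goursat's theorem for closed forms on rectangles *)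

Section goursat.
Context {R : realType}.
Implicit Types (P Q : R -> R -> R).

(** The form [P ds + Q dt] is closed at [(s, t)]: both functions have a total differential there,
    and the same [b] is the [t]-derivative of [P] and the [s]-derivative of [Q]. *)
Definition closed_form_at P Q (s t : R) := exists a b d : R,
  forall e : R, 0 < e -> exists2 de : R, 0 < de &
  forall s' t', `|s' - s| < de -> `|t' - t| < de ->
  `|P s' t' - (P s t + a * (s' - s) + b * (t' - t))| <= e * (`|s' - s| + `|t' - t|) /\
  `|Q s' t' - (Q s t + b * (s' - s) + d * (t' - t))| <= e * (`|s' - s| + `|t' - t|).

(** Circulation of [P ds + Q dt] counterclockwise along the boundary of [[a, b] x [c, d]]. *)
Definition rect_int P Q (a b c d : R) : R :=
  dint (P^~ c) a b - dint (P^~ d) a b + (dint (Q b) c d - dint (Q a) c d).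

Variables P Q : R -> R -> R.
Hypothesis cP : forall t, continuous (P^~ t).
Hypothesis cQ : forall s, continuous (Q s).
Let IP t : locint (P^~ t). Proof. exact: continuous_locint. Qed.
Let IQ s : locint (Q s). Proof. exact: continuous_locint. Qed.
Local Notation E := (rect_int P Q).

Lemma rect_int_split m n a b c d : a <= m -> m <= b -> c <= n -> n <= d ->
  E a b c d = E a m c n + E m b c n + E a m n d + E m b n d.
Proof.
move=> am mb cn nd; rewrite /rect_int.
rewrite !(@dint_split _ m (P^~ _) a b)//.
by rewrite !(@dint_split _ n (Q _) c d)//; ring.
Qed.

(** The affine parts have no circulation: the cross derivative [q] contributes [- q k h] on the
    horizontal sides and [q h k] on the vertical ones. What is left are the remainders, each at most
    [e (h + k)], two for each pair of opposite sides. *)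
Lemma rect_int_small (s t e a c h k : R) (p q d : R) :
  0 <= h -> 0 <= k -> 0 <= e ->
  a <= s <= a + h -> c <= t <= c + k ->
  (forall s' t', a <= s' <= a + h -> c <= t' <= c + k ->
  `|P s' t' - (P s t + p * (s' - s) + q * (t' - t))| <= e * (`|s' - s| + `|t' - t|) /\
  `|Q s' t' - (Q s t + q * (s' - s) + d * (t' - t))| <= e * (`|s' - s| + `|t' - t|)) ->
  `|E a (a + h) c (c + k)| <= 2 * e * (h + k) ^+ 2.
Proof.
move=> h0 k0 e0 sa tc H.
have hb (x y s' : R) : 0 <= y -> x <= s' <= x + y -> forall z, x <= z <= x + y -> `|z - s'| <= y.
  move=> y0 /andP[s1 s2] z /andP[z1 z2]; rewrite ler_norml; lra.
have {}H s' t' : a <= s' <= a + h -> c <= t' <= c + k ->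
  `|P s' t' - (P s t + p * (s' - s) + q * (t' - t))| <= e * (h + k) /\
  `|Q s' t' - (Q s t + q * (s' - s) + d * (t' - t))| <= e * (h + k).
  move=> hs' ht'; have [h1 h2] := H _ _ hs' ht'.
  have he : e * (`|s' - s| + `|t' - t|) <= e * (h + k).
    by rewrite ler_wpM2l// lerD//; [exact: (hb a)|exact: (hb c)].
  by split; [exact: le_trans he|exact: le_trans he].
have ac : a <= a <= a + h by rewrite lexx lerDl.
have ah : a <= a + h <= a + h by rewrite lexx lerDl h0.
have cc : c <= c <= c + k by rewrite lexx lerDl.
have ck : c <= c + k <= c + k by rewrite lexx lerDl k0.
have HP : `|dint (fun s' => P s' c - P s' (c + k) + q * k) a (a + h)| <= 2 * e * (h + k) * h.
  rewrite [X in _ <= _ * X](_ : h = a + h - a); last by rewrite addrC addKr.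
  apply: dint_bound.
  - by apply: locintD; [exact: locintB|exact: locint_cst].
  - by rewrite lerDl.
  move=> s' hs'; have [h1 _] := H s' c hs' cc; have [h2 _] := H s' (c + k) hs' ck.
  rewrite [X in `|X|](_ : _ =
    (P s' c - (P s t + p * (s' - s) + q * (c - t))) -
    (P s' (c + k) - (P s t + p * (s' - s) + q * (c + k - t)))); last by ring.
  by rewrite (le_trans (ler_normB _ _))//; lra.
have HQ : `|dint (fun t' => Q (a + h) t' - Q a t' - q * h) c (c + k)| <= 2 * e * (h + k) * k.
  rewrite [X in _ <= _ * X](_ : k = c + k - c); last by rewrite addrC addKr.
  apply: dint_bound.
  - by apply: locintB; [exact: locintB|exact: locint_cst].
  - by rewrite lerDl.
  move=> t' ht'; have [_ h1] := H a t' ac ht'; have [_ h2] := H (a + h) t' ah ht'.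
  rewrite [X in `|X|](_ : _ =
    (Q (a + h) t' - (Q s t + q * (a + h - s) + d * (t' - t))) -
    (Q a t' - (Q s t + q * (a - s) + d * (t' - t)))); last by ring.
  by rewrite (le_trans (ler_normB _ _))//; lra.
rewrite dintD ?dintB ?dint_cst ?lerDl// in HP; last 2 first.
  exact: locintB.
  exact: locint_cst.
rewrite !dintB ?dint_cst ?lerDl// in HQ; last 2 first.
  exact: locintB.
  exact: locint_cst.
rewrite /rect_int.
set p1 := dint _ _ _ in HP *; set p2 := dint (P^~ (c + k)) _ _ in HP *.
set q1 := dint _ c _ in HQ *; set q2 := dint (Q a) _ _ in HQ *.
rewrite [X in `|X|](_ : _ = (p1 - p2 + q * k * (a + h - a)) +
  (q1 - q2 - q * h * (c + k - c))); last by ring.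
rewrite (le_trans (ler_normD _ _))//.
apply: (le_trans (lerD HP HQ)).
by rewrite -mulrDr expr2 mulrA.
Qed.

Let half_itv (x y : R) : 0 <= y -> (x <= x) * (x <= x + y / 2) *
  (x + y / 2 <= x + y) * (x + y / 2 + y / 2 <= x + y).
Proof. by move=> y0; do !split; lra. Qed.

Section bisection.
Variables (h k ka : R).
Hypotheses (h0 : 0 < h) (k0 : 0 < k) (ka0 : 0 < ka).

Let good (n : nat) (x : R * R) := ka * (h / 2 ^+ n) * (k / 2 ^+ n) <=
  `|E x.1 (x.1 + h / 2 ^+ n) x.2 (x.2 + k / 2 ^+ n)|.

Let sub (n : nat) (x y : R * R) :=
  [/\ x.1 <= y.1, y.1 + h / 2 ^+ n.+1 <= x.1 + h / 2 ^+ n,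
      x.2 <= y.2 & y.2 + k / 2 ^+ n.+1 <= x.2 + k / 2 ^+ n].

(** The circulations of the four quarters add up to that of the rectangle; if each were below [ka]
    times its area, so would be the whole. *)
Let bisect n x : good n x -> exists y, good n.+1 y /\ sub n x y.
Proof.
case: x => a c; rewrite /good /sub /=.
set H := h / 2 ^+ n; set K := k / 2 ^+ n.
have -> : h / 2 ^+ n.+1 = H / 2.
  by rewrite exprS invfM mulrCA mulrC.
have -> : k / 2 ^+ n.+1 = K / 2.
  by rewrite exprS invfM mulrCA mulrC.
have H0 : 0 < H by rewrite divr_gt0// exprn_gt0.
have K0 : 0 < K by rewrite divr_gt0// exprn_gt0.
move=> hE; apply: contrapT => /forallNP hn.
have bad y : a <= y.1 -> y.1 + H / 2 <= a + H -> c <= y.2 -> y.2 + K / 2 <= c + K ->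
    `|E y.1 (y.1 + H / 2) y.2 (y.2 + K / 2)| < ka * (H / 2) * (K / 2).
  move=> y1 y2 y3 y4; rewrite ltNge; apply/negP => hy.
  by apply: (hn y); split.
have HE : H = H / 2 + H / 2 by exact: splitr.
have KE : K = K / 2 + K / 2 by exact: splitr.
have H20 : 0 <= H / 2 by rewrite divr_ge0// ltW.
have K20 : 0 <= K / 2 by rewrite divr_ge0// ltW.
have h1 : E a (a + H) c (c + K) = E a (a + H / 2) c (c + K / 2) +
   E (a + H / 2) (a + H / 2 + H / 2) c (c + K / 2) +
   E a (a + H / 2) (c + K / 2) (c + K / 2 + K / 2) +
   E (a + H / 2) (a + H / 2 + H / 2) (c + K / 2) (c + K / 2 + K / 2).
  transitivity (E a (a + H / 2 + H / 2) c (c + K / 2 + K / 2)).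
    by rewrite -[a + _ + _]addrA -[c + _ + _]addrA -HE -KE.
  by apply: rect_int_split; rewrite lerDl.
have okH := half_itv a (ltW H0); have okK := half_itv c (ltW K0).
have b1 : `|E a (a + H / 2) c (c + K / 2)| < ka * (H / 2) * (K / 2).
  by apply: (bad (a, c)); rewrite /= ?okH ?okK.
have b2 : `|E (a + H / 2) (a + H / 2 + H / 2) c (c + K / 2)| < ka * (H / 2) * (K / 2).
  by apply: (bad (a + H / 2, c)); rewrite /= ?okH ?okK.
have b3 : `|E a (a + H / 2) (c + K / 2) (c + K / 2 + K / 2)| < ka * (H / 2) * (K / 2).
  by apply: (bad (a, c + K / 2)); rewrite /= ?okH ?okK.
have b4 : `|E (a + H / 2) (a + H / 2 + H / 2) (c + K / 2) (c + K / 2 + K / 2)| < ka * (H / 2) * (K / 2).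
  by apply: (bad (a + H / 2, c + K / 2)); rewrite /= ?okH ?okK.
move: hE; rewrite leNgt h1 => /negP; apply.
rewrite (le_lt_trans (ler_normD _ _))//.
have -> : ka * H * K = ka * (H / 2) * (K / 2) + ka * (H / 2) * (K / 2) +
  ka * (H / 2) * (K / 2) + ka * (H / 2) * (K / 2) by field.
rewrite ltrD//.
rewrite (le_lt_trans (ler_normD _ _))// ltrD//.
by rewrite (le_lt_trans (ler_normD _ _))// ltrD//.
Qed.

(** Repeated bisection gives nested rectangles with halved sides; the suprema of the coordinates of
    their lower left corners form a point common to all of them. *)
Lemma goursat_point a c : ka * h * k <= `|E a (a + h) c (c + k)| ->
  exists s t, [/\ a <= s <= a + h, c <= t <= c + k &
  forall n : nat, exists x : R * R, [/\ good n x,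
     x.1 <= s <= x.1 + h / 2 ^+ n & x.2 <= t <= x.2 + k / 2 ^+ n]].
Proof.
move=> hE.
(* Dependent choice: the state carries its own index and its proof of [good], so that plain
   iteration produces the sequence. *)
have step (x : {x : nat * (R * R) | good x.1 x.2}) :
    {y : {x : nat * (R * R) | good x.1 x.2} | (sval y).1 = (sval x).1.+1 /\
      sub (sval x).1 (sval x).2 (sval y).2}.
  case: x => -[n x]/= gx; have [y [gy sy]] := cid (bisect gx).
  by exists (exist _ (n.+1, y) gy).
have g0 : good 0 (a, c) by rewrite /good /= expr0 !divr1.
pose seqx n := iter n (fun x => sval (step x)) (exist (fun x => good x.1 x.2) (0%N, (a, c)) g0).
have seq1 n : (sval (seqx n)).1 = n.
  elim: n => //= n ih; have [-> _] := svalP (step (seqx n)).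
  by rewrite ih.
pose x n := (sval (seqx n)).2.
have gx n : good n (x n) by have := svalP (seqx n); rewrite seq1.
have sx n : sub n (x n) (x n.+1).
  have : sub (sval (seqx n)).1 (x n) (x n.+1) := (svalP (step (seqx n))).2.
  by rewrite seq1.
have hn n : 0 <= h / 2 ^+ n by rewrite divr_ge0 ?ltW// exprn_gt0.
have kn n : 0 <= k / 2 ^+ n by rewrite divr_ge0 ?ltW// exprn_gt0.
have mono n m : [/\ (x n).1 <= (x (n + m)%N).1,
    (x (n + m)%N).1 + h / 2 ^+ (n + m) <= (x n).1 + h / 2 ^+ n,
    (x n).2 <= (x (n + m)%N).2 &
    (x (n + m)%N).2 + k / 2 ^+ (n + m) <= (x n).2 + k / 2 ^+ n].
  elim: m => [|m [i1 i2 i3 i4]]; first by rewrite addn0.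
  have [j1 j2 j3 j4] := sx (n + m)%N; rewrite addnS; split.
  - exact: le_trans j1.
  - exact: le_trans i2.
  - exact: le_trans j3.
  - exact: le_trans i4.
have cross n m : (x n).1 <= (x m).1 + h / 2 ^+ m /\ (x n).2 <= (x m).2 + k / 2 ^+ m.
  have [nm|mn] := leqP n m.
    have [i1 _ i3 _] := mono n (m - n)%N; rewrite subnKC// in i1 i3.
    split; first by rewrite (le_trans i1)// lerDl.
    by rewrite (le_trans i3)// lerDl.
  have [_ i1 _ i3] := mono m (n - m)%N; rewrite subnKC// in i1 i3; last exact: ltnW.
  split; first by rewrite (le_trans _ i1)// lerDl.
  by rewrite (le_trans _ i3)// lerDl.
pose A1 := range (fun n => (x n).1); pose A2 := range (fun n => (x n).2).
have b1 m : ubound A1 ((x m).1 + h / 2 ^+ m) by move=> _ [n _ <-]; exact: (cross n m).1.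
have b2 m : ubound A2 ((x m).2 + k / 2 ^+ m) by move=> _ [n _ <-]; exact: (cross n m).2.
have s1 : has_sup A1 by split; [exists (x 0%N).1, 0%N|exists ((x 0%N).1 + h / 2 ^+ 0)].
have s2 : has_sup A2 by split; [exists (x 0%N).2, 0%N|exists ((x 0%N).2 + k / 2 ^+ 0)].
have in1 m : (x m).1 <= sup A1 <= (x m).1 + h / 2 ^+ m.
  apply/andP; split; first by apply: sup_upper_bound => //; exists m.
  by apply: ge_sup; [case: s1|exact: b1].
have in2 m : (x m).2 <= sup A2 <= (x m).2 + k / 2 ^+ m.
  apply/andP; split; first by apply: sup_upper_bound => //; exists m.
  by apply: ge_sup; [case: s2|exact: b2].
exists (sup A1), (sup A2); split.
- by have := in1 0%N; rewrite /x /= expr0 divr1.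
- by have := in2 0%N; rewrite /x /= expr0 divr1.
- by move=> n; exists (x n).
Qed.

End bisection.

Theorem goursat a b c d : a <= b -> c <= d ->
  (forall s t, a <= s <= b -> c <= t <= d -> closed_form_at P Q s t) ->
  E a b c d = 0.
Proof.
rewrite le_eqVlt => /predU1P[<- _ _|ab].
  by rewrite /rect_int {1 2}/dint set_itv1 !Rintegral_set1 !subrr addr0.
rewrite le_eqVlt => /predU1P[<- _|cd hcl].
  by rewrite /rect_int {3 4}/dint set_itv1 !Rintegral_set1 !subrr addr0.
apply/eqP/negPn/negP => E0.
pose h := b - a; pose k := d - c; pose ka := `|E a b c d| / (h * k).
have h0 : 0 < h by rewrite subr_gt0.
have k0 : 0 < k by rewrite subr_gt0.
have ka0 : 0 < ka by rewrite divr_gt0// ?normr_gt0// mulr_gt0.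
have bE : b = a + h by rewrite addrC subrK.
have dE : d = c + k by rewrite addrC subrK.
have kaE : ka * h * k = `|E a b c d| by rewrite -mulrA divfK// gt_eqF// mulr_gt0.
have := @goursat_point h k ka h0 k0 a c.
rewrite -bE -dE kaE lexx => /(_ isT)[s [t [sab tcd hst]]].
have [p [q [r hpq]]] := hcl s t sab tcd.
(* With this [e] the bound of [rect_int_small] on the [n]-th rectangle is half of what [good n]
   demands. *)
pose e := ka * h * k / (4 * (h + k) ^+ 2).
have hk2 : 0 < (h + k) ^+ 2 by rewrite exprn_gt0// addr_gt0.
have e0 : 0 < e by apply: divr_gt0; do ?apply: mulr_gt0 => //.
have [de de0 hde] := hpq e e0.
have [n hn] : exists n : nat, (h + k) / de < 2 ^+ n.
  exists (Num.bound ((h + k) / de)).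
  have : 0 <= (h + k) / de by rewrite divr_ge0 ?ltW// addr_gt0.
  move/archi_boundP => /lt_trans; apply.
  by rewrite -natrX ltr_nat ltn_expl.
have n2 : 0 < 2 ^+ n :> R by rewrite exprn_gt0.
have [[x y] /= [gn xs yt]] := hst n.
have small z u w : 0 <= u <= h + k -> z <= w <= z + u / 2 ^+ n ->
    forall v, z <= v <= z + u / 2 ^+ n -> `|v - w| < de.
  move=> /andP[u0 uhk] /andP[w1 w2] v /andP[v1 v2].
  have : u / 2 ^+ n < de.
    rewrite ltr_pdivrMr//; apply: (le_lt_trans uhk).
    by rewrite mulrC -ltr_pdivrMr.
  by rewrite ltr_norml => ?; lra.
have hh n' : 0 <= h / 2 ^+ n' by rewrite divr_ge0 ?ltW// exprn_gt0.
have kk n' : 0 <= k / 2 ^+ n' by rewrite divr_ge0 ?ltW// exprn_gt0.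
have := @rect_int_small s t e x y (h / 2 ^+ n) (k / 2 ^+ n) p q r (hh n) (kk n) (ltW e0) xs yt.
move=> /(_ _)/wrap[].
  move=> s' t' hs' ht'; apply: hde.
  - by apply: (small x h) => //; rewrite ltW//= lerDl ltW.
  - by apply: (small y k) => //; rewrite ltW//= lerDr ltW.
move=> /(le_trans gn); apply/negP; rewrite -ltNge.
rewrite -mulrDl exprMn.
have -> : ka * (h / 2 ^+ n) * (k / 2 ^+ n) = ka * h * k * (2 ^+ n)^-1 ^+ 2.
  by rewrite expr2; ring.
rewrite mulrA ltr_pM2r ?exprn_gt0 ?invr_gt0//.
rewrite [ltLHS](_ : _ = ka * h * k / 2); last first.
  by rewrite /e; field; rewrite gt_eqF// addr_gt0.
by rewrite ltr_pdivrMr// ltr_pMr ?ltr1n//; do ?apply: mulr_gt0 => //.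
Qed.

End goursat.

(** * The Poisson kernel *)

Section poisson_kernel.
Context {R : realType}.
Implicit Types (r t s : R) (phi : R -> R).

Definition poisson_den r t : R := 1 - 2 * r * cos t + r ^+ 2.

Definition poisson r t : R := (1 - r ^+ 2) / poisson_den r t.

Lemma poisson_denE r t : poisson_den r t = (1 - r) ^+ 2 + 2 * r * (1 - cos t).
Proof. by rewrite /poisson_den; ring. Qed.

Lemma poisson_den_ge r t : 0 <= r -> (1 - r) ^+ 2 <= poisson_den r t.
Proof.
move=> r0; rewrite poisson_denE lerDl mulr_ge0// ?mulr_ge0//.
Qed.

Lemma poisson_den_gt0 r t : 0 <= r < 1 -> 0 < poisson_den r t.
Proof.
move=> /andP[r0 r1]; apply: lt_le_trans (poisson_den_ge t r0).
by rewrite exprn_gt0// subr_gt0.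
Qed.

Lemma sqr_lt1 r : 0 <= r < 1 -> 0 < 1 - r ^+ 2.
Proof. by move=> /andP[r0 r1]; rewrite subr_gt0 expr_lt1. Qed.

Lemma poisson_gt0 r t : 0 <= r < 1 -> 0 < poisson r t.
Proof. by move=> r01; rewrite divr_gt0// ?poisson_den_gt0// sqr_lt1. Qed.

Lemma poissonN r t : poisson r (- t) = poisson r t.
Proof. by rewrite /poisson /poisson_den cosN. Qed.

Lemma cosD2pi' t : cos (t + 2 * pi) = cos t.
Proof. by rewrite mulrC mulr_natr cosD2pi. Qed.

Lemma sinD2pi' t : sin (t + 2 * pi) = sin t.
Proof. by rewrite mulrC mulr_natr sinD2pi. Qed.

Lemma poissonD2pi r t : poisson r (t + 2 * pi) = poisson r t.
Proof. by rewrite /poisson /poisson_den cosD2pi'. Qed.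

Lemma continuous_poisson r : 0 <= r < 1 -> continuous (poisson r).
Proof.
move=> r01 t; rewrite /poisson; apply: cvgM; first exact: cvg_cst.
apply: cvgV; first by rewrite gt_eqF// poisson_den_gt0.
apply: cvgD; last exact: cvg_cst.
apply: cvgB; first exact: cvg_cst.
by apply: cvgM; [exact: cvg_cst|exact: continuous_cos].
Qed.

(** The frequencies [k] and [-k] are merged into one cosine, whence the weight 2 except at
    [k = 0]. *)
Definition fcoef (k : nat) : R := if k is 0%N then 1 else 2.

(** The sum telescopes by the recurrence [cos((N + 2) t) = 2 cos t cos((N + 1) t) - cos(N t)]. The
    two terms of order [N + 1] and [N + 2] in [r] are the truncation error of the Fourier expansion
    of the kernel. *)
Lemma poisson_den_sum r t N :
  poisson_den r t * \sum_(k < N.+1) fcoef k * r ^+ k * cos (k%:R * t) =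
  1 - r ^+ 2 - 2 * r ^+ N.+1 * cos (N.+1%:R * t) + 2 * r ^+ N.+2 * cos (N%:R * t).
Proof.
elim: N => [|N ih].
  rewrite big_ord1 !mul0r cos0 !mul1r /poisson_den /=; ring.
rewrite big_ord_recr mulrDr ih /=.
have e2 : cos (N.+2%:R * t) = 2 * cos t * cos (N.+1%:R * t) - cos (N%:R * t).
  have -> : N.+2%:R * t = N.+1%:R * t + t by rewrite [in LHS]mulrS mulrDl mul1r addrC.
  have -> : N%:R * t = N.+1%:R * t - t by rewrite [in RHS]mulrS mulrDl mul1r addrC addKr.
  by rewrite cosD cosB; ring.
rewrite e2 /poisson_den !exprS; ring.
Qed.

Lemma poisson_expansion r t N : 0 <= r < 1 ->
  `|poisson r t - \sum_(k < N.+1) fcoef k * r ^+ k * cos (k%:R * t)|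
    <= 4 * r ^+ N.+1 / (1 - r) ^+ 2.
Proof.
move=> r01; have /andP[r0 r1] := r01.
have d0 := poisson_den_gt0 t r01.
set S := \sum_(_ < _) _; rewrite -(ler_pM2l d0) -{1}[poisson_den r t]gtr0_norm//.
rewrite -normrM mulrBr /poisson mulrCA divff ?gt_eqF// mulr1 poisson_den_sum.
have rN : 0 <= r ^+ N.+1 by rewrite exprn_ge0.
apply: (@le_trans _ _ (4 * r ^+ N.+1)).
  rewrite (_ : _ - _ = r ^+ N.+1 * (2 * cos (N.+1%:R * t) - 2 * (r * cos (N%:R * t)))); last first.
    by rewrite !exprS; ring.
  rewrite normrM (ger0_norm rN) mulrC ler_wpM2r//.
  rewrite (le_trans (ler_normB _ _))// !normrM normr_nat.
  have h1 := cos_max (N.+1%:R * t).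
  have h2 : `|r| * `|cos (N%:R * t)| <= 1.
    by rewrite mulr_ile1// ?cos_max// ger0_norm// ltW.
  lra.
rewrite mulrA ler_pdivlMr ?exprn_gt0 ?subr_gt0// [leLHS]mulrC.
by rewrite ler_wpM2r ?mulr_ge0// poisson_den_ge.
Qed.

Lemma dint_cos (n : nat) : dint (fun s => cos (n.+1%:R * s)) 0 (2 * pi) = 0 :> R.
Proof.
have n0 : n.+1%:R != 0 :> R by rewrite pnatr_eq0.
apply: etrans (@dint_FTC2 _ _ (fun s => n.+1%:R^-1 * sin (n.+1%:R * s)) _ _ _ _ _) _; last first.
- rewrite mulr0 sin0 mulr0 subr0 (_ : _ * (2 * pi) = 0 + pi *+ 2 *+ n.+1).
    by rewrite (periodicn (@sinD2pi R)) sin0 mulr0.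
  by rewrite add0r mulr_natl -[pi *+ 2]mulr_natl.
- move=> t.
  have d1 : is_derive t (1 : R) (fun s => n.+1%:R * s) n.+1%:R.
    have := @is_deriveZ _ _ _ id n.+1%:R t (1 : R) 1 _.
    by rewrite /GRing.scale/= mulr1; apply.
  have d2 := @is_derive1_comp _ sin _ t _ _ (is_derive_sin (n.+1%:R * t)) d1.
  have := @is_deriveZ _ _ _ _ n.+1%:R^-1 t (1 : R) _ d2.
  by rewrite /GRing.scale/= mulrCA mulVf// mulr1.
- move=> t; apply: continuous_comp; last exact: continuous_cos.
  by apply: cvgM; [exact: cvg_cst|exact: cvg_id].
- by rewrite mulr_ge0// pi_ge0.
Qed.

Lemma dint_sin (n : nat) : dint (fun s => sin (n.+1%:R * s)) 0 (2 * pi) = 0 :> R.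
Proof.
have n0 : n.+1%:R != 0 :> R by rewrite pnatr_eq0.
apply: etrans (@dint_FTC2 _ _ (fun s => - n.+1%:R^-1 * cos (n.+1%:R * s)) _ _ _ _ _) _; last first.
- rewrite mulr0 cos0 (_ : n.+1%:R * (2 * pi) = 0 + pi *+ 2 *+ n.+1).
    by rewrite (periodicn (@cosD2pi R)) cos0 subrr.
  by rewrite add0r mulr_natl -[pi *+ 2]mulr_natl.
- move=> t.
  have d1 : is_derive t (1 : R) (fun s => n.+1%:R * s) n.+1%:R.
    have := @is_deriveZ _ _ _ id n.+1%:R t (1 : R) 1 _.
    by rewrite /GRing.scale/= mulr1; apply.
  have d2 := @is_derive1_comp _ cos _ t _ _ (is_derive_cos (n.+1%:R * t)) d1.
  apply: is_derive_eq (@is_deriveZ _ _ _ _ (- n.+1%:R^-1) t (1 : R) _ d2) _.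
  by rewrite /GRing.scale/=; field.
- move=> t; apply: continuous_comp; last exact: continuous_sin.
  by apply: cvgM; [exact: cvg_cst|exact: cvg_id].
- by rewrite mulr_ge0// pi_ge0.
Qed.

End poisson_kernel.

Section poisson_integral.
Context {R : realType}.
Implicit Types (r t s x e : R) (phi : R -> R).

Lemma continuous_bounded_itv phi a b : continuous phi ->
  exists2 M : R, 0 < M & forall t, a <= t <= b -> `|phi t| <= M.
Proof.
move=> cphi; have cK : compact (phi @` `[a, b]%classic).
  by apply: continuous_compact (@segment_compact _ a b); exact: continuous_subspaceT.
have [M [_ hM]] := compact_bounded cK.
exists (`|M| + 1); first by rewrite ltr_wpDl.
move=> t tab; apply: (hM (`|M| + 1)); first by rewrite (le_lt_trans (ler_norm M))// ltrDl.
by exists t => //=; rewrite in_itv.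
Qed.

(** Turns truncation errors that decay geometrically into exact identities, without any infinite
    series. *)
Lemma eq0_geometric x C r : 0 <= r < 1 -> (forall n : nat, `|x| <= C * r ^+ n) -> x = 0.
Proof.
move=> /andP[r0 r1] h; apply/eqP; rewrite -normr_le0; apply/ler_addgt0Pr => e e0.
rewrite add0r.
have : C * r ^+ n @[n --> \oo] --> C * 0.
  by apply: cvgM; [exact: cvg_cst|apply: cvg_expr; rewrite ger0_norm].
rewrite mulr0 => /cvgrPdist_le/(_ e e0)[n _ /(_ n (leqnn n))].
rewrite sub0r normrN => hn; apply: (le_trans (h n)).
exact: le_trans (ler_norm _) hn.
Qed.

Definition pconv r phi t : R :=
  (2 * pi)^-1 * dint (fun s => poisson r (t - s) * phi s) 0 (2 * pi).

(** The weight [fcoef k] is absorbed here, so that the Poisson integral of [phi] is the limit in [N]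
    of [trig (acoef phi) (bcoef phi) N r] with no further factors. *)
Definition acoef phi (k : nat) : R :=
  (2 * pi)^-1 * fcoef k * dint (fun s => cos (k%:R * s) * phi s) 0 (2 * pi).
Definition bcoef phi (k : nat) : R :=
  (2 * pi)^-1 * fcoef k * dint (fun s => sin (k%:R * s) * phi s) 0 (2 * pi).

Definition trig (a b : nat -> R) (N : nat) x t : R :=
  \sum_(k < N.+1) x ^+ k * (cos (k%:R * t) * a k + sin (k%:R * t) * b k).

Lemma twopi_gt0 : 0 < 2 * pi :> R.
Proof. by rewrite mulr_gt0// pi_gt0. Qed.

Lemma continuous_cosM (c : R) : continuous (fun s : R => cos (c * s)).
Proof.
move=> s; apply: continuous_comp; last exact: continuous_cos.
by apply: cvgM; [exact: cvg_cst|exact: cvg_id].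
Qed.

Lemma continuous_sinM (c : R) : continuous (fun s : R => sin (c * s)).
Proof.
move=> s; apply: continuous_comp; last exact: continuous_sin.
by apply: cvgM; [exact: cvg_cst|exact: cvg_id].
Qed.

Lemma locintM (f g : R -> R) : continuous f -> continuous g -> locint (fun s : R => f s * g s).
Proof. by move=> cf cg; apply: continuous_locint => s; apply: cvgM; [exact: cf|exact: cg]. Qed.

Lemma continuousB_arg (f : R -> R) t : continuous f -> continuous (fun s => f (t - s)).
Proof.
move=> cf s; apply: (@continuous_comp _ _ _ (fun s => t - s) f); last exact: cf.
by apply: cvgB; [exact: cvg_cst|exact: cvg_id].
Qed.

Lemma continuousD_arg (f : R -> R) t : continuous f -> continuous (fun s => f (s + t)).
Proof.
move=> cf s; apply: (@continuous_comp _ _ _ (fun s => s + t) f); last exact: cf.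
by apply: cvgD; [exact: cvg_id|exact: cvg_cst].
Qed.

Lemma continuous_poissonB r t : 0 <= r < 1 -> continuous (fun s => poisson r (t - s)).
Proof.
by move=> r01; apply: continuousB_arg; exact: continuous_poisson.
Qed.

Lemma locint_pconv r phi t : 0 <= r < 1 -> continuous phi ->
  locint (fun s => poisson r (t - s) * phi s).
Proof. by move=> r01 cphi; apply: locintM => //; exact: continuous_poissonB. Qed.

Lemma trig_coef phi N r t : continuous phi ->
  trig (acoef phi) (bcoef phi) N r t = (2 * pi)^-1 *
  dint (fun s => \sum_(k < N.+1) (fcoef k * r ^+ k) * (cos (k%:R * (t - s)) * phi s)) 0 (2 * pi).
Proof.
move=> cphi.
have Ic (k : nat) := locintM (@continuous_cosM k%:R) cphi.
have Is (k : nat) := locintM (@continuous_sinM k%:R) cphi.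
have Icb (k : nat) : locint (fun s => cos (k%:R * (t - s)) * phi s).
  by apply: locintM => //; exact: (continuousB_arg (@continuous_cosM k%:R)).
rewrite dint_sum; last by move=> k; exact: locintZ.
rewrite /trig mulr_sumr; apply: eq_bigr => k _; rewrite dintZ//.
have -> : dint (fun s => cos (k%:R * (t - s)) * phi s) 0 (2 * pi) =
    dint (fun s => cos (k%:R * t) * (cos (k%:R * s) * phi s) +
       sin (k%:R * t) * (sin (k%:R * s) * phi s)) 0 (2 * pi).
  by apply: eq_dint => s _; rewrite mulrBr cosB; ring.
rewrite dintD ?dintZ//; [|exact: locintZ..].
by rewrite /acoef /bcoef; ring.
Qed.

Lemma pconv_expansion phi M N r t : 0 <= r < 1 -> continuous phi ->
  (forall s, 0 <= s <= 2 * pi -> `|phi s| <= M) ->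
  `|pconv r phi t - trig (acoef phi) (bcoef phi) N r t|
     <= 4 * r ^+ N.+1 / (1 - r) ^+ 2 * M.
Proof.
move=> r01 cphi phiM; rewrite trig_coef// /pconv -mulrBr -dintB; last 2 first.
- exact: locint_pconv.
- apply: locint_sum => k; apply: locintZ; apply: locintM => //.
  exact: (continuousB_arg (@continuous_cosM k%:R)).
rewrite normrM gtr0_norm ?invr_gt0 ?twopi_gt0// mulrC ler_pdivrMr ?twopi_gt0//.
rewrite -[X in _ <= _ * X]subr0; apply: dint_bound.
- apply: locintB; first exact: locint_pconv.
  apply: locint_sum => k; apply: locintZ; apply: locintM => //.
  exact: (continuousB_arg (@continuous_cosM k%:R)).
- exact: ltW twopi_gt0.
move=> s hs; under eq_bigr do rewrite mulrA.
rewrite -mulr_suml -mulrBl normrM ler_pM//; last exact: phiM.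
exact: poisson_expansion.
Qed.

(** Cosines and sines of nonzero frequency have mean zero, so every partial sum of the expansion of
    the constant [1] is exactly [1], and the geometric error forces the identity. *)
Lemma pconv1 r t : 0 <= r < 1 -> pconv r (fun=> 1) t = 1.
Proof.
move=> r01; apply/subr0_eq; apply: (@eq0_geometric _ (4 * r / (1 - r) ^+ 2) r) => // N.
have n1 s : 0 <= s <= 2 * pi -> `|1 : R| <= 1 by rewrite normr1.
have c1 : continuous (fun _ : R => 1 : R) by move=> x; exact: cvg_cst.
have := @pconv_expansion (fun=> 1) 1 N r t r01 c1 n1.
have -> : trig (acoef (fun=> 1)) (bcoef (fun=> 1)) N r t = 1.
  have a0 : acoef (fun=> 1) 0 = 1.
    rewrite /acoef mulr1 (_ : dint _ _ _ = dint (fun=> 1) 0 (2 * pi)).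
      by rewrite dint_cst ?(ltW twopi_gt0)// mul1r subr0 mulVf// gt_eqF// twopi_gt0.
    by apply: eq_dint => s _; rewrite mul0r cos0 mulr1.
  rewrite /trig big_ord_recl big1 ?addr0 => [|k _]; last first.
    rewrite /acoef /bcoef /=.
    have -> : dint (fun s => cos ((bump 0 k)%:R * s) * 1) 0 (2 * pi) = 0.
      by rewrite -[RHS](dint_cos k); apply: eq_dint => s _; rewrite mulr1.
    have -> : dint (fun s => sin ((bump 0 k)%:R * s) * 1) 0 (2 * pi) = 0.
      by rewrite -[RHS](dint_sin k); apply: eq_dint => s _; rewrite mulr1.
    by rewrite !mulr0 addr0 mulr0.
  by rewrite a0 /= mul0r cos0 sin0 mul0r addr0 !mulr1.
by rewrite mulr1 exprS mulrA [X in _ -> _ <= X]mulrAC.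
Qed.

Lemma pconvE r phi t : 0 <= r < 1 -> continuous phi ->
  (forall s, phi (s + 2 * pi) = phi s) ->
  pconv r phi t = (2 * pi)^-1 * dint (fun s => poisson r s * phi (s + t)) (- pi) pi.
Proof.
move=> r01 cphi pphi; rewrite /pconv; congr (_ * _).
pose psi s := poisson r (s - t) * phi s.
have Ipsi : locint psi.
  by apply: locintM => //; apply: continuousD_arg; exact: continuous_poisson.
have ppsi s : psi (s + 2 * pi) = psi s.
  by rewrite /psi pphi addrAC poissonD2pi.
transitivity (dint psi 0 (2 * pi)).
  by apply: eq_dint => s _; rewrite /psi -opprB poissonN.
rewrite -(@dint_periodic _ psi _ twopi_gt0 Ipsi ppsi (- pi + t)).
have -> : - pi + t + 2 * pi = pi + t by ring.
by rewrite -dint_shift//; apply: eq_dint => s _; rewrite /psi addrK.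
Qed.

Lemma dint_poisson r : 0 <= r < 1 -> dint (poisson r) (- pi) pi = 2 * pi.
Proof.
move=> r01; have := pconv1 0 r01; rewrite pconvE//; last by move=> x; exact: cvg_cst.
rewrite (_ : dint _ _ _ = dint (poisson r) (- pi) pi); last first.
  by apply: eq_dint => s _; rewrite mulr1.
move=> /(congr1 ( *%R (2 * pi))); rewrite mulrA divff ?mul1r ?mulr1//.
by rewrite gt_eqF// twopi_gt0.
Qed.

(** Approximate identity: within [de] of the origin the increment [psi] is at most [e / 2], and
    farther away the kernel is at most [2 (1 - r) / (1 - cos de)], which vanishes as [r] tends to
    [1]. *)
Lemma pconv_cvg phi t e : continuous phi -> (forall s, phi (s + 2 * pi) = phi s) ->
  0 < e -> exists2 r0, 0 <= r0 < 1 &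
  forall r, r0 < r < 1 -> `|pconv r phi t - phi t| <= e.
Proof.
move=> cphi pphi e0.
pose psi s := phi (s + t) - phi t.
have cpsi : continuous psi.
  move=> s; apply: cvgB; last exact: cvg_cst.
  exact: continuousD_arg.
have [M M0 hM] := @continuous_bounded_itv psi (- pi) pi cpsi.
have [de de0 hde] : exists2 de, 0 < de <= 1 & forall s, `|s| < de -> `|psi s| <= e / 2.
  have /cvgrPdist_le/(_ (e / 2)) := cpsi 0.
  rewrite divr_gt0// => /(_ isT)/nbhs_ballP[d/= d0 hd].
  exists (Num.min d 1); first by rewrite lt_min d0 ltr01 ge_min lexx orbT.
  move=> s; rewrite lt_min => /andP[sd _]; have := hd s.
  rewrite /ball/= sub0r normrN => /(_ sd).
  by rewrite /psi add0r subrr sub0r normrN.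
have /andP[d0 d1] := de0.
have pi1 : 1 <= pi :> R by have := @pi_ge2 R; lra.
have c1 : 0 < 1 - cos de.
  rewrite subr_gt0 -cos0 ltr_cos// in_itv/=; rewrite ?lexx ?pi_ge0// ltW//=.
  exact: le_trans pi1.
(* The entry [1 / 2] makes [2 r] at least [1] in the lower bound of the denominator; the other one
   makes [2 (1 - r) M / (1 - cos de)] at most [e / 2]. *)
pose r0 := Num.max (1 / 2) (1 - e / 2 * (1 - cos de) / (2 * M)).
have r01 : 0 <= r0 < 1.
  rewrite le_max gt_max; apply/andP; split; first by rewrite divr_ge0.
  apply/andP; split; first by lra.
  by rewrite ltrBlDr ltrDl divr_gt0// ?mulr_gt0// divr_gt0.
exists r0 => // r /andP[]; rewrite gt_max => /andP[r12 rM] r1.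
have rr : 0 <= r < 1 by rewrite r1 andbT; lra.
have IP : locint (poisson r) by apply: continuous_locint; exact: continuous_poisson.
have Ip : locint (fun s => poisson r s * psi s).
  by apply: locintM => //; exact: continuous_poisson.
have -> : pconv r phi t - phi t = (2 * pi)^-1 * dint (fun s => poisson r s * psi s) (- pi) pi.
  rewrite pconvE//.
  have -> : dint (fun s => poisson r s * psi s) (- pi) pi =
      dint (fun s => poisson r s * phi (s + t) - phi t * poisson r s) (- pi) pi.
    by apply: eq_dint => s _; rewrite /psi; ring.
  rewrite dintB; last 2 first.
  - apply: locintM; first exact: continuous_poisson.
    exact: continuousD_arg.
  - exact: locintZ.
  rewrite dintZ// dint_poisson// mulrBr [(2 * pi)^-1 * (phi t * _)]mulrCA.
  by rewrite mulVf ?mulr1// gt_eqF// twopi_gt0.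
rewrite normrM gtr0_norm ?invr_gt0 ?twopi_gt0// mulrC ler_pdivrMr ?twopi_gt0//.
apply: (le_trans (dint_norm _ _ Ip)).
(* A single dominating integrand serves near the origin and far from it; its mean is [e] because the
   kernel has mean [1]. *)
apply: (@le_trans _ _ (dint (fun s => e / 2 * poisson r s + e / 2) (- pi) pi)); last first.
  rewrite dintD; [|exact: locintZ|exact: locint_cst].
  rewrite dintZ// dint_poisson// dint_cst; last by rewrite ge0_cp// pi_ge0.
  by rewrite le_eqVlt; apply/orP; left; apply/eqP; field.
apply: ler_dint.
- exact: locint_norm.
- by apply: locintD; [exact: locintZ|exact: locint_cst].
move=> s hs; have P0 := poisson_gt0 s rr.
rewrite normrM gtr0_norm//.
have [sd|sd] := ltP `|s| de.
  apply: (@le_trans _ _ (poisson r s * (e / 2))).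
    by rewrite ler_wpM2l//; [exact: ltW|exact: hde].
  by rewrite mulrC lerDl divr_ge0// ltW.
apply: (@le_trans _ _ (e / 2)); last first.
  by rewrite lerDr; apply: mulr_ge0; apply: ltW => //; exact: divr_gt0.
have cs : cos s <= cos de.
  rewrite -(cos_norm s) leNgt ltr_cos -?leNgt// in_itv/= ?normr_ge0 /=.
    by rewrite ler_norml.
  by rewrite ltW//= (le_trans d1).
have hP : poisson r s <= 2 * (1 - r) / (1 - cos de).
  rewrite /poisson ler_pdivrMr ?poisson_den_gt0// mulrAC ler_pdivlMr//.
  rewrite poisson_denE (_ : 1 - r ^+ 2 = (1 - r) * (1 + r)); last by ring.
  set D := (1 - r) ^+ 2 + _.
  rewrite -[leRHS]mulrA [leRHS]mulrCA -[leLHS]mulrA ler_wpM2l//.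
    by rewrite subr_ge0 ltW.
  apply: (@le_trans _ _ (2 * (1 - cos de))).
    by apply: ler_wpM2r; [exact: ltW|lra].
  rewrite ler_wpM2l// (@le_trans _ _ (2 * r * (1 - cos s)))//; last first.
    by rewrite lerDr sqr_ge0.
  by rewrite -[leLHS]mul1r; apply: ler_pM; lra.
apply: (@le_trans _ _ (2 * (1 - r) / (1 - cos de) * M)).
  by apply: ler_pM => //; [exact: ltW|exact: hM].
rewrite mulrAC ler_pdivrMr// -ler_pdivlMr//.
have hX : e / 2 * (1 - cos de) / (2 * M) = e / 2 * (1 - cos de) / M / 2.
  by field; rewrite gt_eqF.
by move: rM; rewrite hX; set X := _ / M; lra.
Qed.

End poisson_integral.

Lemma subr_addrACA (V : zmodType) (x x' y y' u u' v v' : V) :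
  x + x' - (y + y') - (u + u' + (v + v')) = (x - y - (u + v)) + (x' - y' - (u' + v')).
Proof.
rewrite (addrACA u) (opprD y) (addrACA x) (opprD (u + v)).
by rewrite [LHS]addrACA.
Qed.

(** * Total differentials in two real variables *)

Section partials.
Context {R : realType}.
Implicit Types (s t : R).

(** This is total differentiability, for curried functions: the existence of partial derivatives
    alone would be too weak for Goursat's argument. The sum norm on the plane is that of
    [closed_form_at]. *)
Definition has_partials (V : normedModType R) (F : R -> R -> V) s t (a b : V) :=
  forall e : R, 0 < e -> exists2 d : R, 0 < d & forall s' t',
    `|s' - s| < d -> `|t' - t| < d ->
    `|F s' t' - F s t - ((s' - s) *: a + (t' - t) *: b)| <= e * (`|s' - s| + `|t' - t|).

Lemma has_partials_lip (V : normedModType R) (F : R -> R -> V) s t a b :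
  has_partials F s t a b -> exists2 K : R, 0 < K & exists2 d : R, 0 < d &
    forall s' t', `|s' - s| < d -> `|t' - t| < d ->
    `|F s' t' - F s t| <= K * (`|s' - s| + `|t' - t|).
Proof.
move=> /(_ 1 ltr01)[d d0 hd].
exists (1 + `|a| + `|b|); first by rewrite -addrA ltr_pwDl// addr_ge0.
exists d => // s' t' hs ht; have := hd s' t' hs ht.
rewrite mul1r => h.
rewrite -[X in `|X|](subrK ((s' - s) *: a + (t' - t) *: b)).
rewrite (le_trans (ler_normD _ _))//.
have h1 : `|(s' - s) *: a + (t' - t) *: b| <= `|s' - s| * `|a| + `|t' - t| * `|b|.
  by rewrite (le_trans (ler_normD _ _))// !normrZ.
apply: (le_trans (lerD h h1)).
have := normr_ge0 (s' - s); have := normr_ge0 (t' - t).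
have := normr_ge0 a; have := normr_ge0 b.
set A := `|a|; set B := `|b|; set S := `|s' - s|; set T := `|t' - t|.
move=> B0 A0 T0 S0; rewrite -subr_ge0.
rewrite (_ : _ - _ = B * S + A * T); last by ring.
by rewrite addr_ge0// mulr_ge0.
Qed.

Lemma has_partialsD (V : normedModType R) (F G : R -> R -> V) s t a b a' b' :
  has_partials F s t a b -> has_partials G s t a' b' ->
  has_partials (fun s t => F s t + G s t) s t (a + a') (b + b').
Proof.
move=> hF hG e e0.
have [d1 d10 h1] := hF (e / 2) (divr_gt0 e0 (ltr0n _ 2)).
have [d2 d20 h2] := hG (e / 2) (divr_gt0 e0 (ltr0n _ 2)).
exists (Num.min d1 d2); first by rewrite lt_min d10.
move=> s' t'; rewrite !lt_min => /andP[s1 s2] /andP[t1 t2].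
have {}h1 := h1 s' t' s1 t1; have {}h2 := h2 s' t' s2 t2.
rewrite [X in `|X|](_ : _ = (F s' t' - F s t - ((s' - s) *: a + (t' - t) *: b)) +
   (G s' t' - G s t - ((s' - s) *: a' + (t' - t) *: b'))); last first.
  by rewrite !scalerDr subr_addrACA.
rewrite (le_trans (ler_normD _ _))//; apply: (le_trans (lerD h1 h2)).
by rewrite -mulrDl -splitr.
Qed.

Lemma has_partials_comp (V W : normedModType R) (f : V -> W) (G : R -> R -> V) s t a b :
  differentiable f (G s t) -> has_partials G s t a b ->
  has_partials (fun s t => f (G s t)) s t ('d f (G s t) a) ('d f (G s t) b).
Proof.
move=> df hG e e0; set x := G s t.
have [K K0 [d1 d10 hK]] := has_partials_lip hG.
have [r r0 hr] : exists2 r : R, 0 < r & forall h, `|'d f x h| <= r * `|h|.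
  have := diff_continuous df => /linear_bounded_continuous/linear_boundedP.
  move=> /pinfty_ex_gt0[r r0 hr]; by exists r.
have [d2 d20 h2] : exists2 d2 : R, 0 < d2 & forall h : V, `|h| < d2 ->
    `|f (h + x) - f x - 'd f x h| <= e / (2 * K) * `|h|.
  have [_ /eqaddoP/(_ (e / (2 * K)))] := (diff_locallyP x f).1 df.
  rewrite divr_gt0 ?mulr_gt0// => /(_ isT)/nbhs_ballP[d2/= d20 hd].
  exists d2 => // h hd2; have := hd h.
  rewrite -ball_normE /ball_/= sub0r normrN => /(_ hd2).
  by rewrite !fctE /= opprD addrA.
have [d3 d30 h3] := hG (e / (2 * r)) (divr_gt0 e0 (mulr_gt0 (ltr0n _ 2) r0)).
(* [K] is a Lipschitz constant of [G] at the point, so increments below [d2 / (2 K)] in both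
   variables move [G] by less than [d2]. *)
pose d := Num.min (Num.min d1 d3) (d2 / (2 * K)).
exists d; first by rewrite !lt_min d10 d30 divr_gt0 ?mulr_gt0.
move=> s' t'; rewrite !lt_min => /andP[/andP[s1 s3] s2] /andP[/andP[t1 t3] t2].
have {}hK := hK s' t' s1 t1; have {}h3 := h3 s' t' s3 t3.
pose h := G s' t' - x.
have hd2 : `|h| < d2.
  apply: (le_lt_trans hK).
  rewrite mulrC -ltr_pdivlMr//.
  have -> : d2 / K = d2 / (2 * K) + d2 / (2 * K) by field; rewrite gt_eqF.
  exact: ltrD.
have {}h2 := h2 h hd2; rewrite {1}/h subrK in h2.
have e1 : 'd f x h - ((s' - s) *: 'd f x a + (t' - t) *: 'd f x b) =
    'd f x (h - ((s' - s) *: a + (t' - t) *: b)).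
  rewrite [RHS](linearB ('d f x)); congr (_ - _).
  rewrite [RHS](linearD ('d f x)).
  by congr (_ + _); apply/esym; exact: (linearZZ ('d f x)).
rewrite -[X in `|X|](subrKA ('d f x h)).
rewrite (le_trans (ler_normD _ _))// e1.
have h4 := le_trans (hr (h - ((s' - s) *: a + (t' - t) *: b))) (ler_wpM2l (ltW r0) h3).
apply: (le_trans (lerD h2 h4)).
have h5 : e / (2 * K) * `|h| <= e / (2 * K) * (K * (`|s' - s| + `|t' - t|)).
  by rewrite ler_wpM2l// divr_ge0 ?ltW// mulr_gt0.
apply: (le_trans (lerD h5 (lexx _))).
rewrite le_eqVlt; apply/orP; left; apply/eqP; field.
by rewrite !gt_eqF.
Qed.

Lemma has_partials_fst s t : has_partials (fun s _ => s) s t (1 : R) 0.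
Proof.
move=> e e0; exists 1 => // s' t' _ _.
rewrite scaler0 addr0 [_ *: _]mulr1 subrr normr0 mulr_ge0// ?addr_ge0//.
exact: ltW.
Qed.

Lemma has_partials_snd s t : has_partials (fun _ t => t) s t (0 : R) 1.
Proof.
move=> e e0; exists 1 => // s' t' _ _.
rewrite scaler0 add0r [_ *: _]mulr1 subrr normr0 mulr_ge0// ?addr_ge0//.
exact: ltW.
Qed.

Lemma has_partials_comp1 (f : R -> R) (G : R -> R -> R) s t (a b df : R) :
  is_derive (G s t) (1 : R) f df -> has_partials G s t a b ->
  has_partials (fun s t => f (G s t)) s t (df * a) (df * b).
Proof.
move=> fd hG; have [dd de] := fd.
have df' : differentiable f (G s t) by apply/derivable1_diffP.
have dE h : 'd f (G s t) h = df * h.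
  by rewrite deriv1E// derive1E de [LHS]mulrC.
by rewrite -!dE; exact: has_partials_comp.
Qed.

Lemma has_partialsZl (V : normedModType R) (F : R -> R -> R) (v : V) s t (a b : R) :
  has_partials F s t a b -> has_partials (fun s t => F s t *: v) s t (a *: v) (b *: v).
Proof.
move=> hF e e0.
have v0 : 0 < `|v| + 1 by rewrite ltr_wpDl.
have [d d0 hd] := hF (e / (`|v| + 1)) (divr_gt0 e0 v0).
exists d => // s' t' hs ht.
rewrite !scalerA -scalerDl -!scalerBl normrZ.
apply: (@le_trans _ _ (e / (`|v| + 1) * (`|s' - s| + `|t' - t|) * (`|v| + 1))).
  by apply: ler_pM => //; [exact: hd|rewrite lerDl].
by rewrite mulrAC divfK// gt_eqF.
Qed.

Lemma has_partialsM (F G : R -> R -> R) s t (a b a' b' : R) :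
  has_partials F s t a b -> has_partials G s t a' b' ->
  has_partials (fun s t => F s t * G s t) s t
    (a * G s t + F s t * a') (b * G s t + F s t * b').
Proof.
move=> hF hG e e0.
have [K K0 [d1 d10 hK]] := has_partials_lip hF.
have [L L0 [d2 d20 hL]] := has_partials_lip hG.
have G0 : 0 < `|G s t| + 1 by rewrite ltr_wpDl.
have F0 : 0 < `|F s t| + 1 by rewrite ltr_wpDl.
have KL0 : 0 < K * L by exact: mulr_gt0.
have e30 : 0 < e / 3 by exact: divr_gt0.
have [d3 d30 h3] := hF (e / 3 / (`|G s t| + 1)) (divr_gt0 e30 G0).
have [d4 d40 h4] := hG (e / 3 / (`|F s t| + 1)) (divr_gt0 e30 F0).
pose d5 := e / 3 / (2 * (K * L)).
have d50 : 0 < d5 by rewrite divr_gt0// mulr_gt0.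
exists (Num.min (Num.min d1 d2) (Num.min (Num.min d3 d4) d5)).
  by rewrite !lt_min d10 d20 d30 d40 d50.
move=> s' t'; rewrite !lt_min.
move=> /andP[/andP[s1 s2] /andP[/andP[s3 s4] s5]] /andP[/andP[t1 t2] /andP[/andP[t3 t4] t5]].
have {}h3 := h3 s' t' s3 t3; have {}h4 := h4 s' t' s4 t4.
have {}hK := hK s' t' s1 t1; have {}hL := hL s' t' s2 t2.
set D := `|s' - s| + `|t' - t| in h3 h4 hK hL *.
have D0 : 0 <= D by rewrite addr_ge0.
(* Two first-order remainders, each multiplied by a value at the base point, and a product of two
   increments, which is of second order; each gets a third of [e]. *)
rewrite [X in `|X|](_ : _ =
  (F s' t' - F s t - ((s' - s) * a + (t' - t) * b)) * G s t +
  (G s' t' - G s t - ((s' - s) * a' + (t' - t) * b')) * F s t +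
  (F s' t' - F s t) * (G s' t' - G s t)); last first.
  by rewrite /GRing.scale/=; ring.
have b1 : `|(F s' t' - F s t - ((s' - s) * a + (t' - t) * b)) * G s t| <= e / 3 * D.
  rewrite normrM; apply: (@le_trans _ _ (e / 3 / (`|G s t| + 1) * D * (`|G s t| + 1))).
    by apply: ler_pM => //; rewrite lerDl.
  by rewrite mulrAC divfK// gt_eqF.
have b2 : `|(G s' t' - G s t - ((s' - s) * a' + (t' - t) * b')) * F s t| <= e / 3 * D.
  rewrite normrM; apply: (@le_trans _ _ (e / 3 / (`|F s t| + 1) * D * (`|F s t| + 1))).
    by apply: ler_pM => //; rewrite lerDl.
  by rewrite mulrAC divfK// gt_eqF.
have b3 : `|(F s' t' - F s t) * (G s' t' - G s t)| <= e / 3 * D.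
  rewrite normrM; apply: (@le_trans _ _ (K * D * (L * D))); first exact: ler_pM.
  rewrite mulrACA mulrA ler_wpM2r//.
  apply: (@le_trans _ _ (K * L * (2 * d5))).
    rewrite ler_wpM2l ?ltW// mulr_natl mulr2n; exact: ltrD.
  by rewrite /d5 le_eqVlt; apply/orP; left; apply/eqP; field; rewrite !gt_eqF.
rewrite (le_trans (ler_normD _ _))//.
rewrite (le_trans (lerD (le_trans (ler_normD _ _) (lerD b1 b2)) b3))//.
by rewrite le_eqVlt; apply/orP; left; apply/eqP; field.
Qed.

(** Serves to pass to a truncation in the first variable, which agrees with the original function
    only for [s' < s0]. *)
Lemma has_partials_near (V : normedModType R) (F F' : R -> R -> V) s t s0 a b :
  s < s0 -> (forall s' t', s' < s0 -> F s' t' = F' s' t') ->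
  has_partials F s t a b -> has_partials F' s t a b.
Proof.
move=> ss0 FF hF e e0; have [d d0 hd] := hF e e0.
exists (Num.min d (s0 - s)); first by rewrite lt_min d0 subr_gt0.
move=> s' t'; rewrite !lt_min => /andP[sd s'0] /andP[td _].
rewrite -!FF//; first exact: hd.
by move: s'0; rewrite ltr_norml => /andP[_]; rewrite ltrD2r.
Qed.

Lemma closed_form_partials (P Q : R -> R -> R) s t (a b d : R) :
  has_partials P s t a b -> has_partials Q s t b d -> closed_form_at P Q s t.
Proof.
move=> hP hQ; exists a, b, d => e e0.
have [d1 d10 h1] := hP e e0; have [d2 d20 h2] := hQ e e0.
exists (Num.min d1 d2); first by rewrite lt_min d10.
move=> s' t'; rewrite !lt_min => /andP[s1 s2] /andP[t1 t2].
have {}h1 := h1 s' t' s1 t1; have {}h2 := h2 s' t' s2 t2.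
split.
  by move: h1; congr (`|_| <= _); rewrite /GRing.scale/=; ring.
by move: h2; congr (`|_| <= _); rewrite /GRing.scale/=; ring.
Qed.

End partials.

(** * Quaternions and slices *)

Section quaternion_norm.
Context {R : realType}.
Local Notation H := (quat R).
Implicit Types (w x y i : H) (a b s t : R).

Lemma qnormE x : `|x| = qnorm x. Proof. by []. Qed.

Definition qsq x : R := qre x ^+ 2 + qi x ^+ 2 + qj x ^+ 2 + qk x ^+ 2.

Lemma qsq_ge0 x : 0 <= qsq x.
Proof. by rewrite !addr_ge0 ?sqr_ge0. Qed.

Lemma sqr_qnorm x : `|x| ^+ 2 = qsq x.
Proof. by rewrite qnormE sqr_sqrtr// qsq_ge0. Qed.

(** After squaring, this is Euler's four-square identity. *)
Lemma qnormM x y : `|x * y| = `|x| * `|y|.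
Proof.
apply/eqP; rewrite -(@eqrXn2 _ 2) ?mulr_ge0//; apply/eqP.
by rewrite exprMn !sqr_qnorm /qsq /=; ring.
Qed.

Lemma qre_le x : `|qre x| <= `|x|.
Proof.
rewrite -(@ler_pXn2r _ 2) ?nnegrE// sqr_qnorm real_normK ?num_real//.
by rewrite /qsq -!addrA lerDl !addr_ge0 ?sqr_ge0.
Qed.

(** The real linear functionals on the quaternions are exactly these. Left factors move into the
    weight ([lin_mul]), so multiplying the values of a function by [i] amounts to replacing [w] by
    [w * i]. *)
Definition lin w x : R := qre (w * x).

Lemma lin_norm w x : `|lin w x| <= `|w| * `|x|.
Proof. by rewrite -qnormM qre_le. Qed.

Lemma linD w x y : lin w (x + y) = lin w x + lin w y.
Proof. by rewrite /lin mulrDr. Qed.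

Lemma linN w x : lin w (- x) = - lin w x.
Proof. by rewrite /lin mulrN. Qed.

Lemma linB w x y : lin w (x - y) = lin w x - lin w y.
Proof. by rewrite linD linN. Qed.

Lemma linZ w a x : lin w (a *: x) = a * lin w x.
Proof. by rewrite /lin -scalerAr. Qed.

Lemma linNl w x : lin (- w) x = - lin w x.
Proof. by rewrite /lin mulNr. Qed.

Lemma lin_mul w x y : lin w (x * y) = lin (w * x) y.
Proof. by rewrite /lin mulrA. Qed.

Lemma lin0 w : lin w 0 = 0.
Proof. by rewrite /lin mulr0. Qed.

Lemma lin_sum w (I : Type) (r : seq I) (P : pred I) (F : I -> H) :
  lin w (\sum_(k <- r | P k) F k) = \sum_(k <- r | P k) lin w (F k).
Proof. exact: (big_morph (lin w) (linD w) (lin0 w)). Qed.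

Lemma continuous_lin w : continuous (lin w).
Proof.
move=> x; apply/(@cvgrPdist_le _ _ _ (nbhs x)) => /= e e0.
have w0 : 0 < `|w| + 1 by rewrite ltr_wpDl.
near=> y; rewrite -linB (le_trans (lin_norm _ _))//.
apply: (@le_trans _ _ ((`|w| + 1) * (e / (`|w| + 1)))); last first.
  by rewrite mulrC divfK// gt_eqF.
apply: ler_pM => //; first by rewrite lerDl.
near: y; apply: cvgr_dist_le; first exact: cvg_id.
exact: divr_gt0.
Unshelve. all: by end_near. Qed.

Definition qI : H := Quat 0 1 0 0.
Definition qJ : H := Quat 0 0 1 0.
Definition qK : H := Quat 0 0 0 1.

(* Signs are such that [lin (qbasis n)] is the [n]-th real coordinate. *)
Definition qbasis (n : 'I_4) : H := [tuple 1; - qI; - qJ; - qK]`_n.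

Lemma lin1 x : lin 1 x = qre x. Proof. by rewrite /lin mul1r. Qed.
Lemma linI x : lin (- qI) x = qi x. Proof. by rewrite /lin /=; ring. Qed.
Lemma linJ x : lin (- qJ) x = qj x. Proof. by rewrite /lin /=; ring. Qed.
Lemma linK x : lin (- qK) x = qk x. Proof. by rewrite /lin /=; ring. Qed.

Lemma norm_qbasis n : `|qbasis n| = 1.
Proof.
apply/eqP; rewrite -(@eqrXn2 _ 2)// sqr_qnorm expr1n.
by case: n => -[|[|[|[|]]]]//= ?; rewrite /qsq /qbasis /=; apply/eqP; ring.
Qed.

Lemma sqr_qnorm_lin x : `|x| ^+ 2 = \sum_(n < 4) lin (qbasis n) x ^+ 2.
Proof.
by rewrite sqr_qnorm !big_ord_recl big_ord0 /qbasis/= lin1 linI linJ linK /qsq addr0 !addrA.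
Qed.

Lemma qalgM a x : a%:A * x = a *: x.
Proof. by rewrite -scalerAl mul1r. Qed.

Section unit.
Variable i : H.
Hypothesis ui : imag_units R i.

Lemma unit_sqr : i * i = -1.
Proof.
have [i0 i1] := ui; have : `|i| ^+ 2 = 1 by rewrite i1 expr1n.
rewrite sqr_qnorm /qsq i0 => h.
by apply: quatP => /=; rewrite i0; lra.
Qed.

Lemma unitN : imag_units R (- i).
Proof. by have [i0 i1] := ui; split; rewrite ?normrN//= i0 oppr0. Qed.

Lemma norm_slice a b : `|a%:A + b *: i| = Num.sqrt (a ^+ 2 + b ^+ 2).
Proof.
have [i0 i1] := ui; have : `|i| ^+ 2 = 1 by rewrite i1 expr1n.
rewrite sqr_qnorm /qsq i0 => h.
apply/eqP; rewrite -(@eqrXn2 _ 2) ?sqrtr_ge0// sqr_qnorm.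
rewrite /qsq /= i0 sqr_sqrtr ?addr_ge0 ?sqr_ge0//; apply/eqP.
have -> : a ^+ 2 + b ^+ 2 =
  a ^+ 2 + b ^+ 2 * (0 ^+ 2 + qi i ^+ 2 + qj i ^+ 2 + qk i ^+ 2) by rewrite h mulr1.
by ring.
Qed.

Lemma norm_qcis t : `|qcis i t| = 1.
Proof. by rewrite norm_slice cos2Dsin2 sqrtr1. Qed.

Lemma qcisD2pi t : qcis i (t + 2 * pi) = qcis i t.
Proof. by rewrite /qcis cosD2pi' sinD2pi'. Qed.

Lemma qcisD s t : qcis i s * qcis i t = qcis i (s + t).
Proof.
rewrite /qcis mulrDl !mulrDr !qalgM -!scalerAl -!scalerAr mulr1 unit_sqr.
rewrite !scalerA cosD sinD scalerBl scalerDl scalerN.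
rewrite [in RHS]addrAC -!addrA; congr (_ + _).
by rewrite addrCA.
Qed.

Lemma qcisX n t : qcis i t ^+ n = qcis i (n%:R * t).
Proof.
elim: n => [|n ih]; first by rewrite mul0r expr0 /qcis cos0 sin0 scale1r scale0r addr0.
by rewrite exprS ih qcisD [in RHS]mulrS mulrDl mul1r.
Qed.

End unit.

Lemma continuous_mull w : continuous ( *%R w : H -> H).
Proof.
move=> x; apply/(@cvgrPdist_le _ _ _ (nbhs x)) => /= e e0.
have w0 : 0 < `|w| + 1 by rewrite ltr_wpDl.
near=> y; rewrite -mulrBr qnormM.
apply: (@le_trans _ _ ((`|w| + 1) * (e / (`|w| + 1)))); last first.
  by rewrite mulrC divfK// gt_eqF.
apply: ler_pM => //; first by rewrite lerDl.
near: y; apply: cvgr_dist_le; first exact: cvg_id.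
exact: divr_gt0.
Unshelve. all: by end_near. Qed.

Lemma is_derive_mull w (g : R -> H) u dg : is_derive u (1 : R) g dg ->
  is_derive u (1 : R) (fun t => w * g t) (w * dg).
Proof.
move=> [dg1 dgE].
have cg : h^-1 *: (w * g (h *: (1 : R) + u) - w * g u) @[h --> 0^'] --> w * dg.
  rewrite -dgE.
  have -> : (fun h : R => h^-1 *: (w * g (h *: (1 : R) + u) - w * g u)) =
      *%R w \o (fun h : R => h^-1 *: (g (h *: (1 : R) + u) - g u)).
    by apply/funext => h /=; rewrite -mulrBr scalerAr.
  by apply: continuous_cvg; [exact: continuous_mull|exact: dg1].
split; first by apply/cvg_ex; exists (w * dg).
exact/cvg_lim.
Qed.

Lemma qcisN i t : qcis (- i) t = qcis i (- t).
Proof. by rewrite /qcis cosN sinN scalerN scaleNr. Qed.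

Lemma continuous_qcis i : continuous (qcis i).
Proof.
move=> t; apply: cvgD; apply: cvgZr_tmp.
  exact: continuous_cos.
exact: continuous_sin.
Qed.

End quaternion_norm.

(** * The Cauchy-Riemann equation on one slice *)

Section slice.
Context {R : realType}.
Local Notation H := (quat R).
Variables (f : H -> H) (i : H).
Hypothesis fSH : slice_hyperholomorphic R f.
Hypothesis ui : imag_units R i.

(** The parity of [alpha] and [beta] removes the restriction [0 <= v]: for negative [v] the point is
    read with [- j] and [- v]. *)
Lemma slice_formula : exists alpha beta : R -> R -> H,
  (forall j u v, imag_units R j -> u ^+ 2 + v ^+ 2 < 1 ->
     f (u%:A + v *: j) = alpha u v + j * beta u v) /\
  (forall u v, u ^+ 2 + v ^+ 2 < 1 ->
     [/\ derivable (alpha^~ v) u 1, derivable (alpha u) v 1,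
           derivable (beta^~ v) u 1 & derivable (beta u) v 1] /\
       [/\ derive1 (alpha^~ v) u = derive1 (beta u) v
         & derive1 (beta^~ v) u = - derive1 (alpha u) v]).
Proof.
have [_ [al [be [h1 h2]]]] := fSH; exists al, be; split; last first.
  by move=> u v /h2[_].
move=> j u v uj uv; have [v0|v0] := leP 0 v; first exact: h1.
have uvN : u ^+ 2 + (- v) ^+ 2 < 1 by rewrite sqrrN.
have := h1 (- j) u (- v) (unitN uj).
rewrite oppr_ge0 => /(_ (ltW v0) uvN); rewrite scaleNr scalerN opprK => ->.
by have [[-> ->] _] := h2 u v uv; rewrite mulrNN.
Qed.

Lemma SH_diff x : unit_ball R x -> differentiable f x.
Proof. by have [h _] := fSH; exact: h. Qed.

Lemma SH_continuous x : unit_ball R x -> {for x, continuous f}.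
Proof. by move=> /SH_diff; exact: differentiable_continuous. Qed.

(* The Cauchy-Riemann equation on the slice spanned by [1] and [i]. *)
Lemma diff_slice u v : u ^+ 2 + v ^+ 2 < 1 ->
  'd f (u%:A + v *: i) i = i * 'd f (u%:A + v *: i) 1.
Proof.
move=> uv; have [al [be [h1 h2]]] := slice_formula.
have [[da1 da2 db1 db2] [e1 e2]] := h2 u v uv.
set x := u%:A + v *: i.
have xb : unit_ball R x.
  rewrite /unit_ball /= norm_slice//.
  by rewrite -[ltRHS]sqrtr1 ltr_sqrt.
have df := SH_diff xb.
have nu : \forall u' \near u, u' ^+ 2 + v ^+ 2 < 1.
  have cu : continuous (fun u' : R => u' ^+ 2 + v ^+ 2).
    by move=> z; apply: cvgD; [exact: exprn_continuous|exact: cvg_cst].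
  by apply: (cvgr_lt _ (cu u)).
have nv : \forall v' \near v, u ^+ 2 + v' ^+ 2 < 1.
  have cv : continuous (fun v' : R => u ^+ 2 + v' ^+ 2).
    by move=> z; apply: cvgD; [exact: cvg_cst|exact: exprn_continuous].
  by apply: (cvgr_lt _ (cv v)).
have nF u' v' : u' ^+ 2 + v' ^+ 2 < 1 -> f (u'%:A + v' *: i) = al u' v' + i * be u' v'.
  exact: h1.
have D1 (g h : R -> H) z : derivable g z 1 -> derivable h z 1 ->
    'D_1 (fun t => g t + i * h t) z = derive1 g z + i * derive1 h z.
  move=> dg dh; rewrite !derive1E.
  have ig := derivableP dg; have ih := is_derive_mull i (derivableP dh).
  by have [_ ->] := is_deriveD ig ih.
have E1 : 'd f x 1 = derive1 (al^~ v) u + i * derive1 (be^~ v) u.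
  rewrite -D1// -deriveE//.
  transitivity ('D_1 (fun u' : R => f (u'%:A + v *: i)) u).
    rewrite /derive.
    suff -> : (fun h : R => h^-1 *: ((f \o shift x) (h *: (1 : H)) - f x)) =
      (fun h : R => h^-1 *: (((fun u' : R => f (u'%:A + v *: i)) \o shift u) (h *: (1 : R)) - f (u%:A + v *: i))) by [].
    apply/funext => h /=; congr (_ *: (f _ - _)).
    by rewrite /x addrA scalerDl [h *: (1 : R)]mulr1.
  apply: near_eq_derive.
  by near=> u'; apply: nF; near: u'.
have E2 : 'd f x i = derive1 (al u) v + i * derive1 (be u) v.
  rewrite -D1// -deriveE//.
  transitivity ('D_1 (fun v' : R => f (u%:A + v' *: i)) v).
    rewrite /derive.
    suff -> : (fun h : R => h^-1 *: ((f \o shift x) (h *: i) - f x)) =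
      (fun h : R => h^-1 *: (((fun v' : R => f (u%:A + v' *: i)) \o shift v) (h *: (1 : R)) - f (u%:A + v *: i))) by [].
    apply/funext => h /=; congr (_ *: (f _ - _)).
    by rewrite /x addrCA scalerDl [h *: (1 : R)]mulr1.
  apply: near_eq_derive.
  by near=> v'; apply: nF; near: v'.
by rewrite E1 E2 e1 e2 mulrDr mulrA unit_sqr// mulN1r opprK addrC.
Unshelve. all: by end_near. Qed.

End slice.

(** * Fourier coefficients on a slice *)

Section harmonic_def.
Context {R : realType}.

(* The Fourier coefficients on the circle of radius [rho] are those of the
   Poisson integral of a boundary function with coefficients [a] and [b]. *)
Definition harmonic (U : R -> R -> R) (a b : nat -> R) := forall rho, 0 < rho < 1 ->
  [/\ continuous (U rho), forall t, U rho (t + 2 * pi) = U rho t &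
    forall n : nat, acoef (U rho) n = rho ^+ n * a n /\ bcoef (U rho) n = rho ^+ n * b n].

End harmonic_def.

Section slice_fourier.
Context {R : realType}.
Local Notation H := (quat R).
Variables (f : H -> H) (i : H).
Hypothesis fSH : slice_hyperholomorphic R f.
Hypothesis ui : imag_units R i.

Definition radial w rho t : R := lin w (f (rho *: qcis i t)).

(** Logarithmic polar coordinates: the point is [exp(s + i t)], so that in [(s, t)] the
    Cauchy-Riemann equation reads [d/dt = i d/ds]. *)
Let phi w s t : R := radial w (expR s) t.

Lemma has_partials_lin w (F : R -> R -> H) s t a b :
  has_partials F s t a b -> has_partials (fun s t => lin w (F s t)) s t (lin w a) (lin w b).
Proof.
move=> hF e e0.
have v0 : 0 < `|w| + 1 by rewrite ltr_wpDl.
have [d d0 hd] := hF (e / (`|w| + 1)) (divr_gt0 e0 v0).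
exists d => // s' t' hs ht.
rewrite [X in `|X|](_ : _ = lin w (F s' t' - F s t - ((s' - s) *: a + (t' - t) *: b))); last first.
  by rewrite !linB linD !linZ.
rewrite (le_trans (lin_norm _ _))//.
apply: (@le_trans _ _ ((`|w| + 1) * (e / (`|w| + 1) * (`|s' - s| + `|t' - t|)))).
  by apply: ler_pM => //; [rewrite lerDl|exact: hd].
by rewrite mulrA mulrCA divff ?mulr1// gt_eqF.
Qed.

Lemma norm_scale_qcis rho t : `|rho *: qcis i t| = `|rho|.
Proof. by rewrite normrZ norm_qcis// mulr1. Qed.

Lemma ball_scale_qcis rho t : `|rho| < 1 -> unit_ball R (rho *: qcis i t).
Proof. by move=> h; rewrite /unit_ball /= norm_scale_qcis. Qed.

Lemma scale_qcisE rho t : rho *: qcis i t = (rho * cos t)%:A + (rho * sin t) *: i.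
Proof. by rewrite /qcis scalerDr !scalerA. Qed.

(** By [diff_slice] the differential of [f] in a direction [z] of the slice is [z * 'd f x 1];
    varying [s] moves in the direction [x], and varying [t] in the direction [i * x]. *)
Lemma partials_phi w s t : s < 0 ->
  let x := expR s *: qcis i t in
  let m := x * 'd f x 1 in
  has_partials (phi w) s t (lin w m) (lin (w * i) m).
Proof.
move=> s0 x m; rewrite -lin_mul; apply: has_partials_lin.
have hs := has_partials_comp1 (is_derive_expR s) (has_partials_fst s t).
have hc := has_partials_comp1 (is_derive_cos t) (has_partials_snd s t).
have hn := has_partials_comp1 (is_derive_sin t) (has_partials_snd s t).
have := has_partialsD (has_partialsZl (1 : H) (has_partialsM hs hc))
   (has_partialsZl i (has_partialsM hs hn)).
rewrite !mulr1 !mulr0 !mul0r !addr0 !add0r mulrN => hG.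
have xb : unit_ball R x.
  by apply: ball_scale_qcis; rewrite ger0_norm ?expR_ge0// expR_lt1.
have xE : x = (expR s * cos t)%:A + (expR s * sin t) *: i by exact: scale_qcisE.
have n1 : (expR s * cos t) ^+ 2 + (expR s * sin t) ^+ 2 < 1.
  rewrite !exprMn -mulrDr cos2Dsin2 mulr1 expr_lt1 ?expR_ge0//.
  by rewrite expR_lt1.
have di : 'd f x i = i * 'd f x 1 by rewrite xE; apply: diff_slice.
have df : differentiable f ((expR s * cos t)%:A + (expR s * sin t) *: i).
  by rewrite -xE; exact: SH_diff.
have := has_partials_comp df hG; rewrite -xE.
rewrite [X in has_partials _ _ _ X _](_ : _ = m); last first.
  transitivity ('d f x ((expR s * cos t)%:A + (expR s * sin t) *: i)).
    by congr ('d f x _).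
  rewrite [LHS](linearD ('d f x)) [X in X + _](linearZZ ('d f x)).
  by rewrite [X in _ + X](linearZZ ('d f x)) di -qalgM scalerAl -mulrDl -xE.
rewrite [X in has_partials _ _ _ _ X](_ : _ = i * m); last first.
  rewrite [LHS](linearD ('d f x)) [X in X + _](linearZZ ('d f x)).
  rewrite [X in _ + X](linearZZ ('d f x)) di -qalgM scalerAl -mulrDl /m mulrA; congr (_ * _).
  rewrite xE mulrDr -!scalerAr mulr1 unit_sqr// scalerN addrC; congr (_ + _).
  by rewrite scaleNr.
by apply: (@has_partials_near _ _ _ _ _ _ 0) => // s' t' _; rewrite scale_qcisE.
Qed.

(** This is [Re(w z^c f(z))] at [z = exp(s + i t)], which satisfies the same Cauchy-Riemann equation
    as [phi]. Its integral over [t] is [rho^c] times a Fourier integral of [f] on the circle of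
    radius [rho = exp s]. *)
Let Q c w s t : R := expR (c * s) *
  (cos (c * t) * phi w s t + sin (c * t) * phi (w * i) s t).

Lemma mulii w : w * i * i = - w.
Proof. by rewrite -mulrA unit_sqr// mulrN1. Qed.

Lemma partials_Q c w s t : s < 0 ->
  let x := expR s *: qcis i t in
  let m w := lin w (x * 'd f x 1) in
  has_partials (Q c w) s t
  (expR (c * s) * (c * (cos (c * t) * phi w s t + sin (c * t) * phi (w * i) s t) +
      cos (c * t) * m w + sin (c * t) * m (w * i)))
  (expR (c * s) * (c * (cos (c * t) * phi (w * i) s t - sin (c * t) * phi w s t) +
      cos (c * t) * m (w * i) - sin (c * t) * m w)).
Proof.
move=> s0 x m.
have dc z : is_derive z (1 : R) ( *%R c) c.
  have := @is_deriveZ _ _ _ id c z (1 : R) 1 _.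
  by rewrite /GRing.scale/= mulr1; apply.
have hcs := has_partials_comp1 (dc s) (has_partials_fst s t).
have hct := has_partials_comp1 (dc t) (has_partials_snd s t).
have hs := @has_partials_comp1 _ expR (fun s _ => c * s) s t _ _ _ (is_derive_expR (c * s)) hcs.
have hc := @has_partials_comp1 _ cos (fun _ t => c * t) s t _ _ _ (is_derive_cos (c * t)) hct.
have hn := @has_partials_comp1 _ sin (fun _ t => c * t) s t _ _ _ (is_derive_sin (c * t)) hct.
have h1 := partials_phi w t s0; have h2 := partials_phi (w * i) t s0.
have := has_partialsM hs (has_partialsD (has_partialsM hc h1) (has_partialsM hn h2)).
rewrite mulii linNl -/x -/(m _) -/(m _).
congr (has_partials _ _ _ _ _); ring.
Qed.

Section shift_radius.
Variables (c : R) (w : H).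
Hypothesis cosc : cos (c * (2 * pi)) = 1.
Hypothesis sinc : sin (c * (2 * pi)) = 0.

Let continuous_f_scale (g : R -> R) t : continuous g -> (forall s, `|g s| < 1) ->
  continuous (fun s => f (g s *: qcis i t)).
Proof.
move=> cg g1 s; apply: (@continuous_comp _ _ _ (fun s => g s *: qcis i t) f).
  by apply: cvgZr_tmp; exact: cg.
by apply: (SH_continuous fSH); exact: ball_scale_qcis.
Qed.

Lemma continuous_radial rho w' : `|rho| < 1 -> continuous (radial w' rho).
Proof.
move=> r1 t; rewrite /radial.
apply: (@continuous_comp _ _ _ (fun t => f (rho *: qcis i t)) (lin w')); last exact: continuous_lin.
apply: (@continuous_comp _ _ _ (fun t => rho *: qcis i t) f); last first.
  by apply: (SH_continuous fSH); exact: ball_scale_qcis.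
by apply: cvgZl_tmp; exact: continuous_qcis.
Qed.

(** The form with coefficients [Q c (- (w * i))] in [ds] and [Q c w] in [dt] is closed, and by
    [cosc] and [sinc] its integrals along [t = 0] and [t = 2 pi] cancel. Goursat's theorem then
    equates the two remaining sides. *)
Lemma dint_Q_const s1 s2 : s1 <= s2 -> s2 < 0 ->
  dint (Q c w s1) 0 (2 * pi) = dint (Q c w s2) 0 (2 * pi).
Proof.
move=> s12 s20; pose s0 := s2 / 2.
have s2s0 : s2 < s0 by rewrite /s0; lra.
have s00 : s0 < 0 by rewrite /s0; lra.
(* [goursat] works with functions continuous on the whole line, while [f] is controlled only for
   [s < 0]. Freezing [s] beyond [s0], strictly between [s2] and [0], changes nothing on a
   neighbourhood of the rectangle. *)
pose Q' w s := Q c w (Num.min s s0).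
have es s : `|expR (Num.min s s0)| < 1.
  by rewrite ger0_norm ?expR_ge0// expR_lt1 gt_min s00 orbT.
have cmin : continuous (fun s => Num.min s s0).
  by move=> s; exact: (@continuous_min _ _ (fun s : R => s : R^o) (fun=> s0 : R^o) s cvg_id (cvg_cst _)).
have cphi w' t : continuous (fun s => phi w' (Num.min s s0) t).
  move=> s; rewrite /phi /radial.
  apply: (@continuous_comp _ _ _ (fun s => f (expR (Num.min s s0) *: qcis i t)) (lin w')).
    apply: continuous_f_scale => // s'.
    by apply: continuous_comp; [exact: cmin|exact: continuous_expR].
  exact: continuous_lin.
have cP w' t : continuous (fun s => Q' w' s t).
  move=> s; apply: cvgM.
    apply: (@continuous_comp _ _ _ (fun s => c * Num.min s s0) expR); last exact: continuous_expR.
    by apply: cvgM; [exact: cvg_cst|exact: cmin].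
  by apply: cvgD; (apply: cvgM; [exact: cvg_cst|exact: cphi]).
have cQ w' s : continuous (Q' w' s).
  move=> t; apply: cvgM; first exact: cvg_cst.
  apply: cvgD; apply: cvgM.
  - exact: continuous_cosM.
  - exact: continuous_radial.
  - exact: continuous_sinM.
  - exact: continuous_radial.
have h : rect_int (Q' (- (w * i))) (Q' w) s1 s2 0 (2 * pi) = 0.
  apply: goursat => //; first exact: ltW (twopi_gt0).
  move=> s t /andP[_ ss2] _.
  have ss0 : s < s0 by exact: le_lt_trans s2s0.
  have s0' : s < 0 by exact: lt_trans s00.
  have QE w' s' t' : s' < s0 -> Q c w' s' t' = Q' w' s' t'.
    by move=> h; rewrite /Q' min_l// ltW.
  have h1 := partials_Q c (- (w * i)) t s0'.
  have h2 := partials_Q c w t s0'.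
  rewrite !mulNr mulii opprK in h1.
  have phiN s' t' : phi (- (w * i)) s' t' = - phi (w * i) s' t' by exact: linNl.
  move: h1 => /=; set B1 := (X in has_partials _ _ _ _ X -> _) => h1.
  move: h2 => /=; set A2 := (X in has_partials _ _ _ X _ -> _) => h2.
  have AB : A2 = B1 by rewrite /A2 /B1 phiN linNl !mulrN !opprK.
  rewrite AB in h2; apply: closed_form_partials.
    by apply: (has_partials_near ss0 _ h1) => s' t' /QE.
  by apply: (has_partials_near ss0 _ h2) => s' t' /QE.
have QP s : Q' (- (w * i)) s 0 = Q' (- (w * i)) s (2 * pi).
  have q2 : qcis i (2 * pi) = qcis i 0 by rewrite -[2 * pi]add0r qcisD2pi.
  by rewrite /Q' /Q cosc sinc !mulr0 cos0 sin0 /phi /radial q2.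
have QE s : s <= s2 -> dint (Q' w s) 0 (2 * pi) = dint (Q c w s) 0 (2 * pi).
  by move=> ss2; rewrite /Q' min_l// ltW// (le_lt_trans ss2).
move: h; rewrite /rect_int.
rewrite (_ : dint (fun s => Q' (- (w * i)) s 0) s1 s2 = dint (fun s => Q' (- (w * i)) s (2 * pi)) s1 s2).
  rewrite subrr add0r (QE s1 s12) (QE s2 (lexx s2)) => /subr0_eq/esym.
  exact.
by apply: eq_dint => s _; exact: QP.
Qed.

End shift_radius.

Definition fourier_int c w rho : R :=
  dint (fun t => cos (c * t) * radial w rho t + sin (c * t) * radial (w * i) rho t) 0 (2 * pi).

Lemma locint_fourier c w rho : `|rho| < 1 ->
  locint (fun t => cos (c * t) * radial w rho t + sin (c * t) * radial (w * i) rho t).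
Proof.
move=> r1; apply: locintD; apply: locintM.
- exact: continuous_cosM.
- exact: continuous_radial.
- exact: continuous_sinM.
- exact: continuous_radial.
Qed.

Lemma fourier_int_const c w r1 r2 : cos (c * (2 * pi)) = 1 -> sin (c * (2 * pi)) = 0 ->
  0 < r1 -> r1 <= r2 -> r2 < 1 ->
  expR (c * ln r1) * fourier_int c w r1 = expR (c * ln r2) * fourier_int c w r2.
Proof.
move=> cosc sinc r10 r12 r21.
have r20 : 0 < r2 by exact: lt_le_trans r12.
have l12 : ln r1 <= ln r2 by rewrite ler_ln ?posrE.
have l2 : ln r2 < 0 by rewrite ln_lt0// r20.
have := @dint_Q_const c w cosc sinc (ln r1) (ln r2) l12 l2.
rewrite /fourier_int -!dintZ; last 2 first.
- by apply: locint_fourier; rewrite gtr0_norm.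
- by apply: locint_fourier; rewrite gtr0_norm// (le_lt_trans r12).
by rewrite /Q /phi !lnK ?posrE.
Qed.

Lemma cos_nat (n : nat) : cos (n%:R * (2 * pi)) = 1 :> R.
Proof.
rewrite (_ : _ * _ = 0 + pi *+ 2 *+ n); first by rewrite (periodicn (@cosD2pi R)) cos0.
by rewrite add0r mulr_natl -[pi *+ 2]mulr_natl.
Qed.

Lemma sin_nat (n : nat) : sin (n%:R * (2 * pi)) = 0 :> R.
Proof.
rewrite (_ : _ * _ = 0 + pi *+ 2 *+ n); first by rewrite (periodicn (@sinD2pi R)) sin0.
by rewrite add0r mulr_natl -[pi *+ 2]mulr_natl.
Qed.

Lemma expR_ln_nat (n : nat) (r : R) : 0 < r -> expR (n%:R * ln r) = r ^+ n.
Proof. by move=> r0; rewrite expRM_natl lnK ?posrE. Qed.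

(** [rho^(n+1)] times the integral does not depend on [rho], and it tends to [0] with [rho] because
    [f] is bounded near the origin. This says that the expansion has no negative powers. *)
Lemma fourier_int_pos (n : nat) w rho : 0 < rho < 1 -> fourier_int n.+1%:R w rho = 0.
Proof.
move=> /andP[r0 r1].
have cf : {for 0, continuous f}.
  by apply: (SH_continuous fSH); rewrite /unit_ball/= normr0.
have [d [d0 d1] hd] : exists2 d : R, 0 < d /\ d < 1 & forall x : H, `|x| < d -> `|f x| <= `|f 0| + 1.
  have /cvgrPdist_le/(_ 1 ltr01)/nbhs_ballP[d/= d0 hd] := cf.
  exists (Num.min d (1 / 2)).
    by split; [rewrite lt_min d0 divr_gt0|rewrite gt_min; apply/orP; right; lra].
  move=> x; rewrite lt_min => /andP[xd _].
  have := hd x; rewrite -ball_normE /ball_/= sub0r normrN => /(_ xd) h.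
  rewrite -[f x](subrK (f 0)) addrC (le_trans (ler_normD _ _))// lerD2l.
  by rewrite distrC.
pose C := 2 * ((`|w| + `|w * i|) * (`|f 0| + 1)) * (2 * pi).
have hC r : 0 < r < d -> `|fourier_int n.+1%:R w r| <= C.
  move=> /andP[r0' rd].
  have rn : `|r| < 1 by rewrite gtr0_norm// (lt_trans rd).
  rewrite /C -[X in _ <= _ * X]subr0; apply: dint_bound.
  - exact: locint_fourier.
  - exact: ltW twopi_gt0.
  move=> t _.
  have rad w' : `|radial w' r t| <= `|w'| * (`|f 0| + 1).
    rewrite (le_trans (lin_norm _ _))// ler_wpM2l// hd// norm_scale_qcis.
    by rewrite gtr0_norm.
  have b1 (x y : R) : `|x| <= 1 -> `|x * y| <= `|y|.
    by move=> x1; rewrite normrM ler_piMl.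
  rewrite (le_trans (ler_normD _ _))//.
  have h1 := le_trans (b1 _ (radial w r t) (cos_max (n.+1%:R * t))) (rad w).
  have h2 := le_trans (b1 _ (radial (w * i) r t) (sin_max (n.+1%:R * t))) (rad (w * i)).
  have h3 : 0 <= (`|w| + `|w * i|) * (`|f 0| + 1) by rewrite mulr_ge0// addr_ge0.
  lra.
pose ka := rho ^+ n.+1 * fourier_int n.+1%:R w rho.
suff : ka = 0.
  move/eqP; rewrite mulf_eq0 => /orP[|/eqP//].
  by rewrite expf_eq0/= gt_eqF.
have d01 : 0 <= Num.min rho d / 2 < 1.
  rewrite divr_ge0 ?le_min ?ltW//=.
  by rewrite ltr_pdivrMr// mul1r gt_min (lt_trans r1)// ltr1n.
apply: (@eq0_geometric _ _ C _ d01) => m.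
(* Radii that tend to [0] geometrically; the exponent [m.+1] keeps them below both [rho] and [d]
   already for [m = 0]. *)
pose r := (Num.min rho d / 2) ^+ m.+1.
have m0 : 0 < Num.min rho d / 2 by rewrite divr_gt0// lt_min r0.
have rr : 0 < r by rewrite exprn_gt0.
have rm : r <= Num.min rho d / 2.
  by rewrite -[leRHS]expr1 ler_wiXn2l// ?ltW//; case/andP: d01.
have rm' : r < Num.min rho d.
  by apply: (le_lt_trans rm); rewrite ltr_pdivrMr// ltr_pMr ?ltr1n// lt_min r0.
have /andP[rrho rd] : (r < rho) && (r < d) by rewrite -lt_min.
have := @fourier_int_const n.+1%:R w r rho (cos_nat _) (sin_nat _) rr (ltW rrho) r1.
rewrite !expR_ln_nat// -/ka => <-.
rewrite normrM mulrC ler_pM//; first by apply: hC; rewrite rr.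
rewrite ger0_norm; last by rewrite exprn_ge0// ltW.
have r1' : r <= 1 by rewrite ltW// (lt_trans rrho).
apply: (@le_trans _ _ r).
  by rewrite -[leRHS]expr1 ler_wiXn2l// ltW.
rewrite /r exprS; apply: ler_piMl; first by rewrite exprn_ge0// ltW.
by case/andP: d01 => _ /ltW.
Qed.

(** By [fourier_int_const] any other radius would give the same number, which is [Re(w a_n)] for the
    [n]-th power series coefficient [a_n] of [f]; compare [lin_qcoef]. *)
Definition slice_coef w (n : nat) : R :=
  (2 * pi)^-1 * (fourier_int (- n%:R) w (1 / 2) * 2 ^+ n).

Lemma fourier_int_neg (n : nat) w rho : 0 < rho < 1 ->
  (2 * pi)^-1 * fourier_int (- n%:R) w rho = rho ^+ n * slice_coef w n.
Proof.
move=> /andP[r0 r1].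
have cN : cos (- n%:R * (2 * pi)) = 1 :> R by rewrite mulNr cosN cos_nat.
have sN : sin (- n%:R * (2 * pi)) = 0 :> R by rewrite mulNr sinN sin_nat oppr0.
have eN (r : R) : 0 < r -> expR (- n%:R * ln r) = r ^- n.
  by move=> r0'; rewrite mulNr expRN expR_ln_nat.
have h12 : 0 < 1 / 2 :> R by rewrite divr_gt0.
have h : rho ^- n * fourier_int (- n%:R) w rho = (1 / 2) ^- n * fourier_int (- n%:R) w (1 / 2).
  rewrite -!eN//; have [le|/ltW le] := leP rho (1 / 2).
    by apply: fourier_int_const => //; lra.
  by apply/esym; apply: fourier_int_const => //; lra.
rewrite /slice_coef mulrCA; congr (_ * _).
have -> : fourier_int (- n%:R) w (1 / 2) * 2 ^+ n = rho ^- n * fourier_int (- n%:R) w rho.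
  by rewrite h mulrC div1r exprVn invrK.
by rewrite mulrA mulfV ?mul1r// expf_neq0// gt_eqF.
Qed.

(** The vanishing of the positive frequencies, used for [w'] and for [- (w' * i)], ties the sine
    integral of one function to the cosine integral of its conjugate. Negative frequencies are then
    twice a cosine integral, which is the weight in [fcoef]. The sine coefficient at [0] vanishes,
    whereas [slice_coef (w * i) 0] may not, hence the case distinction. *)
Lemma slice_harmonic w :
  harmonic (radial w) (slice_coef w) (fun n => if n is 0%N then 0 else slice_coef (w * i) n).
Proof.
move=> rho r01; have /andP[r0 r1] := r01.
have rn : `|rho| < 1 by rewrite gtr0_norm.
split; first exact: continuous_radial.
  by move=> t; rewrite /radial qcisD2pi.
have Ic c w' : locint (fun t => cos (c * t) * radial w' rho t).
  by apply: locintM; [exact: continuous_cosM|exact: continuous_radial].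
have Is c w' : locint (fun t => sin (c * t) * radial w' rho t).
  by apply: locintM; [exact: continuous_sinM|exact: continuous_radial].
have pos (n : nat) w' : dint (fun t => cos (n.+1%:R * t) * radial w' rho t) 0 (2 * pi) +
    dint (fun t => sin (n.+1%:R * t) * radial (w' * i) rho t) 0 (2 * pi) = 0.
  by rewrite -dintD//; exact: fourier_int_pos.
have neg (n : nat) w' : (2 * pi)^-1 * (dint (fun t => cos (n%:R * t) * radial w' rho t) 0 (2 * pi) -
    dint (fun t => sin (n%:R * t) * radial (w' * i) rho t) 0 (2 * pi)) = rho ^+ n * slice_coef w' n.
  rewrite -fourier_int_neg// /fourier_int -dintB//; congr (_ * _).
  by apply: eq_dint => t _; rewrite mulNr cosN sinN mulNr.
have Spos (n : nat) w' : dint (fun t => sin (n.+1%:R * t) * radial w' rho t) 0 (2 * pi) =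
    dint (fun t => cos (n.+1%:R * t) * radial (w' * i) rho t) 0 (2 * pi).
  have := pos n (- (w' * i)); rewrite mulNr mulii opprK.
  have -> : dint (fun t => cos (n.+1%:R * t) * radial (- (w' * i)) rho t) 0 (2 * pi) =
      - dint (fun t => cos (n.+1%:R * t) * radial (w' * i) rho t) 0 (2 * pi).
    rewrite -[RHS]mulN1r -dintZ//; apply: eq_dint => t _.
    by rewrite /radial linNl; ring.
  by move=> h; apply/eqP; rewrite -subr_eq0 addrC h.
case=> [|n].
  split.
    rewrite /acoef /= mulr1 -neg; congr (_ * _).
    rewrite [X in _ - X](_ : _ = 0) ?subr0//.
    transitivity (dint (fun=> 0 : R) 0 (2 * pi)).
      by apply: eq_dint => t _; rewrite mul0r sin0 mul0r.
    by rewrite dint_cst ?mul0r// (ltW twopi_gt0).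
  rewrite /bcoef mulr0; apply/eqP; rewrite mulf_eq0; apply/orP; right; apply/eqP.
  transitivity (dint (fun=> 0 : R) 0 (2 * pi)).
    by apply: eq_dint => t _; rewrite mul0r sin0 mul0r.
  by rewrite dint_cst ?mul0r// (ltW twopi_gt0).
have Cn w' : acoef (radial w' rho) n.+1 = rho ^+ n.+1 * slice_coef w' n.+1.
  rewrite -neg /acoef -mulrA; congr (_ * _) => /=.
  have /eqP := pos n w'; rewrite addr_eq0 => /eqP <-.
  by rewrite [LHS]mulr_natl mulr2n.
split; first exact: Cn.
by rewrite -Cn /acoef /bcoef Spos.
Qed.

End slice_fourier.

Lemma continuous_bigsum (R : realType) (I : Type) (r : seq I) (F : I -> R -> R) :
  (forall k, continuous (F k)) -> continuous (fun t => \sum_(k <- r) F k t).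
Proof.
move=> cF; elim: r => [|k r ih].
  by under eq_fun do rewrite big_nil; move=> x; exact: cvg_cst.
by under eq_fun do rewrite big_cons; move=> x; apply: cvgD; [exact: cF|exact: ih].
Qed.

(** * Poisson representation and L^2 monotonicity *)

Section harmonic_theory.
Context {R : realType}.
Variables (U : R -> R -> R) (a b : nat -> R).
Hypothesis hU : harmonic U a b.

Lemma harmonic_continuous rho : 0 < rho < 1 -> continuous (U rho).
Proof. by move=> /hU[]. Qed.

Lemma harmonic_periodic rho t : 0 < rho < 1 -> U rho (t + 2 * pi) = U rho t.
Proof. by move=> /hU[_ h _]. Qed.

Lemma geometric_small (C r e : R) : 0 <= r < 1 -> 0 < e -> exists N : nat, `|C * r ^+ N| <= e.
Proof.
move=> /andP[r0 r1] e0.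
have : C * r ^+ n @[n --> \oo] --> C * 0.
  by apply: cvgM; [exact: cvg_cst|apply: cvg_expr; rewrite ger0_norm].
rewrite mulr0 => /cvgrPdist_le/(_ e e0)[n _ /(_ n (leqnn n))].
by rewrite sub0r normrN => hn; exists n.
Qed.

Lemma trig_scale rho r N t : 0 < rho < 1 ->
  trig (acoef (U rho)) (bcoef (U rho)) N r t = trig a b N (r * rho) t.
Proof.
move=> r01; apply: eq_bigr => k _; have [_ _ /(_ k)[-> ->]] := hU r01.
by rewrite exprMn; ring.
Qed.

Lemma harmonic_trig rho r N t M : 0 < rho < 1 -> 0 <= r < 1 ->
  (forall s, 0 <= s <= 2 * pi -> `|U rho s| <= M) ->
  `|pconv r (U rho) t - trig a b N (r * rho) t| <= 4 * r / (1 - r) ^+ 2 * M * r ^+ N.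
Proof.
move=> rho01 r01 hM; rewrite -trig_scale//.
have := pconv_expansion N t r01 (harmonic_continuous rho01) hM.
by rewrite exprS => /le_trans; apply; rewrite le_eqVlt; apply/orP; left; apply/eqP; ring.
Qed.

Lemma harmonic_bounded rho : 0 < rho < 1 ->
  exists2 M : R, 0 < M & forall s, 0 <= s <= 2 * pi -> `|U rho s| <= M.
Proof. by move=> r01; apply: continuous_bounded_itv; exact: harmonic_continuous. Qed.

(** Both sides are approximated, with geometric errors, by the same sums [trig a b N (r * rho)]. *)
Lemma pconv_eq_radius rho r rho' r' t : 0 < rho < 1 -> 0 <= r < 1 ->
  0 < rho' < 1 -> 0 <= r' < 1 -> r * rho = r' * rho' ->
  pconv r (U rho) t = pconv r' (U rho') t.
Proof.
move=> rho01 r01 rho01' r01' E.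
have [M M0 hM] := harmonic_bounded rho01; have [M' M0' hM'] := harmonic_bounded rho01'.
apply/subr0_eq.
have m01 : 0 <= Num.max r r' < 1.
  by move: r01 r01' => /andP[r0 r1] /andP[r0' r1']; rewrite le_max r0 gt_max r1.
apply: (eq0_geometric m01) => N.
instantiate (1 := 4 * r / (1 - r) ^+ 2 * M + 4 * r' / (1 - r') ^+ 2 * M').
have h1 := harmonic_trig N t rho01 r01 hM; have h2 := harmonic_trig N t rho01' r01' hM'.
rewrite -E in h2.
rewrite -(subrKA (trig a b N (r * rho) t)) (le_trans (ler_normD _ _))//.
rewrite [X in _ + X]distrC mulrDl lerD//.
  apply: (le_trans h1); rewrite ler_wpM2l//; last first.
    move: r01 => /andP[r0 r1]; rewrite lerXn2r// ?nnegrE ?le_max ?r0 ?lexx//.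
  case/andP: r01 => r0 r1.
  by rewrite mulr_ge0 ?(ltW M0)// divr_ge0 ?sqr_ge0// mulr_ge0.
apply: (le_trans h2); rewrite ler_wpM2l//; last first.
  move: r01' => /andP[r0 r1]; rewrite lerXn2r// ?nnegrE ?le_max ?r0 ?lexx ?orbT//.
case/andP: r01' => r0 r1.
by rewrite mulr_ge0 ?(ltW M0')// divr_ge0 ?sqr_ge0// mulr_ge0.
Qed.

Lemma continuous_trig N t : continuous (fun y => trig a b N y t).
Proof.
apply: continuous_bigsum => k y.
by apply: cvgM; [exact: exprn_continuous|exact: cvg_cst].
Qed.

Lemma ratio_bound r r' M : 0 <= r' <= r -> r < 1 -> 0 <= M ->
  4 * r' / (1 - r') ^+ 2 * M <= 4 * r / (1 - r) ^+ 2 * M :> R.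
Proof.
move=> /andP[r0' rr'] r1 M0; rewrite ler_wpM2r//.
apply: ler_pM; rewrite ?mulr_ge0 ?invr_ge0 ?sqr_ge0 ?ler_wpM2l//.
rewrite lef_pV2 ?posrE ?exprn_gt0 ?subr_gt0//; last exact: le_lt_trans r1.
by rewrite lerXn2r// ?nnegrE ?subr_ge0 ?lerB// ltW// (le_lt_trans rr').
Qed.

(** [harmonic] says nothing about the dependence of [U] on the radius. With [x = r * rho], the value
    [U x t] is the limit of [pconv r' (U x) t] as [r'] tends to [1]; by [pconv_eq_radius] these are
    Poisson integrals of [U rho], and the sums [trig], polynomial in the radius, link them to
    [pconv r (U rho) t]. *)
Theorem harmonic_semigroup rho r t : 0 < rho < 1 -> 0 < r < 1 ->
  pconv r (U rho) t = U (r * rho) t.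
Proof.
move=> rho01 r01; have /andP[r0 r1] := r01; have /andP[rho0 rho1] := rho01.
have r01' : 0 <= r < 1 by rewrite ltW.
pose x := r * rho.
have x0 : 0 < x by rewrite mulr_gt0.
have x1 : x < 1 by rewrite mulr_ilt1// ltW.
have x01 : 0 < x < 1 by rewrite x0.
have [M M0 hM] := harmonic_bounded rho01.
apply/eqP; rewrite -subr_eq0 -normr_le0; apply/ler_addgt0Pr => e e0; rewrite add0r.
have e4 : 0 < e / 4 by rewrite divr_gt0.
have [q q01 hq] := pconv_cvg t (harmonic_continuous x01) (fun s => harmonic_periodic s x01) e4.
pose C := 4 * r / (1 - r) ^+ 2 * M.
have C0 : 0 <= C.
  by rewrite mulr_ge0 ?(ltW M0)// divr_ge0 ?sqr_ge0// mulr_ge0// ltW.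
have [N hN] := geometric_small C r01' e4.
have {}hN := le_trans (ler_norm _) hN.
have [d d0 hd] : exists2 d, 0 < d & forall y, `|y - x| < d ->
    `|trig a b N y t - trig a b N x t| <= e / 4.
  have /cvgrPdist_le/(_ _ e4)/nbhs_ballP[d/= d0 hd] := @continuous_trig N t x.
  exists d => // y xy; have := hd y; rewrite /ball/= distrC => /(_ xy).
  by rewrite distrC.
have /andP[q0 q1] := q01.
(* Close enough to [1] both for [pconv_cvg], which needs [q < r'], and for the continuity of [trig]
   at [x], which needs [1 - d < r']. *)
pose r' := (Num.max q (1 - d) + 1) / 2.
have qm : Num.max q (1 - d) < 1 by rewrite gt_max q1/= gtrBl.
have r'q : Num.max q (1 - d) < r' by rewrite /r'; lra.
have r'1 : r' < 1 by rewrite /r'; lra.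
have /andP[qr' dr'] : (q < r') && (1 - d < r') by rewrite -gt_max.
have r'0 : 0 < r' by exact: le_lt_trans qr'.
have E : pconv r' (U x) t = pconv (r' * r) (U rho) t.
  apply: pconv_eq_radius => //.
  - by rewrite ltW.
  - by rewrite mulr_ge0 ?ltW//= mulr_ilt1// ltW.
  - by rewrite mulrA.
have h1 : `|pconv r (U rho) t - trig a b N x t| <= e / 4.
  exact: le_trans (harmonic_trig N t rho01 r01' hM) hN.
have r'r1 : r' * r <= r by rewrite ler_piMl// ltW.
have h2 : `|pconv (r' * r) (U rho) t - trig a b N (r' * x) t| <= e / 4.
  have r'r : 0 <= r' * r < 1.
    by rewrite mulr_ge0 ?ltW//= mulr_ilt1// ltW.
  have -> : r' * x = r' * r * rho by rewrite mulrA.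
  apply: (le_trans (harmonic_trig N t rho01 r'r hM)).
  apply: le_trans hN; apply: ler_pM.
  - rewrite mulr_ge0 ?(ltW M0)// divr_ge0 ?sqr_ge0// mulr_ge0//.
    by case/andP: r'r.
  - by rewrite exprn_ge0//; case/andP: r'r.
  - by apply: ratio_bound; rewrite ?r'r1 ?(ltW M0)//; case/andP: r'r => ->.
  - by rewrite lerXn2r// ?nnegrE ?(ltW r0)//; case/andP: r'r.
have h3 : `|trig a b N (r' * x) t - trig a b N x t| <= e / 4.
  apply: hd; rewrite -{2}[x]mul1r -mulrBl normrM (gtr0_norm x0).
  rewrite ler0_norm ?subr_le0 ?(ltW r'1)// opprB.
  by rewrite (@le_lt_trans _ _ (1 - r'))// ?ler_piMr ?subr_ge0 ?(ltW r'1) ?(ltW x1)//; lra.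
have h4 : `|pconv r' (U x) t - U x t| <= e / 4 by apply: hq; rewrite qr'.
rewrite E in h4.
have -> : pconv r (U rho) t - U (r * rho) t =
  (pconv r (U rho) t - trig a b N x t) - (trig a b N (r' * x) t - trig a b N x t)
  - (pconv (r' * r) (U rho) t - trig a b N (r' * x) t) + (pconv (r' * r) (U rho) t - U x t).
  by rewrite /x; ring.
move: h1 h2 h3 h4.
set A := _ - trig a b N x t; set B := _ - trig a b N (r' * x) t.
set D := trig _ _ _ _ _ - _; set E' := _ - U x t => h1 h2 h3 h4.
rewrite (le_trans (ler_normD _ _))// (le_trans (lerD (ler_normB _ _) h4))//.
rewrite (le_trans (lerD (lerD (ler_normB _ _) h2) (lexx _)))//.
by move: h1 h3; set nA := `|A|; set nD := `|D|; lra.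
Qed.

(** Reproducing [U y] from the fixed circle halfway between [rho1] and [1] keeps the ratio of radii
    below [th], so the error is uniform in [y] and [t]. *)
Lemma harmonic_trig_unif rho1 : 0 < rho1 < 1 -> exists C th : R, [/\ 0 <= C, 0 <= th < 1 &
  forall y t N, 0 < y <= rho1 -> `|U y t - trig a b N y t| <= C * th ^+ N].
Proof.
move=> /andP[r0 r1]; pose rho := (rho1 + 1) / 2.
have rho01 : 0 < rho < 1 by rewrite /rho; apply/andP; split; lra.
have /andP[rho0 _] := rho01.
have [M M0 hM] := harmonic_bounded rho01.
pose th := rho1 / rho.
have th01 : 0 <= th < 1.
  rewrite divr_ge0 ?ltW//= ltr_pdivrMr// mul1r /rho; lra.
have /andP[th0 th1] := th01.
exists (4 * th / (1 - th) ^+ 2 * M), th; split => //.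
  by rewrite mulr_ge0 ?(ltW M0)// divr_ge0 ?sqr_ge0// mulr_ge0.
move=> y t N /andP[y0 y1].
pose r := y / rho.
have rE : r * rho = y by rewrite divfK// gt_eqF.
have r0' : 0 < r by rewrite divr_gt0.
have rth : r <= th by rewrite ler_pM2r ?invr_gt0.
have r01 : 0 < r < 1 by rewrite r0' (le_lt_trans rth).
have := harmonic_trig N t rho01 _ hM => /(_ r); rewrite harmonic_semigroup// rE.
rewrite (ltW r0')/= (le_lt_trans rth)// => /(_ isT) /le_trans; apply.
apply: ler_pM.
- by rewrite mulr_ge0 ?(ltW M0)// divr_ge0 ?sqr_ge0// mulr_ge0// ltW.
- by rewrite exprn_ge0// ltW.
- by apply: ratio_bound; rewrite ?(ltW r0') ?(ltW M0).
- by rewrite lerXn2r// ?nnegrE// ltW.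
Qed.

Lemma harmonic_continuous_radius t x : 0 < x < 1 -> {for x, continuous (fun y => U y t)}.
Proof.
move=> /andP[x0 x1].
have r01 : 0 < (x + 1) / 2 < 1 by apply/andP; split; lra.
have [C [th [C0 th01 h]]] := harmonic_trig_unif r01.
apply/cvgrPdist_le => /= e e0.
have e3 : 0 < e / 3 by rewrite divr_gt0.
have [N hN] := geometric_small C th01 e3.
have {}hN := le_trans (ler_norm _) hN.
have h2 : `|U x t - trig a b N x t| <= e / 3.
  by apply: le_trans hN; apply: h; rewrite x0/=; lra.
near=> y.
have hy : 0 < y <= (x + 1) / 2.
  apply/andP; split; first by near: y; exact: lt_nbhsr.
  by apply: ltW; near: y; apply: lt_nbhsl; lra.
have h1 := le_trans (h y t N hy) hN.
have h3 : `|trig a b N x t - trig a b N y t| <= e / 3.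
  by near: y; move/cvgrPdist_le: (@continuous_trig N t x); apply.
have -> : U x t - U y t = (U x t - trig a b N x t) + (trig a b N x t - trig a b N y t)
   - (U y t - trig a b N y t) by ring.
rewrite (le_trans (ler_normB _ _))// (le_trans (lerD (ler_normD _ _) h1))//.
by move: (h2) (h3); set A := `|_|; set B := `|_|; lra.
Unshelve. all: by end_near. Qed.

(** Parseval sum for the inner product of [U rho] and [U r], at [x = r * rho]: the radii enter only
    through their product, and for [x >= 0] every term is nonnegative. *)
Let energy (N : nat) (x : R) : R :=
  \sum_(k < N.+1) x ^+ k * (2 * pi / fcoef k) * (a k ^+ 2 + b k ^+ 2).

Let fcoef_gt0 k : 0 < fcoef k :> R. Proof. by case: k. Qed.

Let energy_mono N n x y : 0 <= x <= y -> energy N x <= energy (N + n) y.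
Proof.
move=> /andP[x0 xy]; have y0 := le_trans x0 xy.
rewrite /energy -addSn big_split_ord /= -[leLHS]addr0 lerD//.
  apply: ler_sum => k _; rewrite ler_wpM2r ?addr_ge0 ?sqr_ge0// ler_wpM2r//.
    by rewrite divr_ge0 ?(ltW twopi_gt0) ?(ltW (fcoef_gt0 _)).
  by rewrite lerXn2r// nnegrE.
apply: sumr_ge0 => k _; apply: mulr_ge0; last by rewrite addr_ge0 ?sqr_ge0.
by apply: mulr_ge0; [rewrite exprn_ge0|rewrite divr_ge0 ?(ltW twopi_gt0) ?(ltW (fcoef_gt0 _))].
Qed.

Let inner_trig r rho N : 0 < rho < 1 ->
  dint (fun t => U rho t * trig a b N r t) 0 (2 * pi) = energy N (r * rho).
Proof.
move=> rho01; have cU := harmonic_continuous rho01.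
have Ic k := locintM (continuous_cosM (c := k)) cU.
have Is k := locintM (continuous_sinM (c := k)) cU.
transitivity (dint (fun t => \sum_(k < N.+1) (r ^+ k * a k * (cos (k%:R * t) * U rho t) +
   r ^+ k * b k * (sin (k%:R * t) * U rho t))) 0 (2 * pi)).
  apply: eq_dint => t _; rewrite /trig mulr_sumr; apply: eq_bigr => k _; ring.
rewrite dint_sum; last by move=> k; apply: locintD; exact: locintZ.
apply: eq_bigr => k _; rewrite dintD ?dintZ//; [|exact: locintZ..].
have [_ _ /(_ k)[ha hb]] := hU rho01.
have f0 : fcoef k != 0 :> R by rewrite gt_eqF.
have p0 : 2 * pi != 0 :> R by rewrite gt_eqF// twopi_gt0.
have cE : dint (fun s => cos (k%:R * s) * U rho s) 0 (2 * pi) =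
    2 * pi / fcoef k * (rho ^+ k * a k).
  rewrite -ha /acoef; move: p0; set p := 2 * pi; set D := dint _ _ _ => p0.
  rewrite (_ : _ * _ = p / p * (fcoef k / fcoef k) * D); last by ring.
  by rewrite !divff// !mul1r.
have sE : dint (fun s => sin (k%:R * s) * U rho s) 0 (2 * pi) =
    2 * pi / fcoef k * (rho ^+ k * b k).
  rewrite -hb /bcoef; move: p0; set p := 2 * pi; set D := dint _ _ _ => p0.
  rewrite (_ : _ * _ = p / p * (fcoef k / fcoef k) * D); last by ring.
  by rewrite !divff// !mul1r.
by rewrite cE sE exprMn; ring.
Qed.

Let inner_energy r rho e : 0 < rho < 1 -> 0 < r < 1 -> 0 < e ->
  exists N0 : nat, forall N, (N0 <= N)%N ->
  `|dint (fun t => U rho t * U r t) 0 (2 * pi) - energy N (r * rho)| <= e.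
Proof.
move=> rho01 r01 e0.
have [C [th [C0 th01 h]]] := harmonic_trig_unif r01.
have [M M0 hM] := harmonic_bounded rho01.
have [N0 hN0] := geometric_small (C * M * (2 * pi)) th01 e0.
exists N0 => N NN0; have hN : C * M * (2 * pi) * th ^+ N <= e.
  apply: le_trans hN0; apply: le_trans (ler_norm _); rewrite ler_wpM2l//.
    by rewrite mulr_ge0 ?(ltW twopi_gt0)// mulr_ge0// ltW.
  by case/andP: th01 => t0 t1; rewrite ler_wiXn2l// ltW.
have ct : continuous (trig a b N r).
  apply: continuous_bigsum => k t; apply: cvgM; first exact: cvg_cst.
  apply: cvgD; apply: cvgM; try exact: cvg_cst.
    exact: continuous_cosM.
  exact: continuous_sinM.
have cr := harmonic_continuous r01; have crho := harmonic_continuous rho01.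
have I1 := locintM crho cr; have I2 := locintM crho ct.
rewrite -inner_trig// -dintB//; apply: le_trans hN.
have -> : C * M * (2 * pi) * th ^+ N = M * (C * th ^+ N) * (2 * pi - 0) by rewrite subr0; ring.
apply: dint_bound; [exact: locintB|exact: ltW twopi_gt0|].
move=> t ht; rewrite -mulrBr normrM; apply: ler_pM => //; first exact: hM.
by apply: h; case/andP: r01 => -> _ /=.
Qed.

Lemma harmonic_inner_le r rho r' rho' : 0 < rho < 1 -> 0 < r < 1 ->
  0 < rho' < 1 -> 0 < r' < 1 -> r * rho <= r' * rho' ->
  dint (fun t => U rho t * U r t) 0 (2 * pi) <= dint (fun t => U rho' t * U r' t) 0 (2 * pi).
Proof.
move=> h1 h2 h3 h4 le; apply/ler_addgt0Pr => e e0.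
have e2 : 0 < e / 2 by rewrite divr_gt0.
have [N1 k1] := inner_energy h1 h2 e2; have [N2 k2] := inner_energy h3 h4 e2.
have {}k1 := k1 N1 (leqnn _).
have {}k2 := k2 (N1 + N2)%N (leq_addl _ _).
have k3 : energy N1 (r * rho) <= energy (N1 + N2) (r' * rho').
  by apply: energy_mono; rewrite le andbT mulr_ge0// ltW//; [case/andP: h2|case/andP: h1].
by move: k1 k2; rewrite !ler_norml => /andP[_ k1] /andP[k2 _]; lra.
Qed.

Definition norm2 rho : R := dint (fun t => U rho t ^+ 2) 0 (2 * pi).

Lemma norm2_inner rho : norm2 rho = dint (fun t => U rho t * U rho t) 0 (2 * pi).
Proof. by apply: eq_dint => t _; rewrite expr2. Qed.

Lemma norm2_mono r s : 0 < r -> r <= s -> s < 1 -> norm2 r <= norm2 s.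
Proof.
move=> r0 rs s1; have s0 := lt_le_trans r0 rs; have r1 := le_lt_trans rs s1.
rewrite !norm2_inner harmonic_inner_le ?r0 ?r1 ?s0 ?s1//.
by rewrite ler_pM// ltW.
Qed.

(** Expand the square: the inner product of [U s] and [U r] is at least [norm2 r], because
    [s * r >= r * r]. Bounded norms thus make the family Cauchy in L^2. *)
Lemma norm2_diff r s : 0 < r -> r <= s -> s < 1 ->
  dint (fun t => (U s t - U r t) ^+ 2) 0 (2 * pi) <= norm2 s - norm2 r.
Proof.
move=> r0 rs s1; have s0 := lt_le_trans r0 rs; have r1 := le_lt_trans rs s1.
have s01 : 0 < s < 1 by rewrite s0.
have r01 : 0 < r < 1 by rewrite r0.
have cr := harmonic_continuous r01; have cs := harmonic_continuous s01.
have Irr := locintM cr cr; have Iss := locintM cs cs; have Isr := locintM cs cr.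
rewrite [leLHS](_ : _ = dint (fun t => (U s t * U s t + U r t * U r t) - 2 * (U s t * U r t)) 0 (2 * pi)); last first.
  by apply: eq_dint => t _; ring.
rewrite dintB ?dintD ?dintZ -?norm2_inner//; [|exact: locintD|exact: locintZ].
have h : norm2 r <= dint (fun t => U s t * U r t) 0 (2 * pi).
  by rewrite norm2_inner harmonic_inner_le// ler_pM2l.
lra.
Qed.

End harmonic_theory.

(** * Radial limits *)

Section poisson_maximal.
Context {R : realType}.
Local Notation mu := (@lebesgue_measure R).
Implicit Types (f g p phi : R -> R).

Lemma dint_opp f b : continuous f -> 0 <= b ->
  dint f (- b) 0 = dint (fun s => f (- s)) 0 b.
Proof.
move=> cf b0; rewrite /dint /Rintegral; congr fine.
have := @integration_by_substitution_oppr R f 0 b b0.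
rewrite oppr0 => -> //; exact: continuous_subspaceT.
Qed.

Lemma continuous_opp_arg f : continuous f -> continuous (fun s => f (- s)).
Proof.
move=> cf s; apply: (@continuous_comp _ _ _ -%R f); last exact: cf.
exact: opp_continuous.
Qed.

Lemma dint_sym f b : continuous f -> 0 <= b ->
  dint f (- b) b = dint (fun s => f s + f (- s)) 0 b.
Proof.
move=> cf b0; have If := continuous_locint cf.
have IfN := continuous_locint (continuous_opp_arg cf).
rewrite (dint_split If (b := 0)) ?oppr_le0// dint_opp// -dintD//.
by apply: eq_dint => s _; rewrite addrC.
Qed.

(* An Abel summation: [p] is a positive combination of indicators of
   initial segments. *)
Lemma dint_abel p p' phi b : 0 < b -> continuous p' ->
  (forall s, is_derive s (1 : R) p (p' s)) -> (forall s, 0 <= s <= b -> p' s <= 0) ->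
  0 <= p b -> continuous phi -> (forall s, 0 <= s <= b -> 0 <= dint phi 0 s) ->
  0 <= dint (fun s => p s * phi s) 0 b.
Proof.
move=> b0 cp' dp p'0 pb cphi phi0; have Iphi := continuous_locint cphi.
pose G x := dint phi (-1) x - dint phi (-1) 0.
have GE x : 0 <= x -> G x = dint phi 0 x.
  by move=> x0; rewrite /G (dint_split Iphi (b := 0)) ?lerN10// addrC addKr.
have dG x : -1 < x -> derivable G x (1 : R) /\ derive1 G x = phi x.
  move=> x1.
  have [] := @continuous_FTC1_closed R phi (-1) x (x + 1) _ (Iphi _ _) x1 (cphi x).
    by rewrite ltrDl.
  move=> d1 d2.
  have d3 : is_derive x (1 : R) (dint phi (-1)) (phi x).
    by split; [exact: d1|rewrite -d2 derive1E].
  have d4 := is_deriveB d3 (is_derive_cst (dint phi (-1) 0) x (1 : R)).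
  by have [d5 d6] := d4; split; [exact: d5|rewrite derive1E d6 subr0].
have cG x : -1 < x -> {for x, continuous G}.
  by move=> /dG[d _]; apply/differentiable_continuous/derivable1_diffP.
have cp : continuous p.
  by move=> x; apply/differentiable_continuous/derivable1_diffP; have [] := dp x.
have := @Rintegration_by_parts R p G p' phi 0 b b0.
move=> /(_ _ _ _ _ _ _)/wrap[].
  exact: continuous_subspaceT.
  split.
  - by move=> x _; have [] := dp x.
  - by apply/cvg_at_right_filter/cp.
  - by apply/cvg_at_left_filter/cp.
  by move=> x _; rewrite derive1E; have [] := dp x.
  exact: continuous_subspaceT.
  split.
  - by move=> x; rewrite in_itv/= => /andP[x0 _]; have [] := dG x (lt_trans (ltrN10 R) x0).
  - by apply/cvg_at_right_filter/cG/ltrN10.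
  - by apply/cvg_at_left_filter/cG/(lt_trans (ltrN10 R)).
  by move=> x; rewrite in_itv/= => /andP[x0 _]; have [] := dG x (lt_trans (ltrN10 R) x0).
rewrite -/(dint (fun s => p s * phi s) 0 b) => ->.
have -> : G 0 = 0 by rewrite /G subrr.
rewrite mulr0 subr0 subr_ge0.
have b0' := ltW b0.
apply: (@le_trans _ _ 0); last by rewrite mulr_ge0// GE// phi0// b0' lexx.
have Ip : mu.-integrable `[0, b] (EFin \o (fun x => p' x * G x)).
  apply: continuous_compact_integrable; first exact: segment_compact.
  apply: continuous_in_subspaceT => x; rewrite inE/= in_itv/= => /andP[x0 _].
  by apply: cvgM; [exact: cp'|apply: cG; exact: lt_le_trans x0].
apply: (@le_trans _ _ (dint (fun=> 0) 0 b)); last by rewrite dint_cst// mul0r.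
apply: le_Rintegral => //; first exact: locint_cst.
move=> x /=; rewrite in_itv/= => /andP[x0 xb].
by rewrite mulr_le0_ge0// ?p'0 ?x0// GE// phi0// x0.
Qed.

Lemma is_derive_poisson r s : 0 <= r < 1 ->
  is_derive s (1 : R) (poisson r) (- ((1 - r ^+ 2) * (2 * r * sin s) / poisson_den r s ^+ 2)).
Proof.
move=> r01; have d0 := poisson_den_gt0 s r01.
have d1 : is_derive s (1 : R) (poisson_den r) (2 * r * sin s).
  have h1 := @is_deriveZ _ _ _ _ (2 * r) s (1 : R) _ (is_derive_cos s).
  have h2 := is_deriveB (is_derive_cst (1 : R) s (1 : R)) h1.
  have h3 := is_deriveD h2 (is_derive_cst (r ^+ 2) s (1 : R)).
  apply: is_derive_eq h3 _; rewrite /GRing.scale/=; ring.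
have d2 := is_deriveV (lt0r_neq0 d0) d1.
have d3 := @is_deriveZ _ _ _ _ (1 - r ^+ 2) s (1 : R) _ d2.
apply: is_derive_eq d3 _; rewrite /GRing.scale/=.
by field; rewrite gt_eqF.
Qed.

(** The kernel is even, positive and decreasing on [[0, pi]]. With [k] the symmetrisation of [|g|]
    about [t], [dint_abel] applied to [2 M - k] carries the bound from averages over centred
    intervals to the Poisson mean. *)
Lemma poisson_maximal r g t M : 0 <= r < 1 -> continuous g -> 0 <= M ->
  (forall s, 0 < s <= pi -> dint (fun x => `|g x|) (t - s) (t + s) <= 2 * s * M) ->
  `|(2 * pi)^-1 * dint (fun s => poisson r s * g (s + t)) (- pi) pi| <= M.
Proof.
move=> r01 cg M0 hM.
have cP := continuous_poisson r01.
pose h s := `|g (s + t)|.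
have ch : continuous h.
  move=> s; apply: (@continuous_comp _ _ _ (fun s => g (s + t)) Num.norm).
    exact: continuousD_arg.
  exact: norm_continuous.
have pi0 : 0 <= pi :> R := pi_ge0 R.
rewrite normrM gtr0_norm ?invr_gt0 ?twopi_gt0// mulrC ler_pdivrMr ?twopi_gt0//.
apply: (le_trans (dint_norm _ _ (locintM cP (continuousD_arg cg)))).
rewrite [leLHS](_ : _ = dint (fun s => poisson r s * h s) (- pi) pi); last first.
  by apply: eq_dint => s _; rewrite normrM gtr0_norm// poisson_gt0.
have cPh : continuous (fun s => poisson r s * h s).
  by move=> s; apply: cvgM; [exact: cP|exact: ch].
rewrite dint_sym//.
pose k s := h s + h (- s).
have ck : continuous k.
  by move=> s; apply: cvgD; [exact: ch|exact: continuous_opp_arg].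
rewrite [leLHS](_ : _ = dint (fun s => poisson r s * k s) 0 pi); last first.
  by apply: eq_dint => s _; rewrite poissonN mulrDr.
have P2 : 2 * pi = 2 * dint (poisson r) 0 pi.
  rewrite -(dint_poisson r01) dint_sym//.
  rewrite -dintZ; last exact: continuous_locint.
  by apply: eq_dint => s _; rewrite poissonN; ring.
have Ik := continuous_locint ck.
have : 0 <= dint (fun s => poisson r s * (2 * M - k s)) 0 pi.
  apply: (@dint_abel (poisson r) (fun s => - ((1 - r ^+ 2) * (2 * r * sin s) / poisson_den r s ^+ 2))).
  - exact: pi_gt0.
  - move=> s; apply: cvgN; apply: cvgM.
      apply: cvgM; first exact: cvg_cst.
      by apply: cvgM; [exact: cvg_cst|exact: continuous_sin].
    apply: cvgV; first by rewrite expf_neq0// gt_eqF// poisson_den_gt0.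
    have cd : continuous (poisson_den r).
      move=> x; apply: cvgD; last exact: cvg_cst.
      apply: cvgB; first exact: cvg_cst.
      by apply: cvgM; [exact: cvg_cst|exact: continuous_cos].
    by apply: (@continuous_comp _ _ _ (poisson_den r) (fun x => x ^+ 2)); [exact: cd|exact: exprn_continuous].
  - by move=> s; exact: is_derive_poisson.
  - move=> s /sin_ge0_pi s0; have /andP[r0 _] := r01.
    rewrite oppr_le0 divr_ge0 ?sqr_ge0// mulr_ge0 ?(ltW (sqr_lt1 r01))//.
    by rewrite mulr_ge0// mulr_ge0.
  - by rewrite ltW// poisson_gt0.
  - by move=> s; apply: cvgB; [exact: cvg_cst|exact: ck].
  - move=> s /andP[s0 s1].
    rewrite dintB ?dint_cst//; last exact: locint_cst.
    have -> : dint k 0 s = dint h (- s) s by rewrite dint_sym.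
    have -> : dint h (- s) s = dint (fun x => `|g x|) (- s + t) (s + t).
      apply: (@dint_shift _ t (fun x => `|g x|)).
      by apply: locint_norm; exact: continuous_locint.
    rewrite subr0.
    move: s0; rewrite le_eqVlt => /predU1P[<-|s0].
      by rewrite oppr0 mulr0 /dint set_itv1 Rintegral_set1 subrr.
    rewrite subr_ge0 addrC [s + t]addrC mulrAC; apply: hM.
    by rewrite s0.
have IP : locint (poisson r) by exact: continuous_locint.
have -> : dint (fun s => poisson r s * (2 * M - k s)) 0 pi =
    dint (fun s => 2 * M * poisson r s - poisson r s * k s) 0 pi.
  by apply: eq_dint => s _; ring.
have IPk : locint (fun s => poisson r s * k s) := locintM cP ck.
have IMP : locint (fun s => 2 * M * poisson r s) := locintZ (2 * M) IP.
rewrite (dintB _ _ IMP IPk) dintZ//.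
by rewrite subr_ge0 P2 mulrAC mulrC mulrA [M * 2]mulrC.
Qed.

Lemma integral_oo_cc (F : R -> \bar R) a b : measurable_fun setT F ->
  (\int[mu]_(x in `]a, b[) F x = \int[mu]_(x in `[a, b]) F x)%E.
Proof.
move=> mF; rewrite integral_itv_obnd_cbnd; last exact: measurable_funTS.
by rewrite integral_itv_bndo_bndc//; exact: measurable_funTS.
Qed.

Lemma mu_itv_ball (t s : R) : ball t s = `]t - s, t + s[%classic.
Proof. exact: ball_itv. Qed.

(** Hardy-Littlewood for [g] cut off outside [[-(L + pi), L + pi]]: an interval of radius at most
    [pi] centred in [[-L, L]] does not meet the cut. The [3] is the constant of the maximal
    inequality. *)
Lemma maximal_set g (L la : R) : continuous g -> 0 < la -> exists S : set R,
  [/\ measurable S, (mu S <= (3 / la * dint (fun x => `|g x|) (- (L + pi)) (L + pi))%:E)%E &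
    forall t, ~ S t -> `|t| <= L ->
      forall s, 0 < s <= pi -> dint (fun x => `|g x|) (t - s) (t + s) <= 2 * s * la].
Proof.
move=> cg la0; pose A := `[- (L + pi), L + pi]%classic : set R.
have Ig := continuous_locint cg; have Ing := locint_norm Ig.
have mg := locint_measurable Ig.
have lf : locally_integrable setT (g \_ A).
  apply: integrable_locally_restrict; first exact: measurable_itv.
  exact: Ig.
exists [set t | (la%:E < HL_maximal (g \_ A) t)%E]; split.
- rewrite -[X in measurable X]setTI; apply: emeasurable_fun_o_infty => //.
  exact: measurable_HL_maximal.
- apply: (le_trans (maximal_inequality lf la0)).
  rewrite [leRHS]EFinM lee_pmul2l ?lte_fin ?divr_gt0//.
  rewrite (_ : (fun y => `|((g \_ A) y)%:E|%E) = (fun y => (`|g y|%:E)) \_ A); last first.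
    by apply/funext => y; rewrite /patch; case: ifP => //= _; rewrite normr0.
  rewrite -integral_mkcond /dint /Rintegral fineK//.
  exact: integrable_fin_num (Ing _ _).
- move=> t /negP; rewrite -leNgt => hHL tL s /andP[s0 spi].
  have sA : ball t s `<=` A.
    move=> x; rewrite mu_itv_ball /A /= !in_itv/=.
    by move: tL; rewrite ler_norml => /andP[t1 t2] /andP[x1 x2]; apply/andP; split; lra.
  have : (iavg (g \_ A) (ball t s) <= la%:E)%E.
    apply: le_trans hHL; apply: ereal_sup_ubound; exists s => //=.
    by rewrite in_itv/= s0.
  have -> : iavg (g \_ A) (ball t s) = ((s *+ 2)^-1 * dint (fun x => `|g x|) (t - s) (t + s))%:E.
    have s20 : s *+ 2 != 0 by rewrite mulrn_eq0/= gt_eqF.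
    rewrite /iavg lebesgue_measure_ball ?ltW// inver (negbTE s20) EFinM; congr (_ * _)%E.
    transitivity (\int[mu]_(y in `](t - s)%R, (t + s)%R[) (`|g y|)%:E)%E.
      rewrite mu_itv_ball; apply: eq_integral => y; rewrite -mu_itv_ball => yb.
      by rewrite /patch mem_set//; apply: sA; exact: set_mem yb.
    rewrite integral_oo_cc; last first.
      by apply/measurable_EFinP; exact: locint_measurable.
    rewrite /dint /Rintegral fineK//; exact: integrable_fin_num (Ing _ _).
  rewrite lee_fin ler_pdivrMl ?mulrn_wgt0// => h.
  by rewrite -mulr_natl in h.
Qed.

End poisson_maximal.

(** * Weak-type bound for the radial maximal function *)

Section weak_type.
Context {R : realType}.
Local Notation mu := (@lebesgue_measure R).

Lemma pconvB r (f g : R -> R) t : 0 <= r < 1 -> continuous f -> continuous g ->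
  pconv r (fun s => f s - g s) t = pconv r f t - pconv r g t.
Proof.
move=> r01 cf cg; rewrite /pconv -mulrBr -dintB; [|exact: locint_pconv..].
by congr (_ * _); apply: eq_dint => s _; rewrite mulrBr.
Qed.

Lemma open_gt_norm (g : R -> R) (la : R) : continuous g -> open [set t | la < `|g t|].
Proof.
move=> cg; have cn : continuous (fun t => `|g t|).
  by move=> t; apply: (@continuous_comp _ _ _ g Num.norm); [exact: cg|exact: norm_continuous].
rewrite (_ : [set t | _] = (fun t => `|g t|) @^-1` [set y | la < y])//.
by apply: open_comp; [move=> ? _; exact: cn|exact: open_gt].
Qed.

Definition window (k : nat) : R := (2 * pi) * k%:R.

Section poisson_family.
Variables (W : R -> R -> R).
Hypothesis cW : forall r, 0 < r < 1 -> continuous (W r).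
Hypothesis pW : forall r t, 0 < r < 1 -> W r (t + 2 * pi) = W r t.
Hypothesis semiW : forall rho r t, 0 < rho < 1 -> 0 < r < 1 ->
  pconv r (W rho) t = W (r * rho) t.

(** Superlevel set of the radial maximal function over [r < sig], in a bounded window. The union is
    uncountable; measurability will come from openness. *)
Definition exceed k sig la : set R :=
  \bigcup_(r in [set r | 0 < r < sig]) ([set t | `|t| < window k] `&` [set t | la < `|W r t|]).

Lemma exceed_open k sig la : sig <= 1 -> open (exceed k sig la).
Proof.
move=> s1; apply: bigcup_open => r /= /andP[r0 rs].
apply: openI; last by apply: open_gt_norm; apply: cW; rewrite r0 (lt_le_trans rs).
rewrite (_ : [set t | _] = `]- window k, window k[%classic); last first.
  by apply/seteqP; split => t /=; rewrite in_itv/= ltr_norml.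
exact: interval_open.
Qed.

(** From L^2 to L^1 by the pointwise inequality [|g| <= de / 2 + g^2 / (2 de)]. *)
Lemma dint_abs_le (g : R -> R) (de : R) : continuous g -> 0 < de ->
  dint (fun t => g t ^+ 2) 0 (2 * pi) <= de ^+ 2 ->
  dint (fun t => `|g t|) 0 (2 * pi) <= (2 * pi + 1) * de / 2.
Proof.
move=> cg d0 h; have Ig := continuous_locint cg.
have Ig2 : locint (fun t => g t ^+ 2) by exact: locintM.
apply: (@le_trans _ _ (dint (fun t => de / 2 + (2 * de)^-1 * g t ^+ 2) 0 (2 * pi))).
  apply: ler_dint; first exact: locint_norm.
    by apply: locintD; [exact: locint_cst|exact: locintZ].
  move=> t _; rewrite -subr_ge0 -[g t ^+ 2]real_normK ?num_real//.
  have -> : de / 2 + (2 * de)^-1 * `|g t| ^+ 2 - `|g t| = (2 * de)^-1 * (de - `|g t|) ^+ 2.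
    by field; rewrite gt_eqF.
  by rewrite mulr_ge0 ?sqr_ge0// invr_ge0 mulr_ge0// ltW.
rewrite (dintD _ _ (locint_cst (de / 2)) (locintZ (2 * de)^-1 Ig2)).
rewrite (dintZ (2 * de)^-1 _ _ Ig2) dint_cst ?(ltW twopi_gt0)//.
have h2 : (2 * de)^-1 * dint (fun t => g t ^+ 2) 0 (2 * pi) <= (2 * de)^-1 * de ^+ 2.
  by rewrite ler_wpM2l// invr_ge0 mulr_ge0// ltW.
apply: (le_trans (lerD (lexx _) h2)).
by rewrite le_eqVlt; apply/orP; left; apply/eqP; field; rewrite gt_eqF.
Qed.

(** For [r < sig] the semigroup law makes [W r] the Poisson integral of [W sig] with parameter
    [r / sig], so all these radii are covered by one superlevel set of the maximal function of
    [W sig]. *)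
Lemma exceed_bound k sig la de : 0 < sig < 1 -> 0 < la -> 0 < de ->
  dint (fun t => W sig t ^+ 2) 0 (2 * pi) <= de ^+ 2 ->
  (mu (exceed k sig la) <= (3 / la * ((2 * pi + 1) * de * k.+1%:R))%:E)%E.
Proof.
move=> s01 la0 de0 hde; have cs := cW s01; have /andP[s0 s1] := s01.
have [S [mS muS hS]] := maximal_set (window k) cs la0.
have sub : exceed k sig la `<=` S.
  move=> t [r /= /andP[r0 rs] [tk hr]]; apply: contrapT => nS.
  have rs01 : 0 < r / sig < 1 by rewrite divr_gt0//= ltr_pdivrMr// mul1r.
  have rs01' : 0 <= r / sig < 1 by case/andP: rs01 => /ltW -> ->.
  have h : `|W r t| <= la.
    rewrite -{1}(divfK (lt0r_neq0 s0) r) -semiW// pconvE//; last by move=> s; exact: pW.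
    by apply: poisson_maximal => //; [exact: ltW|exact: (hS t nS (ltW tk))].
  by move: hr; rewrite ltNge h.
apply: (@le_trans _ _ (mu S)).
  by apply: le_measure; rewrite ?inE//; apply: open_measurable; apply: exceed_open; exact: ltW.
apply: (le_trans muS); rewrite lee_fin ler_wpM2l//; first by rewrite divr_ge0// ltW.
have Ing : locint (fun t => `|W sig t|) by apply: locint_norm; exact: continuous_locint.
have pn t : `|W sig (t + 2 * pi)| = `|W sig t| by rewrite pW.
have p0 := @twopi_gt0 R; have pi0 := @pi_gt0 R.
(* The window of index [k.+1] contains that of index [k] enlarged by [pi] on both sides, and
   consists of [2 (k + 1)] full periods. *)
pose m := (2 * k.+1)%N.
apply: (@le_trans _ _ (dint (fun t => `|W sig t|) (- window k.+1) (- window k.+1 + (2 * pi) *+ m))).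
  have e1 : window k.+1 = window k + 2 * pi.
    by rewrite /window -[k.+1%:R]natr1 mulrDr mulr1.
  have e2 : - window k.+1 + (2 * pi) *+ m = window k.+1.
    rewrite /m mulnC mulrnA mulr2n /window mulr_natr; ring.
  apply: dint_subset => //; rewrite ?e2 e1; lra.
rewrite dint_periodicMn// -[leLHS]mulr_natr /m natrM mulrA.
apply: ler_pM => //; first by rewrite mulr_ge0//; apply: dint_ge0.
have := dint_abs_le cs de0 hde; set X := dint _ _ _; lra.
Qed.

(** The sets for [sig < 1] increase to the set for [1] and share one bound, so continuity of the
    measure from below applies. *)
Lemma exceed_bound1 k la de sig0 : sig0 < 1 -> 0 < la -> 0 < de ->
  (forall sig, sig0 <= sig -> 0 < sig < 1 -> dint (fun t => W sig t ^+ 2) 0 (2 * pi) <= de ^+ 2) ->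
  (mu (exceed k 1%R la) <= (3 / la * ((2 * pi + 1) * de * k.+1%:R))%:E)%E.
Proof.
move=> s01 la0 de0 hde.
pose s1 := Num.max sig0 (1 / 2).
have s11 : s1 < 1 by rewrite gt_max s01/=; lra.
have s10 : 0 < s1 by rewrite lt_max; apply/orP; right; lra.
pose sig n : R := 1 - (1 - s1) / n.+1%:R.
have sigs n : s1 <= sig n.
  by rewrite /sig lerBrDr -lerBrDl ler_pdivrMr// ler_peMr ?ler1n// subr_ge0 ltW.
have sig1 n : 0 < sig n < 1.
  by rewrite (lt_le_trans s10 (sigs n))/= /sig gtrBl divr_gt0// subr_gt0.
have mono n m : (n <= m)%N -> sig n <= sig m.
  by move=> nm; rewrite /sig lerD2l lerN2 ler_pM2l ?subr_gt0// lef_pV2 ?posrE// ler_nat ltnS.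
have me n : measurable (exceed k (sig n) la).
  by apply: open_measurable; apply: exceed_open; have /andP[_ /ltW] := sig1 n.
have cup : exceed k 1 la = \bigcup_n exceed k (sig n) la.
  apply/seteqP; split.
    move=> t [r /= /andP[r0 r1] ht].
    exists (Num.bound ((1 - s1) / (1 - r))) => //.
    exists r => //=; rewrite r0/= /sig ltrBrDr -ltrBrDl.
    have : 0 <= (1 - s1) / (1 - r) by rewrite divr_ge0 ?subr_ge0 ?ltW.
    move=> /archi_boundP; set B := Num.bound _ => hB.
    rewrite ltr_pdivrMr// mulrC -ltr_pdivrMr ?subr_gt0//.
    by rewrite (lt_le_trans hB)// ler_nat.
  move=> t [n _ [r /= /andP[r0 rs] ht]]; exists r => //=.
  by rewrite r0 (lt_trans rs)//; case/andP: (sig1 n).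
have ndec : nondecreasing_seq (fun n => exceed k (sig n) la).
  move=> n m nm; apply/subsetPset => t [r /= /andP[r0 rs] ht]; exists r => //=.
  by rewrite r0 (lt_le_trans rs)// mono.
have mcup : measurable (\bigcup_n exceed k (sig n) la) by apply: bigcupT_measurable.
have := nondecreasing_cvg_mu (mu := mu) me mcup ndec.
rewrite -cup => hc; apply: (cvge_to_le hc); apply: nearW => n.
apply: exceed_bound => //; apply: hde => //.
by apply: le_trans (sigs n); rewrite le_max lexx.
Qed.

End poisson_family.

End weak_type.

(** * Almost everywhere radial limits and the boundary function *)

Section fatou.
Context {R : realType}.
Local Notation mu := (@lebesgue_measure R).
Variables (U : R -> R -> R) (a b : nat -> R) (C : R).
Hypothesis hU : harmonic U a b.
Hypothesis bU : forall r, 0 < r < 1 -> norm2 U r <= C.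

Lemma norm2_near_sup e : 0 < e -> exists2 tau, 0 < tau < 1 &
  forall s, tau <= s -> s < 1 -> norm2 U s - norm2 U tau <= e.
Proof.
move=> e0; pose E := [set norm2 U s | s in [set s | 0 < s < 1]].
have hE : has_sup E.
  split; first by exists (norm2 U (1 / 2)), (1 / 2) => //=; lra.
  by exists C => _ [s hs <-]; exact: bU.
have [_ [tau /= t01 <-] ht] := sup_adherent e0 hE.
exists tau => // s ts s1.
have : norm2 U s <= sup E.
  apply: sup_upper_bound => //; exists s => //=.
  by rewrite s1 andbT (lt_le_trans _ ts)//; case/andP: t01.
move: ht; lra.
Qed.

Definition oscillating k la : set R := [set t | `|t| < window k /\
  ~ exists r0, 0 < r0 < 1 /\ forall r r', r0 < r < 1 -> r0 < r' < 1 -> `|U r t - U r' t| <= 3 * la].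

(** [V r = U r - U (ka * r)] obeys the semigroup law again and, by [norm2_diff], is small in L^2, so
    the set where some [V r] exceeds [la] is small. Elsewhere [U r] stays within [la] of
    [U (ka * r)], which converges to [U ka] because [ka < 1]; this gives the Cauchy criterion at
    level [3 la]. *)
Lemma oscillating_cover k la e : 0 < la -> 0 < e ->
  exists D, [/\ measurable D, oscillating k la `<=` D & (mu D <= e%:E)%E].
Proof.
move=> la0 e0.
pose K : R := 3 / la * ((2 * pi + 1) * k.+1%:R).
have K0 : 0 < K.
  by rewrite mulr_gt0 ?divr_gt0// mulr_gt0// addr_gt0// twopi_gt0.
(* Chosen so that the weak-type bound is exactly [e]. *)
pose de := e / K; have de0 : 0 < de by rewrite divr_gt0.
have [tau t01 htau] := norm2_near_sup (exprn_gt0 2 de0).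
have /andP[tau0 tau1] := t01.
(* As [tau < ka], there are radii [sig] in [[tau / ka, 1[]; for them both [sig] and [ka * sig] are
   at least [tau], where the norms are nearly constant. *)
pose ka := (1 + tau) / 2.
have ka0 : 0 < ka by rewrite /ka; lra.
have ka1 : ka < 1 by rewrite /ka; lra.
have tka : tau < ka by rewrite /ka; lra.
pose V r t := U r t - U (ka * r) t.
have kr r : 0 < r < 1 -> 0 < ka * r < 1.
  by move=> /andP[r0 r1]; rewrite mulr_gt0//= mulr_ilt1// ltW.
have cV r : 0 < r < 1 -> continuous (V r).
  move=> r01 t; apply: cvgB; first exact: (harmonic_continuous hU).
  by apply: (harmonic_continuous hU); exact: kr.
have pV r t : 0 < r < 1 -> V r (t + 2 * pi) = V r t.
  by move=> r01; rewrite /V !(harmonic_periodic hU)//; exact: kr.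
have sV rho r t : 0 < rho < 1 -> 0 < r < 1 -> pconv r (V rho) t = V (r * rho) t.
  move=> rho01 r01; have r01' : 0 <= r < 1 by case/andP: r01 => /ltW -> ->.
  rewrite pconvB//; [|exact: (harmonic_continuous hU)|by apply: (harmonic_continuous hU); exact: kr].
  by rewrite !(harmonic_semigroup hU)// ?kr// /V mulrCA.
have s01 : tau / ka < 1 by rewrite ltr_pdivrMr// mul1r.
have hV sig : tau / ka <= sig -> 0 < sig < 1 -> dint (fun t => V sig t ^+ 2) 0 (2 * pi) <= de ^+ 2.
  move=> ts s01'; have /andP[sig0 sig1] := s01'; have /andP[ks0 ks1] := kr _ s01'.
  have ks : tau <= ka * sig by rewrite mulrC -ler_pdivrMr.
  have kss : ka * sig <= sig by rewrite ler_piMl ?ltW.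
  apply: (le_trans (norm2_diff hU ks0 kss sig1)).
  apply: (@le_trans _ _ (norm2 U sig - norm2 U tau)).
    by rewrite lerD2l lerN2; exact: (norm2_mono hU).
  by apply: htau => //; exact: le_trans kss.
exists (exceed V k 1 la); split.
- by apply: open_measurable; exact: exceed_open.
- move=> t [tk hosc]; apply: contrapT => nex; apply: hosc.
  have hVt r : 0 < r < 1 -> `|V r t| <= la.
    move=> r01; rewrite leNgt; apply/negP => hr; apply: nex.
    by exists r.
  have ka01 : 0 < ka < 1 by rewrite ka0.
  have /cvgrPdist_le/(_ (la / 2)) := @harmonic_continuous_radius _ U a b hU t ka ka01.
  rewrite divr_gt0// => /(_ isT)/nbhs_ballP[d/= d0 hd].
  pose r0 := Num.max (1 / 2) (1 - d).
  have r00 : 0 < r0 by rewrite lt_max; apply/orP; left; lra.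
  have r01 : r0 < 1 by rewrite gt_max gtrBl d0 andbT; lra.
  exists r0; split; first by rewrite r00.
  have near r : r0 < r < 1 -> `|U r t - U ka t| <= la + la / 2.
    move=> /andP[]; rewrite gt_max => /andP[r2 rd] r1.
    have r01' : 0 < r < 1 by rewrite r1 andbT; lra.
    rewrite -(subrKA (U (ka * r) t)) (le_trans (ler_normD _ _))// lerD//; first exact: hVt.
    rewrite distrC; apply: hd; rewrite /ball/= -{1}[ka]mulr1 -mulrBr normrM.
    rewrite (gtr0_norm ka0) ger0_norm ?subr_ge0 ?ltW//.
    apply: (@le_lt_trans _ _ (1 - r)); last by lra.
    by rewrite ler_piMl ?subr_ge0 ?ltW.
  move=> r r' hr hr'; rewrite -(subrKA (U ka t)) (le_trans (ler_normD _ _))//.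
  apply: (le_trans (lerD (near _ hr) (le_trans _ (near _ hr')))); first by rewrite distrC.
  lra.
- apply: (le_trans (exceed_bound1 cV pV sV k s01 la0 de0 hV)).
  rewrite lee_fin /de /K; set X := 3 / la; rewrite le_eqVlt; apply/orP; left; apply/eqP.
  have X0 : X != 0 by rewrite gt_eqF// divr_gt0.
  have Y0 : 2 * pi + 1 != 0 :> R by rewrite gt_eqF// addr_gt0// twopi_gt0.
  move: Y0; set Y := 2 * pi + 1 => Y0; field.
  by rewrite X0 Y0 !andbT gt_eqF// ltr_pwDl.
Qed.

Lemma oscillating_negligible k la : 0 < la -> mu.-negligible (oscillating k la).
Proof.
move=> la0.
have /choice[D hD] : forall n : nat, exists D, [/\ measurable D, oscillating k la `<=` D &
    (mu D <= (n.+1%:R^-1)%:E)%E] by move=> n; apply: oscillating_cover.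
exists (\bigcap_n D n); split.
- by apply: bigcapT_measurable => n; have [] := hD n.
- apply/eqP; rewrite eq_le measure_ge0 andbT; apply/lee_addgt0Pr => e e0; rewrite add0e.
  pose n := Num.bound e^-1; have [mD _ muD] := hD n.
  apply: (@le_trans _ _ (mu (D n))).
    apply: le_measure; rewrite ?inE//; first by apply: bigcapT_measurable => m; have [] := hD m.
    exact: bigcap_inf.
  apply: (le_trans muD); rewrite lee_fin invf_ple ?posrE//.
  have h : 0 <= e^-1 by rewrite invr_ge0 ltW.
  apply: ltW; apply: (lt_le_trans (archi_boundP h)).
  by rewrite ler_nat.
- by move=> t ht n _; have [_ s _] := hD n; exact: s.
Qed.

Lemma radial_limit : exists N : set R, [/\ measurable N, mu N = 0%E &
  forall t, ~ N t -> cvg (U r t @[r --> 1^'-])].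
Proof.
have : mu.-negligible (\bigcup_k \bigcup_m oscillating k (m.+1%:R^-1)).
  apply: negligible_bigcup => k; apply: negligible_bigcup => m.
  by apply: oscillating_negligible; rewrite invr_gt0.
move=> [N [mN N0 hN]]; exists N; split => // t nN.
apply/cauchy_cvgP/cauchy_exP => e e0.
pose k := Num.bound (`|t|).
pose m := Num.bound (6 / e).
have nosc : ~ oscillating k m.+1%:R^-1 t.
  by move=> h; apply: nN; apply: hN; exists k => //; exists m.
have tk : `|t| < window k.
  rewrite /window; have h := archi_boundP (normr_ge0 t); rewrite -/k in h.
  apply: (lt_le_trans h); rewrite ler_peMl//.
  by have := @pi_ge2 R; lra.
have [r0 [r01 hr]] : exists r0, 0 < r0 < 1 /\
    forall r r', r0 < r < 1 -> r0 < r' < 1 -> `|U r t - U r' t| <= 3 * m.+1%:R^-1.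
  by apply: contrapT => h; apply: nosc; split.
have hm : 3 * m.+1%:R^-1 < e.
  have h := archi_boundP (divr_ge0 (ler0n R 6) (ltW e0)); rewrite -/m in h.
  rewrite ltr_pdivrMr// -ltr_pdivrMl//.
  apply: (@lt_le_trans _ _ m%:R); last by rewrite ler_nat.
  by apply: le_lt_trans h; rewrite mulrC ler_pM2r ?invr_gt0// ler_nat.
have /andP[r00 r0l1] := r01.
exists (U ((r0 + 1) / 2) t).
have : \forall r \near (1 : R)^'-, ball (U ((r0 + 1) / 2) t) e (U r t); last exact.
near=> r; rewrite /ball/=; apply: le_lt_trans hm.
apply: hr; first by apply/andP; split; lra.
apply/andP; split; near: r; [exact: nbhs_left_gt|exact: nbhs_left_lt].
Unshelve. all: by end_near. Qed.

Lemma seq_at_left (c : R) : 0 < c -> (fun n : nat => 1 - c / n.+1%:R) @ \oo --> (1 : R)^'-.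
Proof.
move=> c0 P [e /= e0 hP].
exists (Num.bound (c / e)) => // n /= hn; apply: hP => /=; last first.
  by rewrite gtrBl divr_gt0.
rewrite opprB addrC subrK gtr0_norm ?divr_gt0//.
rewrite ltr_pdivrMr// mulrC -ltr_pdivrMr//.
apply: (lt_le_trans (archi_boundP (divr_ge0 (ltW c0) (ltW e0)))).
by rewrite ler_nat (leq_trans hn).
Qed.

(** Setting [u] to [0] on the null set makes it an everywhere limit of measurable functions. The L^2
    estimate is Fatou's lemma along radii tending to [1], fed with [norm2_diff]. *)
Theorem boundary_function : exists (N : set R) (u : R -> R),
  [/\ measurable N, mu N = 0%E, measurable_fun setT u,
    forall t, ~ N t -> U r t @[r --> 1^'-] --> u t &
    forall e, 0 < e -> exists2 r0, 0 < r0 < 1 & forall r, r0 <= r -> r < 1 ->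
      locint (fun t => (u t - U r t) ^+ 2) /\
      forall x, dint (fun t => (u t - U r t) ^+ 2) x (x + 2 * pi) <= e].
Proof.
have [N [mN N0 hN]] := radial_limit.
pose I : R -> R := \1_(~` N).
have mI : measurable_fun setT I by apply: measurable_indic; exact: measurableC.
have I0 t : N t -> I t = 0.
  by move=> Nt; rewrite /I indicE memNset//; apply.
have I1 t : ~ N t -> I t = 1 by move=> Nt; rewrite /I indicE mem_set.
pose u t := I t * lim (U r t @[r --> 1^'-]).
have hu t : ~ N t -> U r t @[r --> 1^'-] --> u t.
  by move=> Nt; rewrite /u I1// mul1r; exact: hN.
pose s c n : R := 1 - c / n.+1%:R.
have s01 c n : 0 < c < 1 -> 0 < s c n < 1.
  move=> /andP[c0 c1]; rewrite /s gtrBl divr_gt0// andbT subr_gt0.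
  by rewrite ltr_pdivrMr// mul1r (lt_le_trans c1)// ler1n.
have hs c t : 0 < c < 1 -> ~ N t -> U (s c n) t @[n --> \oo] --> u t.
  by move=> /andP[c0 _] Nt; apply: cvg_comp (hu t Nt); exact: seq_at_left.
have mU r : 0 < r < 1 -> measurable_fun setT (U r).
  by move=> r01; apply: locint_measurable; apply: continuous_locint; exact: (harmonic_continuous hU).
have mu_ : measurable_fun setT u.
  have h12 : 0 < (1 / 2 : R) < 1 by apply/andP; split; lra.
  apply: (@measurable_fun_cvg _ _ _ _ (fun n t => I t * U (s (1 / 2) n) t)).
    by move=> n; apply: measurable_funM => //; apply: mU; exact: s01.
  move=> t _; have [Nt|Nt] := pselect (N t).
    by rewrite /u I0// mul0r; under eq_fun do rewrite mul0r; exact: cvg_cst.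
  by rewrite I1//; under eq_fun do rewrite mul1r; exact: hs.
exists N, u; split => // e e0.
have [tau t01 htau] := norm2_near_sup e0; have /andP[t0 t1] := t01.
exists tau => // r tr r1; have r0 := lt_le_trans t0 tr.
have r01 : 0 < r < 1 by rewrite r0.
pose w t := (u t - U r t) ^+ 2.
have mw : measurable_fun setT w.
  by apply: measurable_funX; apply: measurable_funB => //; exact: mU.
(* [m = 1] gives the final estimate and large [m] the integrability on arbitrary intervals. The
   starting point [x] is arbitrary because [N], and so [u], need not be periodic. *)
have key x m : (\int[mu]_(t in `[x, (x + 2 * pi *+ m)%R]) (w t)%:E <= (e *+ m)%:E)%E.
  set D := `[x, _]%classic.
  have mD : measurable D by exact: measurable_itv.
  (* The radii [s (1 - r) n] start at [r] and increase to [1], so that [norm2_diff] applies with [r]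
     as the smaller radius. *)
  pose f n t := (I t * (U (s (1 - r) n) t - U r t) ^+ 2)%:E.
  have c01 : 0 < 1 - r < 1 by rewrite subr_gt0 r1/= gtrBl.
  have sr n : r <= s (1 - r) n.
    rewrite /s lerBrDr -lerBrDl ler_pdivrMr// ler_peMr ?ler1n// subr_ge0 ltW//.
  have mf n : measurable_fun D (f n).
    apply/measurable_EFinP/measurable_funTS; apply: measurable_funM => //.
    by apply: measurable_funX; apply: measurable_funB; apply: mU => //; exact: s01.
  have I01 t : 0 <= I t <= 1.
    by have [Nt|Nt] := pselect (N t); rewrite ?(I0 t Nt) ?(I1 t Nt) ?lexx ?ler01.
  have f0 n t : D t -> (0 <= f n t)%E.
    by move=> _; rewrite lee_fin mulr_ge0 ?sqr_ge0//; case/andP: (I01 t).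
  have := fatou mu mD mf f0.
  have -> : (\int[mu]_(t in D) limn_einf (f^~ t) = \int[mu]_(t in D) (w t)%:E)%E.
    transitivity (\int[mu]_(t in D) (I t * w t)%:E)%E.
      apply: eq_integral => t _; have [Nt|Nt] := pselect (N t).
        rewrite I0// mul0r; apply: (cvg_limn_einf_sup _).1.
        by rewrite /f; under eq_fun do rewrite I0// mul0r; exact: cvg_cst.
      rewrite I1// mul1r; apply: (cvg_limn_einf_sup _).1.
      rewrite /f; under eq_fun do rewrite I1// mul1r.
      apply/fine_cvgP; split; first exact: nearW.
      have hd : U (s (1 - r) n) t - U r t @[n --> \oo] --> u t - U r t.
        by apply: cvgB; [exact: hs|exact: cvg_cst].
      rewrite /w expr2 (_ : fine \o _ = (fun n => (U (s (1 - r) n) t - U r t) *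
        (U (s (1 - r) n) t - U r t))); first exact: cvgM.
      by apply/funext => n /=; rewrite expr2.
    apply: ae_eq_integral => //.
    - by apply/measurable_EFinP/measurable_funTS; exact: measurable_funM.
    - by apply/measurable_EFinP/measurable_funTS.
    - exists N; split => // t /= ht; apply: contrapT => Nt; apply: ht => _.
      by rewrite I1// mul1r.
  move=> /le_trans; apply.
  have fe n : (\int[mu]_(t in D) f n t <= (e *+ m)%:E)%E.
    have sn := s01 _ n c01; have /andP[_ sn1] := sn.
    have cd : continuous (fun t => U (s (1 - r) n) t - U r t).
      by move=> t; apply: cvgB; apply: (harmonic_continuous hU).
    have Id : locint (fun t => (U (s (1 - r) n) t - U r t) ^+ 2) by exact: locintM.
    apply: (@le_trans _ _ (dint (fun t => (U (s (1 - r) n) t - U r t) ^+ 2) x (x + 2 * pi *+ m))%:E).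
      rewrite /dint /Rintegral fineK; last exact: integrable_fin_num (Id _ _).
      apply: ge0_le_integral => //.
      - by move=> t Dt; exact: f0.
      - exact: mf.
      - by apply: (measurable_int mu); exact: Id.
      - by move=> t _; rewrite lee_fin ler_piMl ?sqr_ge0//; case/andP: (I01 t).
    rewrite lee_fin dint_periodicMn//; [|exact: twopi_gt0|]; last first.
      by move=> t; rewrite !(harmonic_periodic hU).
    rewrite lerMn2r; apply/orP; right.
    apply: (le_trans (norm2_diff hU r0 (sr n) sn1)).
    apply: (@le_trans _ _ (norm2 U (s (1 - r) n) - norm2 U tau)).
      by rewrite lerD2l lerN2; exact: (norm2_mono hU).
    by apply: htau => //; exact: le_trans (sr n).
  rewrite limn_einf_lim; apply: lime_le; first exact: is_cvg_einfs.
  by apply: nearW => n; apply: le_trans (fe n); by apply: ereal_inf_lbound; exists n => /=.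
have w0 t : 0 <= w t by exact: sqr_ge0.
have lw : locint w.
  move=> x y; apply/integrableP; split; first exact/measurable_EFinP/measurable_funTS.
  pose m := Num.bound `|y - x|.
  apply: (@le_lt_trans _ _ (\int[mu]_(t in `[x, (x + 2 * pi *+ m)%R]) (w t)%:E)%E); last first.
    by apply: (le_lt_trans (key x m)); rewrite ltry.
  under eq_integral do rewrite gee0_abs ?lee_fin//.
  apply: ge0_subset_integral => //.
  - exact/measurable_EFinP/measurable_funTS.
  - by move=> t _ /=; rewrite lee_fin.
  move=> t /=; rewrite !in_itv/= => /andP[-> ty]; apply: (le_trans ty).
  rewrite -lerBlDl (le_trans (ler_norm _))// (le_trans (ltW (archi_boundP (normr_ge0 _))))//.
  rewrite lerMn2r; apply/orP; right; have := @pi_ge2 R; lra.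
split => // x; have := key x 1%N; rewrite !mulr1n -lee_fin /dint /Rintegral fineK//.
exact: integrable_fin_num (lw _ _).
Qed.

End fatou.

(** * Mean oscillation *)

Section mean_oscillation.
Context {R : realType}.
Local Notation mu := (@lebesgue_measure R).
Implicit Types (f g u v : R -> R) (a b c e : R).

Lemma locint_le f g : measurable_fun setT f -> locint g ->
  (forall t, `|f t| <= g t) -> locint f.
Proof.
move=> mf Ig fg a b.
apply: (@le_integrable _ _ _ mu _ (measurable_itv _) _ (EFin \o g)) (Ig a b).
  exact/measurable_EFinP/measurable_funTS.
by move=> t _ /=; rewrite lee_fin (le_trans (fg t))// ler_norm.
Qed.

Definition locl2 u := measurable_fun setT u /\ locint (fun t => u t ^+ 2).

Lemma continuous_locl2 u : continuous u -> locl2 u.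
Proof.
move=> cu; split; first by apply: locint_measurable; exact: continuous_locint.
exact: locintM.
Qed.

Lemma locl2M u v : locl2 u -> locl2 v -> locint (fun t => u t * v t).
Proof.
move=> [mu_ Iu] [mv Iv].
apply: (locint_le (g := fun t => u t ^+ 2 + v t ^+ 2)); last 1 first.
- move=> t; have := sqr_ge0 (u t - v t); have := sqr_ge0 (u t + v t).
  by rewrite ler_norml; have := sqr_ge0 (u t); have := sqr_ge0 (v t); nra.
- exact: measurable_funM.
- exact: locintD.
Qed.

Lemma locl2_cst c : locl2 (fun=> c).
Proof. by apply: continuous_locl2; exact: cst_continuous. Qed.

Lemma locl2_locint u : locl2 u -> locint u.
Proof. move=> hu; have := locl2M hu (locl2_cst 1).
by under [X in locint X]eq_fun do rewrite mulr1. Qed.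

Lemma locl2D u v : locl2 u -> locl2 v -> locl2 (fun t => u t + v t).
Proof.
move=> hu hv; split; first by case: hu hv => [? _] [? _]; exact: measurable_funD.
under eq_fun do rewrite sqrrD -mulr_natl.
apply: locintD; last by case: hv.
by apply: locintD; [case: hu|apply/locintZ/locl2M].
Qed.

Lemma locl2Z c u : locl2 u -> locl2 (fun t => c * u t).
Proof.
move=> [mu_ Iu]; split; first exact: measurable_funM.
by under eq_fun do rewrite exprMn; exact: locintZ.
Qed.

Lemma locl2B u v : locl2 u -> locl2 v -> locl2 (fun t => u t - v t).
Proof.
move=> hu hv; under eq_fun do rewrite -mulN1r.
exact/(locl2D hu)/locl2Z.
Qed.

Lemma locl2_shift c u : locl2 u -> locl2 (fun t => u (t + c)).
Proof.
move=> [mu_ Iu]; split; first exact: measurableT_comp (measurable_shift c).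
exact: (locint_shift c Iu).
Qed.

Definition avg u a b : R := (b - a)^-1 * dint u a b.

Definition osc u a b : R := (b - a)^-1 * dint (fun t => (u t - avg u a b) ^+ 2) a b.

Lemma osc_ge0 u a b : a <= b -> 0 <= osc u a b.
Proof.
move=> ab; rewrite mulr_ge0 ?invr_ge0 ?subr_ge0//.
by apply: dint_ge0 => t _; exact: sqr_ge0.
Qed.

Lemma dint_sqrB u c a b : a < b -> locl2 u ->
  dint (fun t => (u t - c) ^+ 2) a b =
  dint (fun t => u t ^+ 2) a b - 2 * c * dint u a b + c ^+ 2 * (b - a).
Proof.
move=> ab hu; have Iu := locl2_locint hu.
transitivity (dint (fun t => u t ^+ 2 - (2 * c) * u t + c ^+ 2) a b).
  by apply: eq_dint => t _; ring.
have Id : locint (fun t => u t ^+ 2 - (2 * c) * u t).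
  by apply: locintB; [case: hu|exact: locintZ].
rewrite (dintD a b Id (locint_cst _)) dint_cst ?ltW//.
by rewrite dintB ?dintZ//; [case: hu|exact: locintZ].
Qed.

(** The two integrals differ by [(c - avg u a b)^2 * (b - a)]. *)
Lemma osc_min u c a b : a < b -> locl2 u ->
  osc u a b <= (b - a)^-1 * dint (fun t => (u t - c) ^+ 2) a b.
Proof.
move=> ab hu; have ab0 : 0 < b - a by rewrite subr_gt0.
rewrite ler_wpM2l ?invr_ge0 ?(ltW ab0)//.
rewrite !dint_sqrB// /avg; set m := dint u a b; set L := b - a.
have L0 : L != 0 by rewrite gt_eqF.
rewrite -subr_ge0 [leRHS](_ : _ = (c - L^-1 * m) ^+ 2 * L); last by field.
by rewrite mulr_ge0 ?sqr_ge0// ltW.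
Qed.

Lemma osc_shift c u a b : locl2 u -> osc (fun t => u (t + c)) a b = osc u (a + c) (b + c).
Proof.
move=> hu; have hc : b + c - (a + c) = b - a by ring.
rewrite /osc /avg (dint_shift c a b (locl2_locint hu)) !hc; congr (_ * _).
have hm : locl2 (fun t => u t - (b - a)^-1 * dint u (a + c) (b + c)).
  exact: (locl2B hu (locl2_cst _)).
by have := dint_shift c a b hm.2.
Qed.

Lemma poisson_le (r s : R) : 0 <= r < 1 -> poisson r s <= (1 - r ^+ 2) / (1 - r) ^+ 2.
Proof.
move=> r01; have /andP[r0 r1] := r01.
rewrite ler_pM2l ?sqr_lt1// lef_pV2 ?posrE ?poisson_den_gt0//.
  by rewrite poisson_den_ge.
by rewrite exprn_gt0// subr_gt0.
Qed.

Lemma locint_poissonM (r : R) v : 0 <= r < 1 -> locint v -> locint (fun s => poisson r s * v s).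
Proof.
move=> r01 Iv.
apply: (locint_le (g := fun s => ((1 - r ^+ 2) / (1 - r) ^+ 2) * `|v s|)).
- apply: measurable_funM; last exact: locint_measurable.
  by apply: locint_measurable; apply: continuous_locint; exact: continuous_poisson.
- by apply: locintZ; exact: locint_norm.
- move=> s; rewrite normrM ger0_norm; last by rewrite ltW// poisson_gt0.
  by rewrite ler_wpM2r// poisson_le.
Qed.

(** [poisson r / (2 pi)] is a probability density on [[-pi, pi]]; the claim is that the variance of
    [w], whose mean is [m], is nonnegative. *)
Lemma jensen_poisson r w : 0 <= r < 1 -> locl2 w ->
  ((2 * pi)^-1 * dint (fun s => poisson r s * w s) (- pi) pi) ^+ 2 <=
  (2 * pi)^-1 * dint (fun s => poisson r s * w s ^+ 2) (- pi) pi.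
Proof.
move=> r01 [mw Iw]; have p0 := @twopi_gt0 R.
have cP := continuous_poisson r01.
have P0 s : 0 <= poisson r s by rewrite ltW// poisson_gt0.
have IP2 := locint_poissonM r01 Iw.
have IP : locint (fun s => poisson r s * w s).
  by apply: locl2M => //; exact: continuous_locl2.
have IP0 : locint (poisson r) by exact: continuous_locint.
set m := (2 * pi)^-1 * _.
have : 0 <= dint (fun s => poisson r s * (w s - m) ^+ 2) (- pi) pi.
  by apply: dint_ge0 => s _; rewrite mulr_ge0 ?sqr_ge0.
have -> : dint (fun s => poisson r s * (w s - m) ^+ 2) (- pi) pi =
   dint (fun s => poisson r s * w s ^+ 2) (- pi) pi
   - 2 * m * dint (fun s => poisson r s * w s) (- pi) pi + m ^+ 2 * (2 * pi).
  transitivity (dint (fun s => poisson r s * w s ^+ 2 - 2 * m * (poisson r s * w s) +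
      m ^+ 2 * poisson r s) (- pi) pi).
    by apply: eq_dint => s _; ring.
  have I1 : locint (fun s => poisson r s * w s ^+ 2 - 2 * m * (poisson r s * w s)).
    by apply: locintB => //; exact: locintZ.
  rewrite (dintD _ _ I1 (locintZ (m ^+ 2) IP0)) (dintZ (m ^+ 2) _ _ IP0) dint_poisson//.
  by rewrite (dintB _ _ IP2 (locintZ (2 * m) IP)) (dintZ (2 * m) _ _ IP).
have -> : dint (fun s => poisson r s * w s) (- pi) pi = 2 * pi * m.
  by rewrite /m mulVKf// gt_eqF.
set D := dint _ _ _ => h.
rewrite -(ler_pM2l p0) mulVKf ?gt_eqF//; lra.
Qed.

(** On an interval [[A, B]] containing all translates near [s0], the average is a difference of two
    values of one primitive, and primitives of integrable functions are continuous. This puts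
    [s |-> avg u (a + s) (b + s)] among the locally square integrable functions. *)
Lemma continuous_avg u a b : a < b -> locl2 u ->
  continuous (fun s => avg u (a + s) (b + s)).
Proof.
move=> ab hu s0; have Iu := locl2_locint hu.
pose A := a + s0 - 1; pose B := b + s0 + 1.
have AB : A < B by rewrite /A /B; lra.
have := @parameterized_integral_continuous R A B u (ltW AB) (Iu _ _).
move=> /(continuous_within_itvP _ AB)[cF _ _].
have cx x : -1 < x - s0 < b - a + 1 -> {for a + x, continuous (dint u A)}.
  by move=> /andP[x1 x2]; apply: cF; rewrite in_itv/= /A /B; apply/andP; split; lra.
have cy x : -1 < x - s0 < 1 -> {for b + x, continuous (dint u A)}.
  by move=> /andP[x1 x2]; apply: cF; rewrite in_itv/= /A /B; apply/andP; split; lra.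
have avgE s : -1 < s - s0 < 1 ->
    avg u (a + s) (b + s) = (b - a)^-1 * (dint u A (b + s) - dint u A (a + s)).
  move=> /andP[s1 s2]; rewrite /avg (_ : b + s - (a + s) = b - a); last by ring.
  by rewrite (@dint_split _ (a + s) u A (b + s) Iu) ?[X in _ * X]addrAC ?subrr ?add0r//
    /A /B; lra.
have s00 : -1 < s0 - s0 < 1 by rewrite subrr ltrN10 ltr01.
rewrite /continuous_at avgE//.
have c1 : (b - a)^-1 * (dint u A (b + s) - dint u A (a + s)) @[s --> s0] -->
    (b - a)^-1 * (dint u A (b + s0) - dint u A (a + s0)).
  apply: cvgM; first exact: cvg_cst.
  apply: cvgB.
    apply: (@continuous_comp _ _ _ (fun s => b + s) (dint u A)); last exact: cy.
    by apply: cvgD; [exact: cvg_cst|exact: cvg_id].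
  apply: (@continuous_comp _ _ _ (fun s => a + s) (dint u A)); last first.
    by apply: cx; rewrite subrr; lra.
  by apply: cvgD; [exact: cvg_cst|exact: cvg_id].
apply: cvg_trans c1; apply: near_eq_cvg; near=> s.
rewrite avgE//.
suff : `|s - s0| < 1 by rewrite ltr_norml.
by near: s; exists 1 => //= s; rewrite distrC.
Unshelve. all: by end_near. Qed.

Lemma measurable_integral_section (h : R * R -> R) (B : set R) : measurable B ->
  measurable_fun setT h -> (forall z, 0 <= h z) ->
  measurable_fun setT (fun t => \int[mu]_(s in B) (h (t, s))%:E)%E.
Proof.
move=> mB mh h0.
pose k (z : R * R) := ((fun z => (h z)%:E) \_ (setT `*` B)) z.
have mk : measurable_fun setT k.
  apply/(measurable_restrictT _ _).1; first exact: measurableX.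
  exact/measurable_EFinP/measurable_funTS.
have k0 z : (0 <= k z)%E by rewrite /k patchE; case: ifPn; rewrite ?lee_fin.
have := @measurable_fun_fubini_tonelli_F _ _ _ _ R mu k mk k0.
congr measurable_fun; apply/funext => t.
rewrite [RHS]integral_mkcond; apply: eq_integral => s _; rewrite /k !patchE.
by congr (if _ then _ else _); rewrite in_setX/= in_setT.
Qed.

(** Extension of the integrand by zero outside [A x B] reduces to Tonelli's theorem on the plane. *)
Lemma tonelli_set (h : R * R -> R) (A B : set R) : measurable A -> measurable B ->
  measurable_fun setT h -> (forall z, 0 <= h z) ->
  (\int[mu]_(t in A) \int[mu]_(s in B) (h (t, s))%:E =
   \int[mu]_(s in B) \int[mu]_(t in A) (h (t, s))%:E)%E.
Proof.
move=> mA mB mh h0.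
pose k (z : R * R) := ((fun z => (h z)%:E) \_ (A `*` B)) z.
have mk : measurable_fun setT k.
  apply/(measurable_restrictT _ _).1; first exact: measurableX.
  exact/measurable_EFinP/measurable_funTS.
have k0 z : (0 <= k z)%E by rewrite /k patchE; case: ifPn; rewrite ?lee_fin.
have := @fubini_tonelli _ _ _ _ R mu mu k mk k0.
have -> : (\int[mu]_x \int[mu]_y k (x, y) = \int[mu]_(t in A) \int[mu]_(s in B) (h (t, s))%:E)%E.
  rewrite [RHS]integral_mkcond; apply: eq_integral => t _; rewrite patchE.
  case: ifPn => [tA|tA].
    rewrite [RHS]integral_mkcond; apply: eq_integral => s _; rewrite /k !patchE.
    by congr (if _ then _ else _); rewrite in_setX/= tA.
  rewrite integral0_eq// => s _; rewrite /k patchE in_setX/=.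
  by rewrite (negbTE tA).
move=> ->; rewrite [RHS]integral_mkcond; apply: eq_integral => s _; rewrite patchE.
case: ifPn => [sB|sB].
  rewrite [RHS]integral_mkcond; apply: eq_integral => t _; rewrite /k !patchE.
  by congr (if _ then _ else _); rewrite in_setX/= sB andbT.
rewrite integral0_eq// => t _; rewrite /k patchE in_setX/=.
by rewrite (negbTE sB) andbF.
Qed.

(* Compare [U] on the interval with the [P_r]-mean over [s] of the averages of [u]
   on the translates by [s]; Jensen's inequality and Tonelli do the rest. *)
Theorem osc_poisson r u U M a b : 0 <= r < 1 -> a < b -> locl2 u -> locl2 U ->
  (forall t, U t = (2 * pi)^-1 * dint (fun s => poisson r s * u (s + t)) (- pi) pi) ->
  (forall s, osc u (a + s) (b + s) <= M) -> osc U a b <= M.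
Proof.
move=> r01 ab hu hU UE hM; have p0 := @twopi_gt0 R.
pose m s := avg u (a + s) (b + s); pose c := (2 * pi)^-1 * dint (fun s => poisson r s * m s) (- pi) pi.
have cm : continuous m by exact: continuous_avg.
have cP := continuous_poisson r01.
have hP := continuous_locl2 cP; have hm := continuous_locl2 cm.
have L0 : 0 < b - a by rewrite subr_gt0.
pose h (z : R * R) := poisson r z.2 * (u (z.2 + z.1) - m z.2) ^+ 2.
have mh : measurable_fun setT h.
  apply: measurable_funM; first exact: measurableT_comp hP.1 measurable_snd.
  apply: measurable_funX; apply: measurable_funB; last exact: measurableT_comp hm.1 measurable_snd.
  apply: measurableT_comp hu.1 _.
  by apply: measurable_funD; [exact: measurable_snd|exact: measurable_fst].
have h0 z : 0 <= h z by rewrite mulr_ge0 ?sqr_ge0// ltW// poisson_gt0.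
have hw t : locl2 (fun s => u (s + t) - m s) by exact: (locl2B (locl2_shift t hu) hm).
have UcE t : (U t - c) ^+ 2 <= (2 * pi)^-1 * dint (fun s => h (t, s)) (- pi) pi.
  apply: le_trans (jensen_poisson r01 (hw t)).
  rewrite UE /c -mulrBr -dintB; [|exact: (locl2M hP (locl2_shift t hu))|exact: (locl2M hP hm)].
  by under [X in dint X]eq_fun do rewrite -mulrBr.
apply: (le_trans (osc_min c ab hU)).
rewrite mulrC ler_pdivrMr//.
have IUc : locint (fun t => (U t - c) ^+ 2) by case: (locl2B hU (locl2_cst c)).
rewrite -lee_fin /dint /Rintegral fineK; last exact: integrable_fin_num (IUc _ _).
apply: (@le_trans _ _ (\int[mu]_(t in `[a, b]) ((2 * pi)^-1%:E * \int[mu]_(s in `[(- pi)%R, pi]) (h (t, s))%:E))%E).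
  apply: ge0_le_integral => //.
  - by move=> t _; rewrite lee_fin sqr_ge0.
  - by apply: (measurable_int mu); exact: IUc.
  - apply: measurable_funTS; apply: emeasurable_funM => //.
    by apply: measurable_integral_section.
  - move=> t _; apply: (@le_trans _ _ ((2 * pi)^-1 * dint (fun s => h (t, s)) (- pi) pi)%:E).
      by rewrite lee_fin.
    rewrite EFinM /dint /Rintegral fineK//.
    have Ih : locint (fun s => h (t, s)) by exact: (locint_poissonM r01 (hw t).2).
    exact: integrable_fin_num (Ih _ _).
rewrite ge0_integralZl//; first last.
- by rewrite lee_fin invr_ge0 ltW.
- by move=> t _; apply: integral_ge0 => s _; rewrite lee_fin.
- by apply: measurable_funTS; exact: measurable_integral_section.
rewrite tonelli_set//.
have hB s : (\int[mu]_(t in `[a, b]) (h (t, s))%:E <= (poisson r s * (M * (b - a)))%:E)%E.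
  have Iu2 : locint (fun t => (u (t + s) - m s) ^+ 2).
    by case: (locl2B (locl2_shift s hu) (locl2_cst (m s))).
  have -> : (\int[mu]_(t in `[a, b]) (h (t, s))%:E =
      (dint (fun t => poisson r s * (u (t + s) - m s) ^+ 2) a b)%:E)%E.
    rewrite /dint /Rintegral fineK.
      by apply: eq_integral => t _; rewrite /h/= (addrC s).
    by apply: integrable_fin_num => //; exact: (locintZ (poisson r s) Iu2).
  rewrite lee_fin dintZ// ler_pM2l ?poisson_gt0//.
  rewrite -ler_pdivrMr// mulrC; apply: le_trans (hM s).
  suff -> : m s = avg (fun t => u (t + s)) a b by rewrite -osc_shift.
  rewrite /m /avg (dint_shift s a b (locl2_locint hu)).
  by rewrite (_ : b + s - (a + s) = b - a)//; ring.
apply: (@le_trans _ _ ((2 * pi)^-1%:E * (dint (fun s => poisson r s * (M * (b - a))) (- pi) pi)%:E)%E).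
  rewrite lee_wpmul2l ?lee_fin ?invr_ge0 ?(ltW p0)//.
  have IPM : locint (fun s => poisson r s * (M * (b - a))).
    by apply: locint_poissonM => //; exact: locint_cst.
  rewrite /dint /Rintegral fineK; last exact: integrable_fin_num (IPM _ _).
  apply: ge0_le_integral => //.
  - by move=> s _; apply: integral_ge0 => t _; rewrite lee_fin.
  - apply: measurable_funTS.
    have := @measurable_integral_section (fun z => h (z.2, z.1)) `[a, b]; apply => //.
    by apply: (measurableT_comp mh); apply: measurable_fun_pair.
  - by apply: (measurable_int mu); exact: IPM.
have -> : dint (fun s => poisson r s * (M * (b - a))) (- pi) pi = M * (b - a) * (2 * pi).
  rewrite -(dint_poisson r01) -dintZ; last exact: continuous_locint.
  by apply: eq_dint => s _; rewrite mulrC.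
by rewrite -EFinM lee_fin mulrCA mulVf ?mulr1// gt_eqF.
Qed.

End mean_oscillation.

(** * Integrals of functions that agree off a null set *)

Section off_null_set.
Context d (T : measurableType d) {R : realType} (mu : {measure set T -> \bar R}).
Local Open Scope ereal_scope.

Import HBNNSimple.

(** The integral of a nonnegative function is a supremum over simple functions below it, measurable
    or not. A simple function below [F], cut to zero on [N], lies below [G] and keeps its
    integral. *)
Let ge0_integral_le (N : set T) (F G : T -> \bar R) : measurable N -> mu N = 0 ->
  (forall t, 0 <= F t) -> (forall t, 0 <= G t) -> (forall t, ~ N t -> F t = G t) ->
  \int[mu]_t F t <= \int[mu]_t G t.
Proof.
move=> mN N0 F0 G0 FG; rewrite ge0_integralTE// ge0_integralTE//.
apply: ub_ereal_sup => _ [h /= hF <-].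
have mNC := measurableC mN.
pose k : {nnsfun T >-> R} := mul_nnsfun h (indic_nnsfun R mNC).
have kE t : k t = (h t * \1_(~` N) t)%R by [].
apply: ereal_sup_ubound; exists k.
  move=> t; rewrite [X in X%:E]kE indicE; have [Nt|Nt] := pselect (N t).
    by rewrite memNset ?mulr0//=; apply.
  by rewrite mem_set//= mulr1 -FG.
rewrite -!integralT_nnsfun; apply: ae_eq_integral => //.
- by apply/measurable_EFinP.
- by apply/measurable_EFinP.
exists N; split => // t /= ht; apply: contrapT => Nt; apply: ht => _.
by rewrite [X in X%:E]kE indicE mem_set//= mulr1.
Qed.

(* Neither function is assumed measurable: [N] is null for Lebesgue measure on
   Borel sets, which is not complete. *)
Lemma integral_off_null (N D : set T) (F G : T -> \bar R) : measurable N -> mu N = 0 ->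
  (forall t, ~ N t -> F t = G t) -> \int[mu]_(t in D) F t = \int[mu]_(t in D) G t.
Proof.
move=> mN N0 FG; rewrite integral_mkcond [RHS]integral_mkcond.
have FGD t : ~ N t -> (F \_ D) t = (G \_ D) t by move=> Nt; rewrite !patchE FG.
rewrite integralE [RHS]integralE; congr (_ - _); apply/eqP; rewrite eq_le.
  by apply/andP; split; apply: (ge0_integral_le mN) => // t Nt; rewrite !funeposE FGD.
by apply/andP; split; apply: (ge0_integral_le mN) => // t Nt; rewrite !funenegE FGD.
Qed.

End off_null_set.

(** * Interior values as Poisson integrals of the boundary function *)

Section boundary_poisson.
Context {R : realType}.
Variables (U : R -> R -> R) (a b : nat -> R) (u : R -> R).
Hypothesis hU : harmonic U a b.
Hypothesis mu_ : measurable_fun setT u.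
Hypothesis U_cvg : forall e, 0 < e -> exists2 r0, 0 < r0 < 1 & forall r, r0 <= r -> r < 1 ->
  locint (fun t => (u t - U r t) ^+ 2) /\
  forall x, dint (fun t => (u t - U r t) ^+ 2) x (x + 2 * pi) <= e.

Lemma locl2_diff r : 0 < r < 1 -> locl2 (fun t => u t - U r t).
Proof.
have [r0 /andP[r00 r01] hr] := U_cvg (@ltr01 R).
have hu : locl2 u.
  have c0 := continuous_locl2 (harmonic_continuous hU (introT andP (conj r00 r01))).
  have h1 : locl2 (fun t => u t - U r0 t).
    split; first exact: measurable_funB c0.1.
    by case: (hr r0 (lexx _) r01).
  by have := locl2D h1 c0; under eq_fun do rewrite subrK.
by move=> r1; apply: (locl2B hu (continuous_locl2 (harmonic_continuous hU r1))).
Qed.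

Lemma boundary_locl2 : locl2 u.
Proof.
have h12 : 0 < (1 / 2 : R) < 1 by apply/andP; split; lra.
have := locl2D (locl2_diff h12) (continuous_locl2 (harmonic_continuous hU h12)).
by under [X in locl2 X -> _]eq_fun do rewrite subrK.
Qed.

(** Let [s] tend to [1] in [U (r * s) = P_r * U s]. The left side is continuous in the radius; on
    the right, Jensen's inequality and the bound [K] of the kernel reduce the error to the L^2
    distance of [U s] to [u], taken below [(e / 2)^2 / K]. *)
Lemma boundary_poisson r t : 0 < r < 1 ->
  U r t = (2 * pi)^-1 * dint (fun s => poisson r s * u (s + t)) (- pi) pi.
Proof.
move=> r01; have /andP[r0 r1] := r01; have r01' : 0 <= r < 1 by rewrite ltW.
have p0 := @twopi_gt0 R.
set K := (1 - r ^+ 2) / (1 - r) ^+ 2.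
have K0 : 0 < K by rewrite divr_gt0 ?sqr_lt1// exprn_gt0// subr_gt0.
set Pu := _ * _; apply/eqP; rewrite -subr_eq0 -normr_le0; apply/ler_addgt0Pr => e e0.
rewrite add0r.
have e20 : 0 < e / 2 by rewrite divr_gt0.
have /cvgrPdist_le/(_ _ e20)[d /= d0 hd] := harmonic_continuous_radius hU (t := t) r01.
have [s0 /andP[s00 s01] hs] := U_cvg (divr_gt0 (exprn_gt0 2 e20) K0).
pose d' := Num.min d 1.
have d'0 : 0 < d' by rewrite lt_min d0 ltr01.
pose s := Num.max s0 (1 - d' / 2).
have s0s : s0 <= s by rewrite le_max lexx.
have s1 : s < 1 by rewrite gt_max s01/= gtrBl divr_gt0.
have sd : 1 - s < d.
  have h1 : 1 - d' / 2 <= s by rewrite le_max lexx orbT.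
  by have h2 : d' <= d by [rewrite ge_min lexx]; lra.
have s01' : 0 < s < 1 by rewrite (lt_le_trans s00).
have [Iw hw] := hs s s0s s1.
rewrite (le_trans (ler_distD (U (r * s) t) _ _))// [leRHS](splitr e) lerD//.
  apply: hd => /=; rewrite -[X in X - _]mulr1 -mulrBr normrM.
  rewrite !gtr0_norm ?subr_gt0//; nra.
have cs := harmonic_continuous hU s01'.
rewrite -(harmonic_semigroup hU _ s01' r01) pconvE//; last first.
  by move=> x; exact: harmonic_periodic hU _ _ s01'.
have hv : locl2 (fun x => U s (x + t)) by apply: locl2_shift; exact: continuous_locl2.
have hu : locl2 (fun x => u (x + t)) by apply: locl2_shift; exact: boundary_locl2.
have hP : locl2 (poisson r) by apply: continuous_locl2; exact: continuous_poisson.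
rewrite /Pu -mulrBr -dintB; [|exact: locl2M|exact: locl2M].
under [X in dint X]eq_fun do rewrite -mulrBr.
have hw2 := locl2B hv hu.
rewrite -(ler_pXn2r (n := 2)) ?nnegrE ?(ltW e20)// -normrX ger0_norm ?sqr_ge0//.
apply: le_trans (jensen_poisson r01' hw2) _.
have hd2 : dint (fun x => poisson r x * (U s (x + t) - u (x + t)) ^+ 2) (- pi) pi <=
    K * ((e / 2) ^+ 2 / K).
  have I2 := locl2_diff s01'.
  have h3 : (fun x => (U s (x + t) - u (x + t)) ^+ 2) = (fun x => (u (x + t) - U s (x + t)) ^+ 2).
    by apply/funext => x; rewrite -sqrrN opprB.
  apply: (@le_trans _ _ (K * dint (fun x => (u (x + t) - U s (x + t)) ^+ 2) (- pi) pi)).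
    have I3 := locint_shift t I2.2.
    rewrite -dintZ//; apply: ler_dint.
    - by apply: (locint_poissonM r01'); rewrite h3.
    - exact: locintZ.
    - move=> x _; rewrite -sqrrN opprB ler_wpM2r ?sqr_ge0//; exact: poisson_le.
  rewrite ler_pM2l// (dint_shift t (- pi) pi I2.2).
  have := hw (- pi + t); rewrite (_ : - pi + t + 2 * pi = pi + t)//; ring.
rewrite mulrCA divff ?mulr1 in hd2; last exact: lt0r_neq0.
apply: (@le_trans _ _ ((2 * pi)^-1 * (e / 2) ^+ 2)).
  by rewrite ler_wpM2l// invr_ge0 ltW.
rewrite ler_piMl ?sqr_ge0// invf_le1//; have := @pi_ge2 R; lra.
Qed.

End boundary_poisson.

(** * Mean oscillation of quaternion valued functions *)

Section quaternion_oscillation.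
Context {R : realType}.
Local Notation H := (quat R).
Local Notation mu := (@lebesgue_measure R).
Implicit Types (g k : R -> H) (w x y c : H) (a b e : R).

Lemma linE w x : lin w x =
  qre w * qre x - qi w * qi x - qj w * qj x - qk w * qk x.
Proof. by []. Qed.

Definition qlocl2 g := forall w, locl2 (fun t => lin w (g t)).

Lemma qlocl2P g : locl2 (fun t => qre (g t)) -> locl2 (fun t => qi (g t)) ->
  locl2 (fun t => qj (g t)) -> locl2 (fun t => qk (g t)) -> qlocl2 g.
Proof.
move=> h1 h2 h3 h4 w; under eq_fun do rewrite linE.
by do 3 (apply: locl2B; last exact: locl2Z); exact: locl2Z.
Qed.

Lemma qlocl2_cst c : qlocl2 (fun=> c).
Proof. by move=> w; exact: locl2_cst. Qed.

Lemma continuous_qlocl2 g : continuous g -> qlocl2 g.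
Proof.
move=> cg w; apply: continuous_locl2 => t.
by apply: (@continuous_comp _ _ _ g (lin w)); [exact: cg|exact: continuous_lin].
Qed.

Lemma qlocl2D g k : qlocl2 g -> qlocl2 k -> qlocl2 (fun t => g t + k t).
Proof. by move=> hg hk w; under eq_fun do rewrite linD; exact: locl2D. Qed.

Lemma qlocl2B g k : qlocl2 g -> qlocl2 k -> qlocl2 (fun t => g t - k t).
Proof. by move=> hg hk w; under eq_fun do rewrite linB; exact: locl2B. Qed.

Lemma qlocl2_mull c g : qlocl2 g -> qlocl2 (fun t => c * g t).
Proof. by move=> hg w; under eq_fun do rewrite lin_mul; exact: hg. Qed.

(** The real part of a product is invariant under cyclic permutation of the factors. *)
Lemma lin_mulr w x c : lin w (x * c) = lin (c * w) x.
Proof. by rewrite /lin /=; ring. Qed.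

Lemma qlocl2_mulr c g : qlocl2 g -> qlocl2 (fun t => g t * c).
Proof. by move=> hg w; under eq_fun do rewrite lin_mulr; exact: hg. Qed.

Lemma qlocl2_norm g : qlocl2 g -> locint (fun t => `|g t| ^+ 2).
Proof.
move=> hg; under eq_fun do rewrite sqr_qnorm_lin.
by apply: locint_sum => n; case: (hg (qbasis n)).
Qed.

Lemma dint_qnorm g a b : qlocl2 g ->
  dint (fun t => `|g t| ^+ 2) a b = \sum_(n < 4) dint (fun t => lin (qbasis n) (g t) ^+ 2) a b.
Proof.
move=> hg; under [X in dint X]eq_fun do rewrite sqr_qnorm_lin.
by rewrite dint_sum// => n; case: (hg (qbasis n)).
Qed.

Definition qavg g a b : H := Quat (avg (fun t => qre (g t)) a b)
  (avg (fun t => qi (g t)) a b) (avg (fun t => qj (g t)) a b) (avg (fun t => qk (g t)) a b).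

Definition qosc g a b : R := (b - a)^-1 * dint (fun t => `|g t - qavg g a b| ^+ 2) a b.

Lemma lin_qavg n g a b : lin (qbasis n) (qavg g a b) = avg (fun t => lin (qbasis n) (g t)) a b.
Proof.
case: n => [[|[|[|[|n]]]] hn] //; rewrite /qbasis/= ?lin1 ?linI ?linJ ?linK /=;
  by under [in RHS]eq_fun do rewrite ?lin1 ?linI ?linJ ?linK.
Qed.

(** Averages are taken coordinatewise and the squared norm is the sum of four squares; this is the
    passage to the real theory. *)
Lemma qosc_sum g a b : qlocl2 g ->
  qosc g a b = \sum_(n < 4) osc (fun t => lin (qbasis n) (g t)) a b.
Proof.
move=> hg; rewrite /qosc dint_qnorm; last exact: qlocl2B (qlocl2_cst _).
rewrite mulr_sumr; apply: eq_bigr => n _; congr (_ * _).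
by apply: eq_dint => t _; rewrite linB lin_qavg.
Qed.

Lemma qosc_ge0 g a b : a <= b -> 0 <= qosc g a b.
Proof.
move=> ab; rewrite mulr_ge0 ?invr_ge0 ?subr_ge0//.
by apply: dint_ge0 => t _; exact: sqr_ge0.
Qed.

Lemma osc_le_qosc n g a b : a <= b -> qlocl2 g ->
  osc (fun t => lin (qbasis n) (g t)) a b <= qosc g a b.
Proof.
move=> ab hg; rewrite qosc_sum// (bigD1 n)//= lerDl sumr_ge0// => m _.
exact: osc_ge0.
Qed.

Lemma qosc_min c g a b : a < b -> qlocl2 g ->
  qosc g a b <= (b - a)^-1 * dint (fun t => `|g t - c| ^+ 2) a b.
Proof.
move=> ab hg; rewrite qosc_sum// dint_qnorm; last exact: qlocl2B (qlocl2_cst _).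
rewrite mulr_sumr; apply: ler_sum => n _.
by under [X in _ * dint X _ _]eq_fun do rewrite linB; exact: osc_min.
Qed.

Lemma qosc_le c e g k a b : a < b -> qlocl2 g -> qlocl2 k ->
  (forall t, a <= t <= b -> `|g t - c| ^+ 2 <= e * `|k t - qavg k a b| ^+ 2) ->
  qosc g a b <= e * qosc k a b.
Proof.
move=> ab hg hk h; apply: (le_trans (qosc_min c ab hg)).
rewrite /qosc mulrCA ler_pM2l ?invr_gt0 ?subr_gt0//.
have I1 := qlocl2_norm (qlocl2B hk (qlocl2_cst (qavg k a b))).
rewrite -dintZ//; apply: ler_dint => //; last exact: locintZ.
exact: qlocl2_norm (qlocl2B hg (qlocl2_cst c)).
Qed.

Lemma qosc_bound c e g a b : a < b -> qlocl2 g ->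
  (forall t, a <= t <= b -> `|g t - c| ^+ 2 <= e) -> qosc g a b <= e.
Proof.
move=> ab hg h; apply: (le_trans (qosc_min c ab hg)).
have ab0 : 0 < b - a by rewrite subr_gt0.
rewrite mulrC ler_pdivrMr// -dint_cst; last exact: ltW.
apply: ler_dint => //; last exact: locint_cst.
exact: qlocl2_norm (qlocl2B hg (qlocl2_cst c)).
Qed.

Lemma sqr_normD x y : `|x + y| ^+ 2 <= 2 * `|x| ^+ 2 + 2 * `|y| ^+ 2.
Proof.
have h := ler_normD x y; have h0 := normr_ge0 (x + y).
have h1 : `|x + y| ^+ 2 <= (`|x| + `|y|) ^+ 2 by rewrite lerXn2r ?nnegrE ?addr_ge0.
by apply: (le_trans h1); have := sqr_ge0 (`|x| - `|y|); nra.
Qed.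

Lemma dint_le2 (A B C : R -> R) a b : locint A -> locint B -> locint C ->
  (forall t, C t <= 2 * A t + 2 * B t) -> dint C a b <= 2 * dint A a b + 2 * dint B a b.
Proof.
move=> IA IB IC h; rewrite -(dintZ 2 a b IA) -(dintZ 2 a b IB).
rewrite -(dintD a b (locintZ 2 IA) (locintZ 2 IB)).
by apply: ler_dint => //; apply: locintD; exact: locintZ.
Qed.

Lemma qoscD g k a b : a < b -> qlocl2 g -> qlocl2 k ->
  qosc (fun t => g t + k t) a b <= 2 * qosc g a b + 2 * qosc k a b.
Proof.
move=> ab hg hk; apply: (le_trans (qosc_min (qavg g a b + qavg k a b) ab (qlocl2D hg hk))).
have I1 := qlocl2_norm (qlocl2B hg (qlocl2_cst (qavg g a b))).
have I2 := qlocl2_norm (qlocl2B hk (qlocl2_cst (qavg k a b))).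
have L0 : 0 <= (b - a)^-1 by rewrite invr_ge0 subr_ge0 ltW.
rewrite /qosc [leRHS](_ : _ = (b - a)^-1 * (2 * dint (fun t => `|g t - qavg g a b| ^+ 2) a b +
  2 * dint (fun t => `|k t - qavg k a b| ^+ 2) a b)); last by rewrite mulrDr; congr (_ + _); exact: mulrCA.
apply: (ler_wpM2l L0).
apply: (dint_le2 a b I1 I2); first exact: qlocl2_norm (qlocl2B (qlocl2D hg hk) (qlocl2_cst _)).
by move=> t; rewrite opprD addrACA; exact: sqr_normD.
Qed.

Lemma qosc_mull c g a b : a < b -> qlocl2 g ->
  qosc (fun t => c * g t) a b <= `|c| ^+ 2 * qosc g a b.
Proof.
move=> ab hg; apply: (qosc_le (c := c * qavg g a b)) => //; first exact: qlocl2_mull.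
by move=> t _; rewrite -mulrBr qnormM exprMn.
Qed.

Lemma qosc_mulr c g a b : a < b -> qlocl2 g ->
  qosc (fun t => g t * c) a b <= `|c| ^+ 2 * qosc g a b.
Proof.
move=> ab hg; apply: (qosc_le (c := qavg g a b * c)) => //; first exact: qlocl2_mulr.
by move=> t _; rewrite -mulrBl qnormM exprMn mulrC.
Qed.

Lemma qosc_eq g k a b : (forall t, g t = k t) -> qosc g a b = qosc k a b.
Proof. by move=> /funext ->. Qed.

Lemma qoscN g a b : a < b -> qlocl2 g -> qosc (fun t => - g t) a b <= qosc g a b.
Proof.
move=> ab hg; have := qosc_mull (-1) ab hg.
have -> : `|-1 : H| = 1 by rewrite normrN; exact: (norm_qbasis ord0).
rewrite expr1n mul1r; apply: le_trans.
by rewrite (@qosc_eq _ (fun t => -1 * g t))// => t; rewrite mulN1r.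
Qed.

Lemma qoscB g k a b : a < b -> qlocl2 g -> qlocl2 k ->
  qosc (fun t => g t - k t) a b <= 2 * qosc g a b + 2 * qosc k a b.
Proof.
move=> ab hg hk.
have hk' : qlocl2 (fun t => - k t).
  by move=> w; have := qlocl2_mull (-1) hk w; under eq_fun do rewrite mulN1r.
apply: (le_trans (qoscD ab hg hk')); apply: lerD; first exact: lexx.
by apply: ler_wpM2l; [exact: ler0n|exact: qoscN].
Qed.

End quaternion_oscillation.

(** * Boundary values of slice hyperholomorphic functions *)

Section boundary_values.
Context {R : realType}.
Local Notation H := (quat R).
Local Notation mu := (@lebesgue_measure R).
Implicit Types (f : H -> H) (i : H) (g : R -> H).

Lemma cvg_quat (T : Type) (F : set_system T) {FF : Filter F} (h : T -> H) (l : H) :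
  (forall n, lin (qbasis n) (h x) @[x --> F] --> lin (qbasis n) l) -> h x @[x --> F] --> l.
Proof.
move=> hl; apply/cvgrPdist_le => e e0; have e20 : 0 < e / 2 by rewrite divr_gt0.
have : \forall x \near F, forall n : 'I_4, `|lin (qbasis n) l - lin (qbasis n) (h x)| <= e / 2.
  apply: filter_forall => n.
  by have /cvgrPdist_le/(_ _ e20) := hl n.
apply: filterS => x hx.
rewrite -(ler_pXn2r (n := 2)) ?nnegrE ?(ltW e0)// sqr_qnorm_lin.
have h2 n : lin (qbasis n) (l - h x) ^+ 2 <= (e / 2) ^+ 2.
  by rewrite linB -[leLHS]real_normK ?num_real// lerXn2r ?nnegrE// ltW.
apply: (le_trans (ler_sum _ (fun n _ => h2 n))).
by rewrite sumr_const card_ord -mulr_natr; lra.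
Qed.

(** [boundary] is a [lim], with an arbitrary value where there is no radial limit, and it is not
    known to be measurable. [g] is a locally square integrable version that agrees with it off a
    Borel null set; [oscillationE] computes all oscillations through it. *)
Definition radial_boundary f i g := qlocl2 g /\ exists N, [/\ measurable N, mu N = 0%E &
  forall t, ~ N t -> f (r *: qcis i t) @[r --> 1^'-] --> g t].

Section radial_boundary.
Variables (f : H -> H) (i : H) (g : R -> H).
Hypothesis hg : radial_boundary f i g.

Let Rintegral_boundary (p : H -> R) a b : locl2 (fun t => p (g t)) ->
  \int[mu]_(t in `]a, b[) p (boundary f i t) = dint (fun t => p (g t)) a b.
Proof.
have [_ [N [mN N0 hN]]] := hg => -[mp _].
rewrite /dint /Rintegral; congr fine.
rewrite -integral_oo_cc; last exact/measurable_EFinP.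
apply: (@integral_off_null _ _ R mu N `]a, b[%classic (fun t => (p (boundary f i t))%:E)
  (fun t => (p (g t))%:E) mN N0) => t Nt.
by rewrite /boundary (cvg_lim _ (hN t Nt)).
Qed.

Lemma average_boundary a b : average f i a b = qavg g a b.
Proof.
have [hl _] := hg.
have h1 : locl2 (fun t => qre (g t)) by have := hl 1; under eq_fun do rewrite lin1.
have h2 : locl2 (fun t => qi (g t)) by have := hl (- qI); under eq_fun do rewrite linI.
have h3 : locl2 (fun t => qj (g t)) by have := hl (- qJ); under eq_fun do rewrite linJ.
have h4 : locl2 (fun t => qk (g t)) by have := hl (- qK); under eq_fun do rewrite linK.
rewrite /average /qRintegral.
by apply: quatP => /=; rewrite Rintegral_boundary.
Qed.

Lemma oscillationE a b : oscillation f i a b = (qosc g a b)%:E.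
Proof.
have [hl [N [mN N0 hN]]] := hg.
have I1 := qlocl2_norm (qlocl2B hl (qlocl2_cst (qavg g a b))).
rewrite /oscillation average_boundary /qosc EFinM; congr (_ * _)%E.
transitivity (\int[mu]_(t in `[a, b]) (`|g t - qavg g a b| ^+ 2)%:E)%E.
  rewrite -integral_oo_cc; last by apply/measurable_EFinP; exact: locint_measurable.
  apply: (@integral_off_null _ _ R mu N `]a, b[%classic
    (fun t => (`|boundary f i t - qavg g a b| ^+ 2)%:E)
    (fun t => (`|g t - qavg g a b| ^+ 2)%:E) mN N0) => t Nt.
  by rewrite /boundary (cvg_lim _ (hN t Nt)).
by rewrite /dint /Rintegral fineK//; exact: integrable_fin_num (I1 _ _).
Qed.

End radial_boundary.

Lemma radial_boundaryD f k i g h : radial_boundary f i g -> radial_boundary k i h ->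
  radial_boundary (f \+ k) i (fun t => g t + h t).
Proof.
move=> [hg [N [mN N0 hN]]] [hh [M [mM M0 hM]]]; split; first exact: qlocl2D.
exists (N `|` M); split; [exact: measurableU|exact: null_set_setU|].
by move=> t /not_orP[Nt Mt]; apply: cvgD; [exact: hN|exact: hM].
Qed.

Lemma radial_boundary_mulr f i g c : radial_boundary f i g ->
  radial_boundary (fun x => f x * c) i (fun t => g t * c).
Proof.
move=> [hg [N [mN N0 hN]]]; split; first exact: qlocl2_mulr.
exists N; split => // t Nt; apply: cvg_quat => n; rewrite lin_mulr.
under eq_fun do rewrite lin_mulr.
by apply: (continuous_cvg _ (@continuous_lin _ _ _)); exact: hN.
Qed.

Lemma radial_boundaryB f k i g h : radial_boundary f i g -> radial_boundary k i h ->
  radial_boundary (f \- k) i (fun t => g t - h t).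
Proof.
move=> [hg [N [mN N0 hN]]] [hh [M [mM M0 hM]]]; split; first exact: qlocl2B.
exists (N `|` M); split; [exact: measurableU|exact: null_set_setU|].
by move=> t /not_orP[Nt Mt]; apply: cvgB; [exact: hN|exact: hM].
Qed.

Definition circle2 f i r : R := dint (fun t => `|f (r *: qcis i t)| ^+ 2) 0 (2 * pi).

Section slice.
Variables (f : H -> H) (i : H).
Hypothesis fSH : slice_hyperholomorphic R f.
Hypothesis ui : imag_units R i.

Lemma continuous_circle r : 0 <= r < 1 -> continuous (fun t => f (r *: qcis i t)).
Proof.
move=> /andP[r0 r1] t; apply: cvg_quat => n.
have r1' : `|r| < 1 by rewrite ger0_norm.
exact: (continuous_radial fSH ui (w' := qbasis n) r1').
Qed.

Lemma circle2_sum r : 0 <= r < 1 ->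
  circle2 f i r = \sum_(n < 4) norm2 (radial f i (qbasis n)) r.
Proof.
by move=> r01; rewrite /circle2 dint_qnorm//; apply: continuous_qlocl2; exact: continuous_circle.
Qed.

Lemma circle_meanE r : 0 <= r < 1 -> circle_mean f i r = ((2 * pi)^-1 * circle2 f i r)%:E.
Proof.
move=> r01; rewrite /circle_mean EFinM; congr (_ * _)%E.
have I1 := qlocl2_norm (continuous_qlocl2 (continuous_circle r01)).
by rewrite /circle2 /dint /Rintegral fineK//; exact: integrable_fin_num (I1 _ _).
Qed.

Lemma circle2_mono r s : 0 < r -> r <= s -> s < 1 -> circle2 f i r <= circle2 f i s.
Proof.
move=> r0 rs s1; rewrite !circle2_sum; last 2 first.
- by rewrite (le_trans (ltW r0) rs).
- by rewrite (ltW r0) (le_lt_trans rs).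
apply: ler_sum => n _; by apply: norm2_mono r0 rs s1; exact: slice_harmonic.
Qed.

Section bounded.
Variable C : R.
Hypothesis hC : forall r, 0 < r < 1 -> circle2 f i r <= C.

(** [boundary_function] is applied to each of the four coordinates; the null sets are united, the
    largest of the four radii is taken, and each coordinate contributes [e / 4]. *)
Theorem hardy_boundary : exists g, [/\ radial_boundary f i g,
  forall n r t, 0 < r < 1 -> radial f i (qbasis n) r t =
    (2 * pi)^-1 * dint (fun s => poisson r s * lin (qbasis n) (g (s + t))) (- pi) pi &
  forall e, 0 < e -> exists2 r0, 0 < r0 < 1 & forall r, r0 <= r -> r < 1 ->
    forall x, dint (fun t => `|g t - f (r *: qcis i t)| ^+ 2) x (x + 2 * pi) <= e].
Proof.
have hn n r : 0 < r < 1 -> norm2 (radial f i (qbasis n)) r <= C.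
  move=> r01; apply: le_trans (hC r01); have /andP[r0 r1] := r01.
  rewrite circle2_sum ?(ltW r0)// (bigD1 n)//= lerDl sumr_ge0// => m _.
  by apply: dint_ge0 => t _; exact: sqr_ge0.
have hb n := boundary_function (slice_harmonic fSH ui (qbasis n)) (hn n).
have [N /(_ _)/cid-/all_sig[u hu]] := choice hb.
have h1 n : locl2 (u n).
  have [_ _ mu_ _ ucvg] := hu n.
  exact: boundary_locl2 (slice_harmonic fSH ui (qbasis n)) mu_ ucvg.
pose o n (h : (n < 4)%N) : 'I_4 := Ordinal h.
pose g t := Quat (u (@o 0 isT) t) (u (@o 1 isT) t) (u (@o 2 isT) t) (u (@o 3 isT) t).
have gE n t : lin (qbasis n) (g t) = u n t.
  by case: n => [[|[|[|[|n]]]] hn'] //; rewrite /qbasis/= ?lin1 ?linI ?linJ ?linK /g/=;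
    congr (u _ _); exact: val_inj.
have hg : qlocl2 g by apply: qlocl2P; exact: h1.
exists g; split.
- have [mS S0] : measurable (\big[setU/set0]_(n < 4) N n) /\ mu (\big[setU/set0]_(n < 4) N n) = 0%E.
    elim/big_ind: _ => [|A B [mA A0] [mB B0]|n _]; last by case: (hu n).
      by split; [exact: measurable0|exact: measure0].
    by split; [exact: measurableU|exact: null_set_setU].
  split=> //; exists (\big[setU/set0]_(n < 4) N n); split => //.
  + move=> t Nt; apply: cvg_quat => n; rewrite gE.
    have [_ _ _ ul _] := hu n; apply: ul => Nn; apply: Nt.
    by rewrite (bigD1 n)//=; left.
- move=> n r t r01; have [_ _ mu_ _ ucvg] := hu n.
  rewrite (boundary_poisson (slice_harmonic fSH ui (qbasis n)) mu_ ucvg t r01).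
  by congr (_ * _); apply: eq_dint => s _; rewrite gE.
move=> e e0; have e40 : 0 < e / 4 by rewrite divr_gt0.
have hr n : exists r0, 0 < r0 < 1 /\ forall r, r0 <= r -> r < 1 -> forall x,
    dint (fun t => (u n t - radial f i (qbasis n) r t) ^+ 2) x (x + 2 * pi) <= e / 4.
  have [_ _ _ _ ucvg] := hu n; have [r0 r01 hr] := ucvg _ e40.
  by exists r0; split => // r r0r r1; case: (hr r r0r r1).
have [rho hrho] := choice hr.
pose r0 := \big[Order.max/(1 / 2)]_(n < 4) rho n.
exists r0.
  rewrite /r0; elim/big_ind: _ => [|x y /andP[x0 x1] /andP[y0 y1]|n _]; last by case: (hrho n).
    by apply/andP; split; lra.
  by rewrite lt_max x0 gt_max x1.
move=> r r0r r1 x.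
have hr0 n : rho n <= r by apply: le_trans r0r; exact: le_bigmax.
have r01 : 0 <= r < 1.
  by have [/andP[h _] _] := hrho ord0; rewrite r1 andbT (le_trans (ltW h)).
rewrite dint_qnorm; last first.
  by apply: qlocl2B => //; apply: continuous_qlocl2; exact: continuous_circle.
rewrite [leRHS](_ : e = \sum_(n < 4) e / 4); last by rewrite sumr_const card_ord -mulr_natr; field.
apply: ler_sum => n _; have [_ h] := hrho n.
by under [X in dint X _ _]eq_fun do rewrite linB gE; exact: h.
Qed.

End bounded.
End slice.

(** A [lim] carries information only once convergence is known. A nondecreasing [V] either is
    bounded and converges, or tends to [+oo]; the second case contradicts a finite bound on the
    limit. *)
Lemma nondecreasing_left_lim (V : R -> R) (M : R) (phi : R -> \bar R) :
  (forall r s, 0 < r -> r <= s -> s < 1 -> V r <= V s) ->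
  (forall r, 0 < r < 1 -> phi r = (V r)%:E) ->
  ((lim (phi r @[r --> 1^'-]) <= M%:E)%E <-> forall r, 0 < r < 1 -> V r <= M).
Proof.
move=> Vm phiE.
have near01 (s : R) : s < 1 -> \forall r \near (1 : R)^'-, s < r < 1 by move=> s1; near=> r; apply/andP.
have phiV : {near 1^'-, (fun r => (V r)%:E) =1 phi}.
  by have := near01 _ (@ltr01 R); apply: filterS => r /phiE.
have bounded B : (forall r, 0 < r < 1 -> V r <= B) ->
    exists l, [/\ V r @[r --> 1^'-] --> l & lim (phi r @[r --> 1^'-]) = l%:E].
  move=> hB.
  have cV : cvg (V r @[r --> 1^'-]).
    apply: nondecreasing_at_left_is_cvgr.
      have := near01 _ (@ltr01 R); apply: filterS => x /andP[x0 _] y z.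
      rewrite !in_itv/= => /andP[xy _] /andP[_ z1] yz.
      by apply: Vm => //; exact: lt_trans xy.
    have := near01 _ (@ltr01 R); apply: filterS => x /andP[x0 _].
    exists B => _ [y /= yx <-]; move: yx; rewrite in_itv/= => /andP[xy y1].
    by apply: hB; rewrite y1 (lt_trans x0).
  exists (lim (V r @[r --> 1^'-])); split=> //.
  apply: cvg_lim => //; apply: cvg_trans (near_eq_cvg phiV) _.
  by apply/fine_cvgP; split; [exact: nearW|exact: cV].
split=> [hl|hM]; last first.
  have [l [Vl ->]] := bounded M hM; rewrite lee_fin.
  rewrite -(cvg_lim _ Vl)//; apply: limr_le; first by apply/cvg_ex; exists l.
  by have := near01 _ (@ltr01 R); apply: filterS => r; exact: hM.
have [[B hB]|unb] := pselect (exists B, forall r, 0 < r < 1 -> V r <= B).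
  have [l [Vl lE]] := bounded B hB; move: hl; rewrite lE lee_fin => lM r /andP[r0 r1].
  apply: le_trans lM; rewrite -(cvg_lim _ Vl)//.
  apply: limr_ge; first by apply/cvg_ex; exists l.
  have := near01 _ r1; apply: filterS => s /andP[rs s1].
  by apply: Vm => //; exact: ltW.
have /cvg_lim lE : phi r @[r --> 1^'-] --> +oo%E.
  apply: cvg_trans (near_eq_cvg phiV) _; apply/cvgeyPge => B.
  have [r [r01 rB]] : exists r, 0 < r < 1 /\ B < V r.
    apply: contrapT => nB; apply: unb; exists B => r r01; rewrite leNgt; apply/negP => rB.
    by apply: nB; exists r.
  have /andP[r0 r1] := r01.
  have := near01 _ r1; apply: filterS => s /andP[rs s1]; rewrite lee_fin.
  by apply: (le_trans (ltW rB)); apply: Vm => //; exact: ltW.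
by move: hl; rewrite lE.
Unshelve. all: by end_near. Qed.

Lemma lim_circle_mean f i M : slice_hyperholomorphic R f -> imag_units R i ->
  ((lim (circle_mean f i r @[r --> 1^'-]) <= M%:E)%E <->
    forall r, 0 < r < 1 -> (2 * pi)^-1 * circle2 f i r <= M).
Proof.
move=> fSH ui; apply: nondecreasing_left_lim.
  move=> r s r0 rs s1; apply: ler_wpM2l; first by rewrite invr_ge0 ltW// twopi_gt0.
  exact: circle2_mono.
by move=> r /andP[r0 r1]; rewrite circle_meanE// (ltW r0).
Qed.

(** Circle integrals increase with the radius, so a finite supremum of their limits is the same as
    one constant bounding them all. *)
Lemma hardy2P f : hardy2 R f <-> slice_hyperholomorphic R f /\
  exists C, forall i r, imag_units R i -> 0 < r < 1 -> circle2 f i r <= C.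
Proof.
have p0 := @twopi_gt0 R.
have sup_le (A : set (\bar R)) (x : \bar R) : A x -> (x <= ereal_sup A)%E by exact: ereal_sup_ubound.
split=> [[fSH hf]|[fSH [C hC]]]; split=> //.
  have [M hM] : exists M : R, forall i, imag_units R i ->
      (lim (circle_mean f i r @[r --> 1^'-]) <= M%:E)%E.
    move: hf; set S := ereal_sup _ => Sy.
    have hS i : imag_units R i -> (lim (circle_mean f i r @[r --> 1^'-]) <= S)%E.
      by move=> ui; apply: sup_le; exists i.
    case: S Sy hS => [M _ h|//|_ h]; first by exists M.
    by exists 0 => i /h; rewrite leeNy_eq => /eqP ->; rewrite leNye.
  exists (2 * pi * M) => i r ui r01.
  by rewrite -ler_pdivrMl//; apply: (lim_circle_mean M fSH ui).1 => //; exact: hM.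
apply: (@le_lt_trans _ _ ((2 * pi)^-1 * C)%:E); last exact: ltry.
apply: ge_ereal_sup => _ [i ui <-]; apply/(lim_circle_mean _ fSH ui) => r r01.
by apply: ler_wpM2l; [rewrite invr_ge0 ltW|exact: hC].
Qed.

End boundary_values.

(** * Derivatives of products and rescalings *)

Section differentiability.
Context {R : realType}.
Local Notation H := (quat R).
Implicit Types (x y c : H).

(** The product under a name of its own, so that it can be declared bilinear and differentiated by
    the rule for continuous bilinear maps. *)
Definition qprod (x y : H) : H := x * y.

Lemma qprod_is_bilinear :
  bilinear_for
    (GRing.Scale.Law.clone _ _ *:%R _) (GRing.Scale.Law.clone _ _ *:%R _) qprod.
Proof.
split=> [u'|u] a x y; rewrite /qprod /=.
- by rewrite mulrDl scalerAl.
- by rewrite mulrDr scalerAr.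
Qed.
HB.instance Definition _ := bilinear_isBilinear.Build R H H H _ _ qprod qprod_is_bilinear.

Lemma qmul_continuous : continuous (fun p : H * H => p.1 * p.2).
Proof.
move=> p; apply: cvg_quat => n.
have E (q : H * H) : lin (qbasis n) (q.1 * q.2) =
    lin (qbasis n) q.1 * lin 1 q.2 - lin (- qI * qbasis n) q.1 * lin (- qI) q.2
    - lin (- qJ * qbasis n) q.1 * lin (- qJ) q.2 - lin (- qK * qbasis n) q.1 * lin (- qK) q.2.
  by rewrite lin_mul linE !lin1 !linI !linJ !linK -!(linI, linJ, linK) !lin_mul.
rewrite E; under eq_fun do rewrite E.
have c1 w : lin w q.1 @[q --> p] --> lin w p.1.
  by apply: (continuous_cvg _ (@continuous_lin _ w _)); exact: cvg_fst.
have c2 w : lin w q.2 @[q --> p] --> lin w p.2.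
  by apply: (continuous_cvg _ (@continuous_lin _ w _)); exact: cvg_snd.
by do 3 (apply: cvgB; last exact: cvgM); exact: cvgM.
Qed.

Lemma differentiable_qmul (f g : H -> H) x : differentiable f x -> differentiable g x ->
  differentiable (fun y => f y * g y) x.
Proof.
move=> df dg.
apply: (@differentiable_comp _ _ _ _ (fun y => (f y, g y)) (fun p : H * H => p.1 * p.2)).
  exact: differentiable_pair.
exact: (@differentiable_bilin R H H H qprod (f x, g x) qmul_continuous).
Qed.

Lemma is_derive_limit (g : R -> H) u l :
  h^-1 *: (g (h + u) - g u) @[h --> (0 : R)^'] --> l -> is_derive u (1 : R) g l.
Proof.
move=> hl.
have E : (fun h : R => h^-1 *: ((g \o shift u) (h *: (1 : R)) - g u)) =
    (fun h => h^-1 *: (g (h + u) - g u)).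
  by apply/funext => h /=; rewrite [h *: (1 : R)]mulr1.
split; first by rewrite /derivable E; apply/cvg_ex; exists l.
by rewrite /derive E; exact: cvg_lim.
Qed.

Lemma limit_is_derive (g : R -> H) u l : is_derive u (1 : R) g l ->
  h^-1 *: (g (h + u) - g u) @[h --> (0 : R)^'] --> l.
Proof.
move=> [dg <-].
have E : (fun h : R => h^-1 *: ((g \o shift u) (h *: (1 : R)) - g u)) =
    (fun h => h^-1 *: (g (h + u) - g u)).
  by apply/funext => h /=; rewrite [h *: (1 : R)]mulr1.
by rewrite -E; exact: dg.
Qed.

Lemma is_derive_scale (g : R -> H) u l : is_derive u (1 : R) g l ->
  is_derive u (1 : R) (fun t => t *: g t) (g u + u *: l).
Proof.
move=> dg; apply: is_derive_limit.
have cg : {for u, continuous g}.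
  by apply/differentiable_continuous/derivable1_diffP; case: dg.
have E : {near (0 : R)^', (fun h => g (h + u) + u *: (h^-1 *: (g (h + u) - g u))) =1
    (fun h => h^-1 *: ((h + u) *: g (h + u) - u *: g u))}.
  near=> h; have h0 : h != 0 by near: h; exact: nbhs_dnbhs_neq.
  set G := g (h + u).
  have -> : (h + u) *: G - u *: g u = h *: G + u *: (G - g u).
    by rewrite scalerDl scalerBr addrA.
  by rewrite [RHS]scalerDr !scalerA mulVf// scale1r [h^-1 * u]mulrC.
apply: cvg_trans (near_eq_cvg E) _; apply: cvgD.
  apply: (continuous_cvg _ cg).
  rewrite -[X in _ --> X]add0r; apply: cvgD; last exact: cvg_cst.
  exact: cvg_within.
by apply: cvgZr; exact: limit_is_derive.
Unshelve. all: by end_near. Qed.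

Lemma is_derive_dilate (g : R -> H) (r u : R) l : is_derive (r * u) (1 : R) g l ->
  is_derive u (1 : R) (fun t => g (r * t)) (r *: l).
Proof.
move=> dg.
have dg' : differentiable g (r * u) by apply/derivable1_diffP; case: dg.
have ds : differentiable (fun t : R => r *: (t : R)) u by exact: differentiableZ.
have dgs : differentiable (g \o (fun t : R => r *: (t : R))) u by exact: differentiable_comp.
split; first by apply/derivable1_diffP.
rewrite (@deriveE _ _ _ (g \o (fun t : R => r *: (t : R))))//.
have hs : 'd (fun t : R => r *: (t : R)) u 1 = r *: (1 : R).
  by rewrite -deriveE//; have [_] := is_deriveZ r (is_derive_id u (1 : R)).
rewrite diff_comp//= hs.
have -> : l = 'D_1 g (r * u) by case: dg.
rewrite deriveE//; exact: linearZZ.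
Qed.

End differentiability.

(** * Closure properties and the representation formula *)

Section slice_hyperholomorphic_closure.
Context {R : realType}.
Local Notation H := (quat R).
Implicit Types (f g : H -> H) (x y c i j : H) (u v r : R).

(** The Cauchy-Riemann equations are expressed by naming the common derivatives [p] and [q]; in this
    form they follow directly from the rules for [is_derive]. *)
Definition slice_pair f (al be : R -> R -> H) :=
  [/\ forall i u v, imag_units R i -> 0 <= v -> u ^+ 2 + v ^+ 2 < 1 ->
        f (u%:A + v *: i) = al u v + i * be u v,
    forall u v, u ^+ 2 + v ^+ 2 < 1 -> al u (- v) = al u v /\ be u (- v) = - be u v &
    forall u v, u ^+ 2 + v ^+ 2 < 1 -> exists p q : H,
      [/\ is_derive u (1 : R) (al^~ v) p, is_derive v (1 : R) (be u) p,
        is_derive u (1 : R) (be^~ v) q & is_derive v (1 : R) (al u) (- q)]].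

Lemma SHP f : slice_hyperholomorphic R f <->
  (forall x, unit_ball R x -> differentiable f x) /\ exists al be, slice_pair f al be.
Proof.
split=> -[df [al [be h]]]; split=> //; exists al, be.
  have [h1 h2] := h; split=> //.
    by move=> u v /h2[].
  move=> u v /h2[_ [[d1 d2 d3 d4] [e1 e2]]].
  exists (derive1 (al^~ v) u), (derive1 (be^~ v) u).
  by split; [|rewrite e1| |rewrite e2 opprK]; rewrite derive1E; exact: derivableP.
have [h1 h2 h3] := h; split=> // u v uv; split; first by have [] := h2 u v uv.
have [p [q [d1 d2 d3 d4]]] := h3 u v uv.
split; first by case: d1 d2 d3 d4 => ? _ [? _] [? _] [? _].
by rewrite !derive1E; case: d1 d2 d3 d4 => _ -> [_ ->] [_ ->] [_ ->]; rewrite opprK.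
Qed.

Lemma SH_cst c : slice_hyperholomorphic R (fun=> c).
Proof.
apply/SHP; split=> [x _|]; first exact: differentiable_cst.
exists (fun _ _ => c), (fun _ _ => 0); split=> [i u v _ _ _|u v _|u v _].
- by rewrite mulr0 addr0.
- by rewrite oppr0.
- by exists 0, 0; rewrite oppr0; split; exact: is_derive_cst.
Qed.

Lemma SHD f g : slice_hyperholomorphic R f -> slice_hyperholomorphic R g ->
  slice_hyperholomorphic R (fun x => f x + g x).
Proof.
move=> /SHP[df [al [be [h1 h2 h3]]]] /SHP[dg [al' [be' [h1' h2' h3']]]]; apply/SHP; split.
  by move=> x xb; apply: differentiableD; [exact: df|exact: dg].
exists (fun u v => al u v + al' u v), (fun u v => be u v + be' u v).
split=> [i u v ui v0 uv|u v uv|u v uv].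
- by rewrite h1// h1'// mulrDr addrACA.
- by have [-> ->] := h2 u v uv; have [-> ->] := h2' u v uv; rewrite opprD.
have [p [q [d1 d2 d3 d4]]] := h3 u v uv.
have [p' [q' [d1' d2' d3' d4']]] := h3' u v uv.
exists (p + p'), (q + q'); rewrite opprD.
by split; exact: is_deriveD.
Qed.

Lemma is_derive_mulr c (g : R -> H) u dg : is_derive u (1 : R) g dg ->
  is_derive u (1 : R) (fun t => g t * c) (dg * c).
Proof.
move=> /limit_is_derive h; apply: is_derive_limit.
under eq_fun do rewrite -mulrBl scalerAl.
have cm : continuous (fun x : H => x * c).
  move=> x; apply: (@cvg_quat R H (nbhs x) (nbhs_filter x)) => n; rewrite lin_mulr; under eq_fun do rewrite lin_mulr; exact: continuous_lin.
by apply: (continuous_cvg _ (cm dg)); exact: h.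
Qed.

Lemma SH_mulr c f : slice_hyperholomorphic R f -> slice_hyperholomorphic R (fun x => f x * c).
Proof.
move=> /SHP[df [al [be [h1 h2 h3]]]]; apply/SHP; split.
  by move=> x xb; apply: (@differentiable_qmul _ f (fun=> c)); [exact: df|exact: differentiable_cst].
exists (fun u v => al u v * c), (fun u v => be u v * c).
split=> [i u v ui v0 uv|u v uv|u v uv].
- by rewrite h1// mulrDl mulrA.
- by have [-> ->] := h2 u v uv; rewrite mulNr.
have [p [q [d1 d2 d3 d4]]] := h3 u v uv.
by exists (p * c), (q * c); rewrite -mulNr; split; exact: is_derive_mulr.
Qed.

(** On the slice, with [x = u + v i], the product [x (alpha + i beta)] is [(u alpha - v beta) + i (v
    alpha + u beta)]. *)
Lemma SH_mulX f : slice_hyperholomorphic R f -> slice_hyperholomorphic R (fun x => x * f x).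
Proof.
move=> /SHP[df [al [be [h1 h2 h3]]]]; apply/SHP; split.
  by move=> x xb; apply: (@differentiable_qmul _ id f); [exact: ex_diff|exact: df].
exists (fun u v => u *: al u v - v *: be u v), (fun u v => v *: al u v + u *: be u v).
split=> [i u v ui v0 uv|u v uv|u v uv].
- rewrite h1// mulrDl qalgM !mulrDr !scalerDr -!addrA; congr (_ + _).
  rewrite -!scalerAl -!scalerAr mulrA unit_sqr// mulN1r scalerN.
  by rewrite [RHS]addrC [X in _ = X - _]addrC addrA.
- have [-> ->] := h2 u v uv; split; first by rewrite scaleNr scalerN opprK.
  by rewrite scaleNr scalerN -opprD.
have [p [q [d1 d2 d3 d4]]] := h3 u v uv.
exists (al u v + u *: p - v *: q), (v *: p + (be u v + u *: q)).
have Zl (k : R -> H) (l : H) (w s : R) : is_derive w (1 : R) k l ->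
    is_derive w (1 : R) (fun t => s *: k t) (s *: l) by move=> ?; exact: is_deriveZ.
split.
- exact: is_deriveB (is_derive_scale d1) (Zl _ _ _ v d3).
- apply: is_derive_eq; first exact: is_deriveD (is_derive_scale d4) (Zl _ _ _ u d2).
  by rewrite scalerN addrAC.
- exact: is_deriveD (Zl _ _ _ v d1) (is_derive_scale d3).
- apply: is_derive_eq; first exact: is_deriveB (Zl _ _ _ u d4) (is_derive_scale d2).
  by rewrite scalerN -opprD addrC [be u v + _]addrC -addrA.
Qed.

(** Horner's scheme: adding a constant and multiplying by [x] on the left are enough. *)
Lemma SH_poly (a : nat -> H) N : slice_hyperholomorphic R (fun x => \sum_(n < N) x ^+ n * a n).
Proof.
elim: N a => [|N IH] a.
  by under eq_fun do rewrite big_ord0; exact: SH_cst.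
under eq_fun do rewrite big_ord_recl expr0 mul1r.
apply: SHD; first exact: SH_cst.
have := SH_mulX (IH (fun n => a n.+1)); congr slice_hyperholomorphic; apply/funext => x.
by rewrite mulr_sumr; apply: eq_bigr => n _; rewrite mulrA -exprS.
Qed.

Lemma SH_dilation f r : 0 < r < 1 -> slice_hyperholomorphic R f ->
  slice_hyperholomorphic R (dilation f r).
Proof.
move=> /andP[r0 r1] /SHP[df [al [be [h1 h2 h3]]]].
have disc u v : u ^+ 2 + v ^+ 2 < 1 -> (r * u) ^+ 2 + (r * v) ^+ 2 < 1.
  move=> uv; rewrite !exprMn -mulrDr.
  have : r ^+ 2 < 1 by rewrite expr_lt1// ltW.
  by have := sqr_ge0 u; have := sqr_ge0 v; have := sqr_ge0 r; nra.
apply/SHP; split.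
  move=> x xb; apply: (@differentiable_comp _ _ _ _ (fun y : H => r *: y) f).
    exact: differentiableZ.
  apply: df; rewrite /unit_ball /= normrZ gtr0_norm//.
  by have := normr_ge0 x; move: xb; rewrite /unit_ball/=; nra.
exists (fun u v => al (r * u) (r * v)), (fun u v => be (r * u) (r * v)).
split=> [i u v ui v0 uv|u v uv|u v uv].
- rewrite /dilation scalerDr !scalerA h1// ?mulr_ge0// ?ltW//; exact: disc.
- by rewrite mulrN; exact: h2 (disc _ _ uv).
have [p [q [d1 d2 d3 d4]]] := h3 _ _ (disc _ _ uv).
exists (r *: p), (r *: q); rewrite -scalerN; split.
- exact: (is_derive_dilate d1).
- exact: (is_derive_dilate d2).
- exact: (is_derive_dilate d3).
- exact: (is_derive_dilate d4).
Qed.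

(** Coefficient, in the representation formula for the slice of [j], of the value on the slice of
    [i]; for [- i] it becomes [(1 + j i) / 2]. *)
Definition slice_proj i j : H := 2^-1 *: (1 - j * i).

Lemma norm_slice_proj i j : imag_units R i -> imag_units R j -> `|slice_proj i j| <= 1.
Proof.
move=> [_ ni] [_ nj]; rewrite normrZ ger0_norm//.
rewrite -ler_pdivlMl// invrK mulr1; apply: (le_trans (ler_normB _ _)).
by rewrite qnormM ni nj mulr1 (norm_qbasis ord0).
Qed.

(* The representation formula: the values on one slice determine those on every other slice. *)
Definition slice_rep f := forall i j (rho t : R), imag_units R i -> imag_units R j -> 0 <= rho < 1 ->
  f (rho *: qcis j t) = slice_proj i j * f (rho *: qcis i t) +
    slice_proj (- i) j * f (rho *: qcis (- i) t).

Lemma SH_slice_rep f : slice_hyperholomorphic R f -> slice_rep f.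
Proof.
move=> fSH i j rho t ui uj /andP[r0 r1]; have [al [be [h1 _]]] := slice_formula fSH.
have uv : (rho * cos t) ^+ 2 + (rho * sin t) ^+ 2 < 1.
  by rewrite !exprMn -mulrDr cos2Dsin2 mulr1 expr_lt1.
rewrite !scale_qcisE !h1//; last exact: unitN.
set A := al _ _; set B := be _ _; rewrite /slice_proj mulrN opprK mulNr.
have E (a b x y : H) : a + y - (b - x) + (a - y + (b + x)) = 2 *: (a + x).
  by apply: quatP => /=; ring.
rewrite -!scalerAl -scalerDr.
have -> : (1 - j * i) * (A + i * B) = A + i * B - (j * i * A - j * B).
  rewrite mulrBl mul1r [j * i * (_ + _)]mulrDr; congr (_ - (_ + _)).
  by rewrite mulrA -(mulrA j) unit_sqr// mulrN1 mulNr.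
have -> : (1 + j * i) * (A - i * B) = A - i * B + (j * i * A + j * B).
  rewrite mulrDl mul1r [j * i * (_ - _)]mulrBr; congr (_ + (_ + _)).
  by rewrite mulrA -(mulrA j) unit_sqr// mulrN1 mulNr opprK.
by rewrite E scalerA mulVf// scale1r.
Qed.

End slice_hyperholomorphic_closure.

(** * Bounded and vanishing mean oscillation *)

Section bmo.
Context {R : realType}.
Local Notation H := (quat R).
Implicit Types (f k : H -> H) (i : H) (a b e M : R).

Lemma oscillation_le f i g a b M : radial_boundary f i g ->
  (oscillation f i a b <= M%:E)%E -> qosc g a b <= M.
Proof. by move=> hg; rewrite (oscillationE hg) lee_fin. Qed.

Lemma le_oscillation f i g a b M : radial_boundary f i g ->
  qosc g a b <= M -> (oscillation f i a b <= M%:E)%E.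
Proof. by move=> hg; rewrite (oscillationE hg) lee_fin. Qed.

Lemma oscillation_lt f i g a b M : radial_boundary f i g ->
  (oscillation f i a b < M%:E)%E -> qosc g a b < M.
Proof. by move=> hg; rewrite (oscillationE hg) lte_fin. Qed.

Lemma lt_oscillation f i g a b M : radial_boundary f i g ->
  qosc g a b < M -> (oscillation f i a b < M%:E)%E.
Proof. by move=> hg; rewrite (oscillationE hg) lte_fin. Qed.

(** Replaces the seminorm in all estimates: a seminorm at most [e] is [osc_le f (e ^+ 2)], free of
    suprema and square roots. *)
Definition osc_le f M := forall i a b, imag_units R i -> a < b -> b - a <= 2 * pi ->
  (oscillation f i a b <= M%:E)%E.

Definition has_boundary f := forall i, imag_units R i -> exists g, radial_boundary f i g.

Lemma bmo_seminorm_le f e : 0 <= e ->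
  ((bmo_seminorm f <= e%:E)%E <-> osc_le f (e ^+ 2)).
Proof.
move=> e0; have eE : e%:E = sqrte (e ^+ 2)%:E by rewrite /= sqrtr_sqr ger0_norm.
have e20 : (0%:E <= (e ^+ 2)%:E)%E by rewrite lee_fin sqr_ge0.
split=> [h i a b ui ab abp|h].
  have h1 : (bmo_slice f i <= e%:E)%E.
    by apply: le_trans h; apply: ereal_sup_ubound; exists i.
  move: h1; rewrite eE lee_sqrt//; apply: le_trans.
  by apply: ereal_sup_ubound; exists (a, b).
apply: ge_ereal_sup => _ [i ui <-]; rewrite eE lee_sqrt//.
by apply: ge_ereal_sup => _ [[a b] /= [ab abp] <-]; exact: h.
Qed.

Lemma bmo_seminorm_finite f : (bmo_seminorm f < +oo)%E <-> exists M, osc_le f M.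
Proof.
split=> [h|[M hM]].
  have [e [e0 he]] : exists e : R, 0 <= e /\ (bmo_seminorm f <= e%:E)%E.
    case: (bmo_seminorm f) h => [e| |] //= _; last by exists 0; rewrite leNye.
    by exists `|e|; rewrite lee_fin ler_norm.
  by exists (e ^+ 2); apply/bmo_seminorm_le.
have hs : (bmo_seminorm f <= (Num.sqrt `|M|)%:E)%E.
  apply/bmo_seminorm_le; first exact: sqrtr_ge0.
  move=> i a b ui ab abp; apply: (le_trans (hM i a b ui ab abp)).
  by rewrite lee_fin sqr_sqrtr// ler_norm.
by apply: (le_lt_trans hs); rewrite ltry.
Qed.

Lemma BMOSHP f : BMOSH R f <-> hardy2 R f /\ exists M, osc_le f M.
Proof. by split=> -[hf hM]; split=> //; apply/bmo_seminorm_finite. Qed.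

Lemma BMOSH_norm_osc f e : 0 < e -> (BMOSH_norm f < e%:E)%E -> osc_le f (e ^+ 2).
Proof.
move=> e0 h; apply/bmo_seminorm_le; first exact: ltW.
apply: le_trans (ltW h); rewrite /BMOSH_norm leeDr// lee_fin.
Qed.

(** A supremum preserves only weak bounds; halving [e] restores the strict one. *)
Lemma osc_BMOSH_norm f e : 0 < e -> f 0 = 0 -> osc_le f ((e / 2) ^+ 2) ->
  (BMOSH_norm f < e%:E)%E.
Proof.
move=> e0 f0 h; rewrite /BMOSH_norm f0 normr0 add0e.
have /bmo_seminorm_le hs := h.
apply: (@le_lt_trans _ _ (e / 2)%:E); first by apply: hs; rewrite ltW// divr_gt0.
by rewrite lte_fin ltr_pdivrMr// ltr_pMr// ltr1n.
Qed.

Lemma hardy2_boundary f : hardy2 R f -> has_boundary f.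
Proof.
move=> /hardy2P[fSH [C hC]] i ui.
have [g [hg _ _]] := hardy_boundary fSH ui (fun r => hC i r ui).
by exists g.
Qed.

Lemma osc_leD f k M M' : has_boundary f -> has_boundary k ->
  osc_le f M -> osc_le k M' -> osc_le (f \+ k) (2 * M + 2 * M').
Proof.
move=> bf bk hf hk i a b ui ab abp; have [g hg] := bf i ui; have [h hh] := bk i ui.
apply: (le_oscillation (radial_boundaryD hg hh)).
apply: (le_trans (qoscD ab hg.1 hh.1)).
have h1 := oscillation_le hg (hf i a b ui ab abp).
have h2 := oscillation_le hh (hk i a b ui ab abp).
by apply: lerD; apply: ler_wpM2l.
Qed.

Lemma osc_le_sym f k M : has_boundary f -> has_boundary k ->
  osc_le (f \- k) M -> osc_le (k \- f) M.
Proof.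
move=> bf bk hf i a b ui ab abp; have [g hg] := bf i ui; have [h hh] := bk i ui.
have h1 := oscillation_le (radial_boundaryB hg hh) (hf i a b ui ab abp).
apply: (le_oscillation (radial_boundaryB hh hg)); apply: le_trans h1.
apply: le_trans (qoscN ab (radial_boundaryB hg hh).1).
by rewrite (@qosc_eq _ (fun t => h t - g t) (fun t => - (g t - h t)))// => t; rewrite opprB.
Qed.

Lemma has_boundaryB f k : has_boundary f -> has_boundary k -> has_boundary (f \- k).
Proof.
move=> bf bk i ui; have [g hg] := bf i ui; have [h hh] := bk i ui.
by exists (fun t => g t - h t); exact: radial_boundaryB.
Qed.

(** In [f = k + (f - k)] the first term oscillates little on short intervals and the second on every
    interval of length at most [2 pi]. With [e / 8] for each, [qoscD] gives [e / 2]. *)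
Lemma vanishing_osc f : BMOSH R f ->
  (forall e, 0 < e -> exists k, VMOSH R k /\ osc_le (f \- k) e) -> VMOSH R f.
Proof.
move=> Bf hf; split=> // i ui e e0.
have e8 : 0 < e / 8 by rewrite divr_gt0.
have [k [[Bk vk] fk]] := hf _ e8.
have [g hg] := hardy2_boundary Bf.1 ui; have [h hh] := hardy2_boundary Bk.1 ui.
have [d d0 hd] := vk i ui _ e8.
exists (Num.min d (2 * pi)); first by rewrite lt_min d0 twopi_gt0.
move=> a b ab; rewrite lt_min => /andP[abd abp].
have h1 := oscillation_le (radial_boundaryB hg hh) (fk i a b ui ab (ltW abp)).
have h2 := oscillation_lt hh (hd a b ab abd).
apply: (lt_oscillation hg).
have h3 : qosc g a b <= 2 * qosc h a b + 2 * qosc (fun t => g t - h t) a b.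
  apply: le_trans (qoscD ab hh.1 (radial_boundaryB hg hh).1).
  by rewrite (@qosc_eq _ (fun t => h t + (g t - h t)) g)// => t; rewrite addrCA subrr addr0.
apply: (le_lt_trans h3).
move: (qosc h a b) (qosc _ a b) h1 h2 {h3} => x y; lra.
Qed.

Lemma VMOSH_closure (A : set (H -> H)) f : (forall k, A k -> BMOSH R k -> VMOSH R k) ->
  BMOSH_closure A f -> VMOSH R f.
Proof.
move=> AV [Bf hf]; apply: vanishing_osc => // e e0.
have s0 : 0 < Num.sqrt e by rewrite sqrtr_gt0.
have [k [Ak Bk hk]] := hf _ s0; exists k; split; first exact: AV.
by have := BMOSH_norm_osc s0 hk; rewrite sqr_sqrtr// ltW.
Qed.

Section closed_ball_extension.
Variables (f h : H -> H) (i : H).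
Hypothesis hc : {within closure (unit_ball R), continuous h}.
Hypothesis hf : forall x, unit_ball R x -> h x = f x.
Hypothesis ui : imag_units R i.

Lemma closure_unit_ball x : closure (unit_ball R) x <-> `|x| <= 1.
Proof.
have -> : unit_ball R = ball (0 : H) 1.
  by apply/seteqP; split=> y; rewrite -ball_normE/= sub0r normrN.
rewrite -[closure _]/(closed_ball (0 : H) 1) closed_ballE//.
by rewrite /closed_ball_/= sub0r normrN.
Qed.

(** Continuity of [h] is relative to the closed ball, so the moving point must be known to stay in
    it. *)
Lemma extension_cvg (T : Type) (F : set_system T) {FF : Filter F} (c : T -> H) x :
  `|x| <= 1 -> (\forall t \near F, `|c t| <= 1) -> c t @[t --> F] --> x ->
  h (c t) @[t --> F] --> h x.
Proof.
move=> /closure_unit_ball xB cB cx A.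
move/subspace_continuousP : hc => /(_ x xB) /[apply].
rewrite /within/= => hA; have := cx _ hA; rewrite /nbhs/=.
move: cB; apply: filterS2 => t /closure_unit_ball tB /=; exact.
Qed.

Lemma extension_continuous : continuous (fun t => h (qcis i t)).
Proof.
move=> t; apply: extension_cvg; first by rewrite norm_qcis.
  by apply: nearW => s; rewrite norm_qcis.
exact: continuous_qcis.
Qed.

Lemma cvg_radius x : r *: x @[r --> (1 : R)^'-] --> (x : H).
Proof.
rewrite -[X in _ --> X]scale1r; apply: cvgZr_tmp; exact: cvg_within.
Qed.

Lemma extension_boundary : radial_boundary f i (fun t => h (qcis i t)).
Proof.
split; first exact: continuous_qlocl2 extension_continuous.
exists set0; split; [exact: measurable0|exact: measure0|] => t _.
have near01 : \forall r \near (1 : R)^'-, 0 < r < 1.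
  by near=> r; apply/andP; split.
have E : {near (1 : R)^'-, (fun r => h (r *: qcis i t)) =1 (fun r => f (r *: qcis i t))}.
  apply: filterS near01 => r /andP[r0 r1]; apply: hf; apply: ball_scale_qcis => //.
  by rewrite gtr0_norm.
apply: cvg_trans (near_eq_cvg E) _; apply: extension_cvg.
- by rewrite norm_qcis.
- apply: filterS near01 => r /andP[r0 r1].
  by rewrite norm_scale_qcis// gtr0_norm// ltW.
- exact: cvg_radius.
Unshelve. all: by end_near. Qed.

End closed_ball_extension.

(** Compactness of [[0, p]] gives one [d] for all [t] in a period and [s] anywhere; in general both
    points are translated by the same multiple of [p]. *)
Lemma continuous_periodic_uniform (g : R -> H) p e : 0 < p -> continuous g ->
  (forall t, g (t + p) = g t) -> 0 < e ->
  exists2 d, 0 < d & forall s t, `|s - t| < d -> `|g s - g t| <= e.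
Proof.
move=> p0 cg pg e0.
have [d d0 hd] : exists2 d, 0 < d & forall t, 0 <= t <= p -> forall s, `|s - t| < d -> `|g s - g t| <= e.
  have /compact_near_coveringP/(_ R (0 : R)^'+ (fun d t => forall s, `|s - t| < d -> `|g s - g t| <= e)) :=
    @segment_compact R 0 p.
  move=> /(_ _ _)/wrap[].
    move=> t _; have e20 : 0 < e / 2 by rewrite divr_gt0.
    have /cvgrPdist_le/(_ _ e20)[d /= d0 hd] := cg t.
    have d20 : 0 < d / 2 by rewrite divr_gt0.
    exists (ball t (d / 2), [set x | 0 < x < d / 2]) => /=.
      split; first exact: nbhsx_ballx.
      by near=> x; apply/andP.
    move=> [t' x] /= [tt' /andP[x0 xd]] s st'; rewrite -ball_normE/= in tt'.
    rewrite [leRHS](splitr e) (le_trans (ler_distD (g t) _ _))// lerD//.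
      rewrite distrC; apply: hd => /=.
      rewrite (splitr d) (le_lt_trans (ler_distD t' _ _))// ltrD//.
      by rewrite distrC (lt_trans st').
    by apply: hd => /=; apply: (lt_trans tt'); rewrite ltr_pdivrMr// ltr_pMr// ltr1n.
  move=> [d /= d0 hd]; exists (d / 2); first by rewrite divr_gt0.
  have d20 : 0 < d / 2 by rewrite divr_gt0.
  have db : ball_ (fun x => `|x|) 0 d (d / 2).
    by rewrite /= sub0r normrN gtr0_norm// ltr_pdivrMr// ltr_pMr// ltr1n.
  by move=> t tp s; apply: (hd _ db d20); rewrite /= in_itv.
exists d => // s t st.
pose n := Num.floor (t / p).
have gz z x : g (x + p *~ z) = g x by exact: periodicMz.
rewrite -(gz (- n) s) -(gz (- n) t); apply: hd.
  rewrite mulrNz -mulrzr; apply/andP; split.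
    by rewrite subr_ge0 mulrC -ler_pdivlMr// floor_le.
  have := floorD1_gt (t / p); rewrite -/n ltr_pdivrMr// intrD mulrDl mul1r [p * _]mulrC.
  by move=> h; rewrite lerBlDl ltW.
by rewrite opprD addrACA subrr addr0.
Unshelve. all: by end_near. Qed.

Lemma disk_algebra_VMOSH f : disk_algebra R f -> BMOSH R f -> VMOSH R f.
Proof.
move=> [_ [h [hc hf]]] Bf; split=> // i ui e e0.
have hg := extension_boundary hc hf ui.
have s0 : 0 < Num.sqrt (e / 2) by rewrite sqrtr_gt0 divr_gt0.
have [d d0 hd] := continuous_periodic_uniform twopi_gt0 (extension_continuous hc ui)
  (fun t => congr1 h (qcisD2pi i t)) s0.
exists d => // a b ab abd; apply: (lt_oscillation hg).
apply: (@le_lt_trans _ _ (e / 2)); last by rewrite ltr_pdivrMr// ltr_pMr// ltr1n.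
apply: (qosc_bound (c := h (qcis i a)) ab hg.1) => t /andP[at_ tb].
have e20 : 0 <= e / 2 by rewrite divr_ge0// ltW.
rewrite -(sqr_sqrtr e20) lerXn2r ?nnegrE ?sqrtr_ge0//.
by apply: hd; rewrite ger0_norm ?subr_ge0//; lra.
Qed.

End bmo.

(** * Dilations and their convergence in the seminorm *)

Section dilation.
Context {R : realType}.
Local Notation H := (quat R).
Implicit Types (f k : H -> H) (i j : H) (a b e M r : R).

Lemma dilation_boundary f i r : slice_hyperholomorphic R f -> imag_units R i -> 0 < r < 1 ->
  radial_boundary (dilation f r) i (fun t => f (r *: qcis i t)).
Proof.
move=> fSH ui /andP[r0 r1]; split.
  by apply: continuous_qlocl2; apply: continuous_circle => //; rewrite (ltW r0).
exists set0; split; [exact: measurable0|exact: measure0|] => t _.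
rewrite /dilation; under eq_fun do rewrite scalerA mulrC -scalerA.
have rb : unit_ball R (r *: qcis i t) by apply: ball_scale_qcis; rewrite ?gtr0_norm.
apply: (continuous_cvg _ (SH_continuous fSH rb)); exact: cvg_radius.
Qed.

Section slice.
Variables (f : H -> H) (i : H) (g : R -> H).
Hypothesis fSH : slice_hyperholomorphic R f.
Hypothesis ui : imag_units R i.
Hypothesis hg : radial_boundary f i g.
Hypothesis hP : forall n r t, 0 < r < 1 -> radial f i (qbasis n) r t =
  (2 * pi)^-1 * dint (fun s => poisson r s * lin (qbasis n) (g (s + t))) (- pi) pi.

(** [osc_poisson] applies to each coordinate, which oscillates no more than [g]; the factor [4]
    counts the coordinates. *)
Lemma qosc_dilation r a b M : 0 < r < 1 -> a < b ->
  (forall s, qosc g (a + s) (b + s) <= M) ->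
  qosc (fun t => f (r *: qcis i t)) a b <= 4 * M.
Proof.
move=> r01 ab hM; have /andP[r0 r1] := r01; have r01' : 0 <= r < 1 by rewrite ltW.
have hF : qlocl2 (fun t => f (r *: qcis i t)).
  by apply: continuous_qlocl2; exact: continuous_circle.
rewrite qosc_sum// (_ : 4 * M = \sum_(n < 4) M); last by rewrite sumr_const card_ord mulr_natl.
apply: ler_sum => n _; apply: (osc_poisson r01' ab (hg.1 (qbasis n)) (hF (qbasis n))).
  by move=> t; exact: hP.
move=> s; apply: le_trans (hM s); apply: osc_le_qosc hg.1; by rewrite lerD2r ltW.
Qed.

End slice.

Lemma BMOSH_dilation f r : 0 < r < 1 -> BMOSH R f -> BMOSH R (dilation f r).
Proof.
move=> r01 /BMOSHP[hf [M hM]]; have /andP[r0 r1] := r01.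
have /hardy2P[fSH [C hC]] := hf.
apply/BMOSHP; split.
  apply/hardy2P; split; first exact: SH_dilation.
  exists C => i s ui /andP[s0 s1].
  have -> : circle2 (dilation f r) i s = circle2 f i (r * s).
    by apply: eq_dint => t _; rewrite /dilation scalerA.
  by apply: hC => //; rewrite mulr_gt0//= mulr_ilt1// ltW.
exists (4 * M) => i a b ui ab abp.
have [g [hg hP _]] := hardy_boundary fSH ui (fun s => hC i s ui).
apply: (le_oscillation (dilation_boundary fSH ui r01)).
apply: (qosc_dilation fSH ui hg hP r01 ab) => s.
apply: (oscillation_le hg); apply: hM => //; first by rewrite ltrD2r.
by rewrite opprD addrACA subrr addr0.
Qed.

Lemma slice_repB f k : slice_rep f -> slice_rep k -> slice_rep (f \- k).
Proof.
move=> hf hk i j rho t ui uj r01; rewrite /= (hf i j)// (hk i j)//.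
by rewrite !mulrBr opprD addrACA.
Qed.

Let le_double_sum M (x y z : R) : z <= 2 * x + 2 * y -> x <= M -> y <= M -> z <= 4 * M.
Proof. by lra. Qed.

(** The representation formula passes to boundary values with constant coefficients of norm at most
    [1], and [qoscD] gives [2 M + 2 M]. The bound does not depend on [j], which is what the supremum
    over all slices requires. *)
Lemma osc_le_slices k i g h M : slice_rep k -> imag_units R i ->
  radial_boundary k i g -> radial_boundary k (- i) h ->
  (forall a b, a < b -> b - a <= 2 * pi -> qosc g a b <= M /\ qosc h a b <= M) ->
  osc_le k (4 * M).
Proof.
move=> rk ui hg hh hM j a b uj ab abp.
pose G1 t := slice_proj i j * g t; pose G2 t := slice_proj (- i) j * h t.
have q1 : qlocl2 G1 by exact: qlocl2_mull hg.1.
have q2 : qlocl2 G2 by exact: qlocl2_mull hh.1.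
have hG : radial_boundary k j (fun t => G1 t + G2 t).
  split; first exact: qlocl2D.
  have [_ [N [mN N0 hN]]] := hg; have [_ [N' [mN' N'0 hN']]] := hh.
  exists (N `|` N'); split; [exact: measurableU|exact: null_set_setU|].
  move=> t /not_orP[Nt N't].
  have near01 : \forall r \near (1 : R)^'-, 0 < r < 1 by near=> r; apply/andP; split.
  have E : {near (1 : R)^'-, (fun r => slice_proj i j * k (r *: qcis i t) +
      slice_proj (- i) j * k (r *: qcis (- i) t)) =1 (fun r => k (r *: qcis j t))}.
    by apply: filterS near01 => r /andP[r0 r1]; rewrite (rk i j)// (ltW r0).
  apply: cvg_trans (near_eq_cvg E) _; apply: cvgD.
    by apply: (continuous_cvg _ (@continuous_mull _ _ _)); exact: hN.
  by apply: (continuous_cvg _ (@continuous_mull _ _ _)); exact: hN'.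
have [g1 h1] := hM a b ab abp.
have bnd (c : H) (q Q : R -> H) : Q = (fun t => c * q t) -> `|c| <= 1 -> qlocl2 q ->
    qosc q a b <= M -> qosc Q a b <= M.
  move=> -> c1 hq qM; apply: (le_trans (qosc_mull c ab hq)); apply: le_trans qM.
  by apply: ler_piMl; [exact/qosc_ge0/ltW|rewrite expr_le1].
have b1 : qosc G1 a b <= M by exact: (bnd _ g G1 erefl (norm_slice_proj ui uj) hg.1 g1).
have b2 : qosc G2 a b <= M by exact: (bnd _ h G2 erefl (norm_slice_proj (unitN ui) uj) hh.1 h1).
have b3 := le_double_sum (qoscD ab q1 q2) b1 b2.
exact: (le_oscillation hG b3).
Unshelve. all: by end_near. Qed.

(** Below the length [d] both terms of the difference oscillate little, the dilation by
    [qosc_dilation]. On longer intervals the division by [b - a] costs at most [1 / d], and L^2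
    convergence over a full period is enough. *)
Lemma dilation_osc_slice f i e : VMOSH R f -> imag_units R i -> 0 < e ->
  exists g, radial_boundary f i g /\ exists r0, 0 < r0 < 1 /\
    forall r, r0 <= r -> r < 1 -> forall a b, a < b -> b - a <= 2 * pi ->
    qosc (fun t => f (r *: qcis i t) - g t) a b <= e.
Proof.
move=> [Bf vf] ui e0; have /hardy2P[fSH [C hC]] := Bf.1.
have [g [hg hP hL]] := hardy_boundary fSH ui (fun s => hC i s ui).
exists g; split=> //.
(* Chosen for [2 * (4 * (e / 10)) + 2 * (e / 10) = e]: the [4] is that of [qosc_dilation], the [2]
   that of [qoscB]. *)
have e10 : 0 < e / 10 by rewrite divr_gt0.
have [d d0 hd] := vf i ui _ e10.
(* An L^2 error of [d * e] leaves at most [e] after division by a length at least [d]. *)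
have [r0 r01 hr] := hL _ (mulr_gt0 d0 e0).
exists r0; split=> // r r0r r1 a b ab abp.
have r01' : 0 < r < 1 by rewrite r1 andbT; case/andP: r01 => h _; exact: lt_le_trans r0r.
have hF : qlocl2 (fun t => f (r *: qcis i t)) by case: (dilation_boundary fSH ui r01').
have [abd|dab] := ltP (b - a) d.
  have osm s : qosc g (a + s) (b + s) <= e / 10.
    apply: ltW; apply: (oscillation_lt hg); apply: hd; first by rewrite ltrD2r.
    by rewrite opprD addrACA subrr addr0.
  have h1 := qosc_dilation fSH ui hg hP r01' ab osm.
  have h2 := osm 0; rewrite !addr0 in h2.
  apply: (le_trans (qoscB ab hF hg.1)).
  move: (qosc _ a b) (qosc g a b) h1 h2 => x y; lra.
apply: (le_trans (qosc_min 0 ab (qlocl2B hF hg.1))).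
have ab0 : 0 < b - a by rewrite subr_gt0.
have I1 := qlocl2_norm (qlocl2B hg.1 hF).
have h1 : dint (fun t => `|f (r *: qcis i t) - g t - 0| ^+ 2) a b <= d * e.
  apply: le_trans (hr r r0r r1 a).
  rewrite (_ : (fun t => `|f (r *: qcis i t) - g t - 0| ^+ 2) =
     (fun t => `|g t - f (r *: qcis i t)| ^+ 2)); last by apply/funext => t; rewrite subr0 distrC.
  by apply: dint_subset => //; rewrite -lerBlDl.
apply: (@le_trans _ _ ((b - a)^-1 * (d * e))); first by rewrite ler_wpM2l// invr_ge0 ltW.
by rewrite mulrCA -[leRHS]mul1r mulrA ler_wpM2r ?(ltW e0)// ler_pdivrMr// mul1r.
Qed.

Lemma qI_unit : imag_units R qI.
Proof.
split=> //; rewrite qnormE /qnorm /=.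
by rewrite expr0n/= expr1n add0r !addr0 sqrtr1.
Qed.

Lemma dilation_osc f e : VMOSH R f -> 0 < e ->
  exists r0, 0 < r0 < 1 /\ forall r, r0 <= r -> r < 1 -> osc_le (dilation f r \- f) e.
Proof.
move=> vf e0; have e40 : 0 < e / 4 by rewrite divr_gt0.
have fSH : slice_hyperholomorphic R f by case: vf => -[] [].
have [g [hg [r0 [/andP[r00 r01] hr]]]] := dilation_osc_slice vf qI_unit e40.
have [h [hh [s0 [/andP[s00 s01] hs]]]] := dilation_osc_slice vf (unitN qI_unit) e40.
exists (Num.max r0 s0); split; first by rewrite lt_max r00 gt_max r01.
move=> r; rewrite ge_max => /andP[r0r s0r] r1.
have r01' : 0 < r < 1 by rewrite r1 (lt_le_trans r00).
rewrite (_ : e = 4 * (e / 4)); last by rewrite mulrCA divff// mulr1.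
have b1 := radial_boundaryB (dilation_boundary fSH qI_unit r01') hg.
have b2 := radial_boundaryB (dilation_boundary fSH (unitN qI_unit) r01') hh.
apply: (osc_le_slices _ qI_unit b1 b2).
  by apply: slice_repB; apply: SH_slice_rep => //; exact: SH_dilation.
by move=> a b ab abp; split; [exact: hr|exact: hs].
Qed.

End dilation.

(** * Polynomial approximation of dilations *)

Section polynomials.
Context {R : realType}.
Local Notation H := (quat R).
Implicit Types (f p : H -> H) (i j : H) (a b e r : R).

Lemma continuous_qmulf (f g : H -> H) : continuous f -> continuous g ->
  continuous (fun x => f x * g x).
Proof.
move=> cf cg x.
apply: (@continuous_comp _ _ _ (fun x => (f x, g x)) (fun q : H * H => q.1 * q.2)).
  exact: cvg_pair (cf x) (cg x).
exact: qmul_continuous.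
Qed.

Lemma continuous_qpoly (c : nat -> H) N : continuous (fun x : H => \sum_(n < N) x ^+ n * c n).
Proof.
elim: N c => [|N IH] c.
  by under eq_fun do rewrite big_ord0; exact: cst_continuous.
have cM : continuous (fun x : H => x * \sum_(n < N) x ^+ n * c n.+1).
  by apply: continuous_qmulf; [move=> x; exact: cvg_id|exact: (IH (fun n => c n.+1))].
have E (x : H) : \sum_(n < N.+1) x ^+ n * c n = c 0%N + x * \sum_(n < N) x ^+ n * c n.+1.
  rewrite big_ord_recl expr0 mul1r mulr_sumr; congr (_ + _).
  by apply: eq_bigr => n _; rewrite mulrA -exprS.
move=> x; rewrite /continuous_at E; under eq_fun do rewrite E.
exact: (cvgD (@cst_continuous H H (c 0%N) x) (cM x)).
Qed.

Lemma norm_exp_le1 (x : H) n : `|x| <= 1 -> `|x ^+ n| <= 1.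
Proof.
move=> x1; elim: n => [|n IH]; first by rewrite expr0 (norm_qbasis ord0).
by rewrite exprS qnormM mulr_ile1.
Qed.

Lemma qpoly_bounded (c : nat -> H) N (x : H) : `|x| <= 1 ->
  `|\sum_(n < N) x ^+ n * c n| <= \sum_(n < N) `|c n|.
Proof.
move=> x1; apply: (le_trans (ler_norm_sum _ _ _)); apply: ler_sum => n _.
by rewrite qnormM ler_piMl// norm_exp_le1.
Qed.

Lemma continuous_radial_boundary p i : continuous p ->
  radial_boundary p i (fun t => p (qcis i t)).
Proof.
move=> cp; split.
  apply: continuous_qlocl2 => t; apply: (@continuous_comp _ _ _ (qcis i) p); last exact: cp.
  exact: continuous_qcis.
exists set0; split; [exact: measurable0|exact: measure0|] => t _.
by apply: (continuous_cvg _ (cp _)); exact: cvg_radius.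
Qed.

Lemma bounded_BMOSH p K : slice_hyperholomorphic R p -> continuous p ->
  (forall x, `|x| <= 1 -> `|p x| <= K) -> BMOSH R p.
Proof.
move=> pSH cp pK; have p0 := @twopi_gt0 R.
have pK2 x : `|x| <= 1 -> `|p x| ^+ 2 <= K ^+ 2.
  by move=> x1; rewrite lerXn2r ?nnegrE ?pK// (le_trans _ (pK x x1)).
apply/BMOSHP; split.
  apply/hardy2P; split=> //; exists (K ^+ 2 * (2 * pi)) => i r ui /andP[r0 r1].
  have r01 : 0 <= r < 1 by rewrite ltW.
  rewrite -[X in _ * X]subr0 -dint_cst; last exact: ltW.
  apply: ler_dint; last 1 first.
  - by move=> t _; apply: pK2; rewrite norm_scale_qcis// gtr0_norm// ltW.
  - by apply: qlocl2_norm; apply: continuous_qlocl2; exact: continuous_circle.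
  - exact: locint_cst.
exists (K ^+ 2) => i a b ui ab _; have hp := continuous_radial_boundary i cp.
apply: (le_oscillation hp); apply: (qosc_bound (c := 0) ab hp.1) => t _.
by rewrite subr0 pK2// norm_qcis.
Qed.

Section slice_coefficients.
Variables (f : H -> H) (i : H).
Hypothesis fSH : slice_hyperholomorphic R f.
Hypothesis ui : imag_units R i.

Lemma slice_coef_linear (s s' : R) (w w' : H) n :
  slice_coef f i (s *: w + s' *: w') n = s * slice_coef f i w n + s' * slice_coef f i w' n.
Proof.
have linl (v : H) (x : H) a b (v' : H) : lin (a *: v + b *: v') x = a * lin v x + b * lin v' x.
  by rewrite !linE /=; ring.
have h12 : `|1 / 2 : R| < 1 by rewrite ger0_norm; lra.
rewrite /slice_coef.
have -> : fourier_int f i (- n%:R) (s *: w + s' *: w') (1 / 2) =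
    s * fourier_int f i (- n%:R) w (1 / 2) + s' * fourier_int f i (- n%:R) w' (1 / 2).
  rewrite /fourier_int.
  have I1 := locint_fourier fSH ui (- n%:R) w h12.
  have I2 := locint_fourier fSH ui (- n%:R) w' h12.
  rewrite -(dintZ s _ _ I1) -(dintZ s' _ _ I2) -(dintD _ _ (locintZ s I1) (locintZ s' I2)).
  apply: eq_dint => t _; rewrite /radial mulrDl -!scalerAl !linl; ring.
ring.
Qed.

(** The [n]-th power series coefficient of [f], assembled from its real coordinates. [lin_qcoef]
    extends the relation from the four basis weights to every [w] by linearity. *)
Definition qcoef n : H := Quat (slice_coef f i 1 n) (slice_coef f i (- qI) n)
  (slice_coef f i (- qJ) n) (slice_coef f i (- qK) n).

Lemma lin_qcoef w n : lin w (qcoef n) = slice_coef f i w n.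
Proof.
have wE : w = 1 *: (qre w *: 1 + (- qi w) *: (- qI)) + 1 *: ((- qj w) *: (- qJ) + (- qk w) *: (- qK)).
  by apply: quatP => /=; ring.
rewrite [in RHS]wE !slice_coef_linear linE /=; ring.
Qed.

(** Tested with [w], the power series becomes the Fourier series of [slice_harmonic], because
    [qcis i t ^+ n] is [qcis i (n t)]. *)
Lemma lin_partial_sum w r N t :
  lin w (\sum_(n < N.+1) qcis i t ^+ n * (r ^+ n *: qcoef n)) =
  trig (slice_coef f i w) (fun n => if n is 0%N then 0 else slice_coef f i (w * i) n) N r t.
Proof.
rewrite lin_sum; apply: eq_bigr => n _.
rewrite -scalerAr linZ qcisX// lin_mul; congr (_ * _).
rewrite mulrDr -scalerAr mulr1 -scalerAr.
have -> : lin (cos (n%:R * t) *: w + sin (n%:R * t) *: (w * i)) (qcoef n) =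
    cos (n%:R * t) * lin w (qcoef n) + sin (n%:R * t) * lin (w * i) (qcoef n).
  by rewrite !linE /=; ring.
rewrite !lin_qcoef; congr (_ + _).
by case: (n : nat) => //; rewrite mul0r sin0 mul0r mulr0.
Qed.

Lemma partial_sum_cvg r e : 0 < r < 1 -> 0 < e -> exists N, forall t,
  `|f (r *: qcis i t) - \sum_(n < N.+1) qcis i t ^+ n * (r ^+ n *: qcoef n)| ^+ 2 <= e.
Proof.
move=> r01 e0; have e20 : 0 < Num.sqrt (e / 4) by rewrite sqrtr_gt0 divr_gt0.
have hn (n : 'I_4) : exists N0, forall N, (N0 <= N)%N -> forall t,
    `|radial f i (qbasis n) r t - trig (slice_coef f i (qbasis n))
      (fun m => if m is 0%N then 0 else slice_coef f i (qbasis n * i) m) N r t| <= Num.sqrt (e / 4).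
  have [C [th [C0 th01 hC]]] := harmonic_trig_unif (slice_harmonic fSH ui (qbasis n)) r01.
  have [N0 hN0] := geometric_small C th01 e20; exists N0 => N N0N t.
  have /andP[r0 r1] := r01; have /andP[th0 th1] := th01.
  apply: (le_trans (hC r t N _)); first by rewrite r0/=.
  apply: le_trans hN0; rewrite ger0_norm ?mulr_ge0 ?exprn_ge0// ler_wpM2l//.
  by apply: ler_wiXn2l => //; exact: ltW.
have [N0 hN0] := choice hn.
pose N := (\max_(n < 4) N0 n)%N; exists N => t.
rewrite sqr_qnorm_lin (_ : e = \sum_(n < 4) e / 4); last first.
  by rewrite sumr_const card_ord -mulr_natr; field.
apply: ler_sum => n _; rewrite linB lin_partial_sum.
have e40 : 0 <= e / 4 by rewrite divr_ge0// ltW.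
rewrite -(sqr_sqrtr e40) -[leLHS]real_normK ?num_real// lerXn2r ?nnegrE ?sqrtr_ge0//.
by apply: hN0; exact: leq_bigmax.
Qed.

End slice_coefficients.

(* Oscillations ignore constants, so the constant coefficient of the partial sum
   may be replaced by [f 0]. *)
Lemma poly_approx f r e : slice_hyperholomorphic R f -> 0 < r < 1 -> 0 < e ->
  exists p, [/\ slice_polynomials R p, BMOSH R p, p 0 = f 0 & osc_le (dilation f r \- p) e].
Proof.
move=> fSH r01 e0; have e40 : 0 < e / 4 by rewrite divr_gt0.
have [N hN] := partial_sum_cvg fSH qI_unit r01 e40.
pose c n := r ^+ n *: qcoef f qI n.
pose b n := if n is 0%N then f 0 else c n.
pose p (x : H) := \sum_(n < N.+1) x ^+ n * b n.
have pE x : p x = \sum_(n < N.+1) x ^+ n * c n + (f 0 - c 0%N).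
  rewrite /p !big_ord_recl !expr0 !mul1r /=.
  by rewrite addrAC [c 0%N + _]addrC subrK; congr (_ + _).
have cp : continuous p by exact: continuous_qpoly.
have pSH : slice_hyperholomorphic R p by exact: SH_poly.
exists p; split.
- by exists N, b.
- by apply: (bounded_BMOSH pSH cp) => x x1; exact: qpoly_bounded.
- rewrite /p big_ord_recl expr0 mul1r big1 ?addr0// => n _.
  by rewrite exprS !mul0r.
have B i : imag_units R i -> radial_boundary (dilation f r \- p) i
    (fun t => f (r *: qcis i t) - p (qcis i t)).
  move=> ui; apply: radial_boundaryB; first exact: dilation_boundary.
  exact: continuous_radial_boundary.
rewrite (_ : e = 4 * (e / 4)); last by rewrite mulrCA divff// mulr1.
apply: (osc_le_slices _ qI_unit (B _ qI_unit) (B _ (unitN qI_unit))).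
  by apply: slice_repB; apply: SH_slice_rep => //; exact: SH_dilation.
have close t : `|f (r *: qcis qI t) - p (qcis qI t) - - (f 0 - c 0%N)| ^+ 2 <= e / 4.
  rewrite pE opprK; set F := f _; set S := \sum_(n < _) _; set D := f 0 - c 0%N.
  have E (x y z : H) : x - (y + z) + z = x - y by rewrite opprD addrA subrK.
  rewrite (E F S D); exact: hN.
move=> a d ad _; split.
  by apply: (qosc_bound (c := - (f 0 - c 0%N)) ad (B _ qI_unit).1) => t _.
apply: (qosc_bound (c := - (f 0 - c 0%N)) ad (B _ (unitN qI_unit)).1) => t _.
by rewrite qcisN.
Qed.

End polynomials.

(** * Linear structure of [VMOSH] *)

Section subspace.
Context {R : realType}.
Local Notation H := (quat R).
Implicit Types (f g : H -> H).

Lemma continuous_disk_algebra f g : slice_hyperholomorphic R f -> continuous g ->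
  (forall x, unit_ball R x -> g x = f x) -> disk_algebra R f.
Proof.
by move=> fSH cg gf; split=> //; exists g; split=> //; exact: continuous_subspaceT.
Qed.

Lemma VMOSH0 : VMOSH R (fun=> 0).
Proof.
have c0 : continuous (fun _ : H => 0 : H) by exact: cst_continuous.
have s0 := SH_cst (0 : H).
apply: disk_algebra_VMOSH; first exact: continuous_disk_algebra s0 c0 _.
by apply: (bounded_BMOSH (K := 0) s0 c0) => x _; rewrite normr0.
Qed.

Lemma VMOSHD f g : VMOSH R f -> VMOSH R g -> VMOSH R (f \+ g).
Proof.
move=> [Bf vf] [Bg vg].
have /BMOSHP[hf [M hM]] := Bf; have /BMOSHP[hg [M' hM']] := Bg.
have bf := hardy2_boundary hf; have bg := hardy2_boundary hg.
have /hardy2P[fSH [C hC]] := hf; have /hardy2P[gSH [C' hC']] := hg.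
split.
  apply/BMOSHP; split; last by exists (2 * M + 2 * M'); exact: osc_leD.
  apply/hardy2P; split; first exact: SHD.
  exists (2 * C + 2 * C') => i r ui r01; have /andP[r0 r1] := r01.
  have r01' : 0 <= r < 1 by rewrite ltW.
  have cf := continuous_qlocl2 (continuous_circle fSH ui r01').
  have cg := continuous_qlocl2 (continuous_circle gSH ui r01').
  apply: (@le_trans _ _ (2 * circle2 f i r + 2 * circle2 g i r)).
    apply: (dint_le2 _ _ (qlocl2_norm cf) (qlocl2_norm cg)).
      exact: qlocl2_norm (qlocl2D cf cg).
    by move=> t; exact: sqr_normD.
  by apply: lerD; apply: ler_wpM2l => //; [exact: hC|exact: hC'].
move=> i ui e e0; have e40 : 0 < e / 4 by rewrite divr_gt0.
have [u hu] := bf i ui; have [v hv] := bg i ui.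
have [d d0 hd] := vf i ui _ e40; have [d' d'0 hd'] := vg i ui _ e40.
exists (Num.min d d'); first by rewrite lt_min d0.
move=> a b ab; rewrite lt_min => /andP[abd abd'].
apply: (lt_oscillation (radial_boundaryD hu hv)).
apply: (le_lt_trans (qoscD ab hu.1 hv.1)).
have := oscillation_lt hu (hd a b ab abd); have := oscillation_lt hv (hd' a b ab abd').
move: (qosc u a b) (qosc v a b) => x y; lra.
Qed.

Lemma VMOSH_mulr f (c : H) : VMOSH R f -> VMOSH R (fun x => f x * c).
Proof.
move=> [Bf vf]; have /BMOSHP[hf [M hM]] := Bf.
have bf := hardy2_boundary hf; have /hardy2P[fSH [C hC]] := hf.
have c0 : 0 <= `|c| ^+ 2 by exact: sqr_ge0.
split.
  apply/BMOSHP; split; last first.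
    exists (`|c| ^+ 2 * M) => i a b ui ab abp; have [u hu] := bf i ui.
    apply: (le_oscillation (radial_boundary_mulr c hu)).
    apply: (le_trans (qosc_mulr c ab hu.1)); apply: ler_wpM2l => //.
    exact: oscillation_le hu (hM i a b ui ab abp).
  apply/hardy2P; split; first exact: SH_mulr.
  exists (`|c| ^+ 2 * C) => i r ui r01; have /andP[r0 r1] := r01.
  have r01' : 0 <= r < 1 by rewrite ltW.
  have cf := continuous_qlocl2 (continuous_circle fSH ui r01').
  have -> : circle2 (fun x => f x * c) i r = `|c| ^+ 2 * circle2 f i r.
    rewrite /circle2 -(dintZ _ _ _ (qlocl2_norm cf)); apply: eq_dint => t _.
    by rewrite qnormM exprMn mulrC.
  by apply: ler_wpM2l => //; exact: hC.
move=> i ui e e0.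
(* Adding [1] also covers [c = 0], where dividing by the squared norm would fail. *)
have c1 : 0 < `|c| ^+ 2 + 1 by rewrite ltr_wpDl.
have e10 : 0 < e / (`|c| ^+ 2 + 1) by rewrite divr_gt0.
have [u hu] := bf i ui; have [d d0 hd] := vf i ui _ e10.
exists d => // a b ab abd; apply: (lt_oscillation (radial_boundary_mulr c hu)).
apply: (le_lt_trans (qosc_mulr c ab hu.1)).
have := oscillation_lt hu (hd a b ab abd); rewrite ltr_pdivlMr//.
have := qosc_ge0 u (ltW ab); move: (qosc u a b) => x x0; nra.
Qed.

Lemma BMOSH_norm_ge0 f : (0 <= BMOSH_norm f)%E.
Proof.
rewrite /BMOSH_norm adde_ge0// ?lee_fin//.
apply: (@le_trans _ _ (bmo_slice f qI)); first exact: sqrte_ge0.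
by apply: ereal_sup_ubound; exists qI => //; exact: qI_unit.
Qed.

End subspace.

(** * The implications between the four statements *)

Section equivalence.
Context {R : realType}.
Local Notation H := (quat R).
Variable f : H -> H.

Let near01 (s : R) : s < 1 -> \forall r \near (1 : R)^'-, s < r < 1.
Proof. by move=> s1; near=> r; apply/andP; split. Unshelve. all: by end_near. Qed.

(** A dilation agrees with [f] at [0], so the norm of the difference is its seminorm, which
    [dilation_osc] controls. *)
Lemma VMOSH_dilation : VMOSH R f -> BMOSH_cvg 1^'- (dilation f) f.
Proof.
move=> vf; have Bf := vf.1; split.
  by apply: filterS (near01 (@ltr01 R)) => r r01; exact: BMOSH_dilation.
have small e : 0 < e -> \forall r \near (1 : R)^'-, (BMOSH_norm (dilation f r \- f)%R < e%:E)%E.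
  move=> e0; have e20 : 0 < (e / 2) ^+ 2 by rewrite exprn_gt0// divr_gt0.
  have [r0 [/andP[_ r01] hr]] := dilation_osc vf e20.
  apply: filterS (near01 r01) => r /andP[r0r r1].
  apply: osc_BMOSH_norm => //; last exact: hr (ltW r0r) r1.
  by rewrite /= /dilation scaler0 subrr.
apply/fine_cvgP; split.
  apply: filterS (small 1 ltr01) => r hr.
  by rewrite ge0_fin_numE ?BMOSH_norm_ge0// (lt_trans hr)// ltry.
apply/cvgrPdist_lt => e e0; apply: filterS (small e e0) => r hr /=.
rewrite sub0r normrN ger0_norm ?fine_ge0 ?BMOSH_norm_ge0//.
rewrite -lte_fin fineK// ge0_fin_numE ?BMOSH_norm_ge0//.
by rewrite (lt_trans hr)// ltry.
Qed.

Lemma dilation_disk_algebra r : 0 < r < 1 -> slice_hyperholomorphic R f ->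
  disk_algebra R (dilation f r).
Proof.
move=> r01 fSH; have /andP[r0 r1] := r01; split; first exact: SH_dilation.
exists (dilation f r); split=> //.
apply/subspace_continuousP => x /closure_unit_ball x1.
apply: cvg_within_filter.
have rb : unit_ball R (r *: x).
  by rewrite /unit_ball/= normrZ gtr0_norm//; have := normr_ge0 x; nra.
apply: (continuous_cvg _ (SH_continuous fSH rb)).
by apply: cvgZl_tmp; exact: cvg_id.
Qed.

Lemma dilation_closure : BMOSH R f -> BMOSH_cvg 1^'- (dilation f) f ->
  BMOSH_closure (disk_algebra R) f.
Proof.
move=> Bf [nB /fine_cvgP[nfin nc]]; split=> // e e0.
have e20 : 0 < e / 2 by rewrite divr_gt0.
have fSH : slice_hyperholomorphic R f by case: Bf => -[].
move/cvgrPdist_lt/(_ _ e20) : nc => nc.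
have : \forall r \near (1 : R)^'-, [/\ 0 < r < 1, BMOSH R (dilation f r) &
    (BMOSH_norm (dilation f r \- f)%R < (e / 2)%:E)%E].
  apply: filterS2 (near01 (@ltr01 R)) (filterI nB (filterI nfin nc)) => r r01 [Br [fr /= hr]].
  split=> //; rewrite -(fineK fr) lte_fin; move: hr.
  by rewrite sub0r normrN; exact/le_lt_trans/ler_norm.
move=> /filter_ex[r [r01 Br hr]].
exists (dilation f r); split=> //; first exact: dilation_disk_algebra.
apply: osc_BMOSH_norm => //; first by rewrite /= /dilation scaler0 subrr.
apply: osc_le_sym; [exact: hardy2_boundary Br.1|exact: hardy2_boundary Bf.1|].
exact: BMOSH_norm_osc.
Qed.

Lemma VMOSH_poly_closure : VMOSH R f -> BMOSH_closure (slice_polynomials R) f.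
Proof.
move=> vf; have Bf := vf.1; split=> // e e0.
have fSH : slice_hyperholomorphic R f by case: Bf => -[].
(* The two errors, from [f] to its dilation and from there to the polynomial, are each doubled by
   [osc_leD] and add up to [(e / 2) ^+ 2]. *)
have e20 : 0 < (e / 2) ^+ 2 / 4 by rewrite divr_gt0// exprn_gt0// divr_gt0.
have [r [r01 hr]] := dilation_osc vf e20.
have /andP[r0 r1] := r01.
have [p [pp Bp pE hp]] := poly_approx fSH r01 e20.
have Br := BMOSH_dilation r01 Bf.
have bf := hardy2_boundary Bf.1; have br := hardy2_boundary Br.1.
exists p; split=> //; apply: osc_BMOSH_norm => //; first by rewrite /= pE subrr.
rewrite (_ : f \- p = (f \- dilation f r) \+ (dilation f r \- p)); last first.
  by apply/funext => x /=; rewrite addrA subrK.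
rewrite (_ : (e / 2) ^+ 2 = 2 * ((e / 2) ^+ 2 / 4) + 2 * ((e / 2) ^+ 2 / 4)); last by field.
apply: osc_leD.
- exact: has_boundaryB.
- exact: has_boundaryB br (hardy2_boundary Bp.1).
- exact: osc_le_sym br bf (hr r (lexx r) r1).
- exact: hp.
Qed.

End equivalence.

Theorem lemma5p4 (R : realType) :
  (forall f : quat R -> quat R, BMOSH R f ->
     [<-> VMOSH R f;
          BMOSH_cvg 1^'- (dilation f) f;
          BMOSH_closure (disk_algebra R) f;
          BMOSH_closure (slice_polynomials R) f]) /\
  BMOSH_closed_subspace (VMOSH R).
Proof.
have AV k : disk_algebra R k -> BMOSH R k -> VMOSH R k by exact: disk_algebra_VMOSH.
(* Polynomials are continuous on the whole space, so they are their own extensions and this case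
   reduces to [AV]. *)
have PV k : slice_polynomials R k -> BMOSH R k -> VMOSH R k.
  move=> [N [a ka]] Bk; apply: AV => //.
  have kSH : slice_hyperholomorphic R k by case: Bk => -[].
  by apply: (continuous_disk_algebra kSH (continuous_qpoly (c := a) (N := N.+1))) => x /ka ->.
split.
  move=> f Bf; tfae.
  - exact: VMOSH_dilation.
  - exact: dilation_closure.
  (* The closure of the disk algebra reaches the closure of the polynomials through [VMOSH]: the
     polynomials approximate dilations of [f] itself, not its approximants in the disk algebra. *)
  - by move=> /(VMOSH_closure AV); exact: VMOSH_poly_closure.
  - exact: VMOSH_closure.
split.
- by move=> f [].
- exact: VMOSH0.
- exact: VMOSHD.
- by move=> f a; exact: VMOSH_mulr.
- by move=> f; exact: VMOSH_closure.
Qed.
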